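(* Let $U\subset\mathbb{C}$ be a bounded domain, and let $f$ be a nonconstant function holomorphic on a neighborhood of $\overline{U}$, with zero set $Z(f)$, such that $Z(f)\cap U=\{a_1,\dots,a_N\}$ with $N\ge 1$ and $a_1,\dots,a_N$ distinct. Define $P(z):=\prod_{j=1}^N (z-a_j)$ and $$u(z):=\begin{cases}P(z)^2\log|f(z)|^2, & z\in U\setminus Z(f),\\ 0, & z\in Z(f)\cap U,\end{cases}\qquad g(z):=\begin{cases}\Delta u(z), & z\in U\setminus Z(f),\\ 0, & z\in Z(f)\cap U,\end{cases}$$ where $\Delta u$ is the classical Laplacian on $U\setminus Z(f)$. Then: (1) $u\in C^1(U)$; (2) $g\in L^\infty_{\mathrm{loc}}(U)$ and $\Delta u=g$ on $U$ in the sense of distributions; (3) $u\notin W^{2,\infty}_{\mathrm{loc}}(U)$.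
   Context: The function $u$ is complex-valued. $W^{2,\infty}_{\mathrm{loc}}(U)$ is the space of functions on $U$ whose weak derivatives of order $\le 2$ exist and belong to $L^\infty_{\mathrm{loc}}(U)$. The Laplacian is $\Delta u = 4\frac{\partial^2 u}{\partial z\,\partial\bar z}$. ''In the sense of distributions'' means $\int_U u\,\Delta\varphi\,dA=\int_U g\,\varphi\,dA$ for all $\varphi\in C_c^\infty(U)$, with $dA$ Lebesgue measure. *)

(* Defs.v *)
From HB Require Import structures.
From mathcomp Require Import all_boot all_order all_algebra.
From mathcomp Require Import all_classical all_reals all_analysis.
From mathcomp Require Import complex.

Set Implicit Arguments.
Unset Strict Implicit.
Unset Printing Implicit Defensive.

Import Order.TTheory GRing.Theory Num.Theory.
Import numFieldNormedType.Exports.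

Local Open Scope classical_set_scope.
Local Open Scope ring_scope.
Local Open Scope complex_scope.

(* R[i] carries no topology in the libraries; it gets the one induced by the
   modulus, as a normed module over itself.  Hence derivable f z 1 is complex
   differentiability for f : R[i] -> R[i]. *)
#[warnings="-redundant-canonical-projection"]
HB.instance Definition _ (R : rcfType) := NormedModule.copy R[i] R[i]^o.

Section PlaneCalculus.
Context {R : realType}.
Implicit Types (U V K : set R[i]) (F G phi : R[i] -> R[i]) (z v : R[i]).

Definition domain U : Prop := [/\ U !=set0, open U & connected U].

Definition holomorphic_on V F : Prop := forall z, V z -> derivable F z 1.

Definition imag_unit : R[i] := 0 +i* 1.

(* Derivatives along a direction v for a real parameter t, taken on the real
   and imaginary parts separately; the directions 1 and i give d/dx, d/dy. *)
Definition on_line F z v (t : R) : R[i] := F (z + t%:C * v).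

Definition dir_derivable F v z : Prop :=
  derivable (fun t => complex.Re (on_line F z v t)) 0 1 /\
  derivable (fun t => complex.Im (on_line F z v t)) 0 1.

Definition dir_derive v F z : R[i] :=
  derive1 (fun t => complex.Re (on_line F z v t)) 0 +i*
  derive1 (fun t => complex.Im (on_line F z v t)) 0.

Definition partial_x F : R[i] -> R[i] := dir_derive 1 F.
Definition partial_y F : R[i] -> R[i] := dir_derive imag_unit F.

Definition d_z F z : R[i] := 2^-1 * (partial_x F z - imag_unit * partial_y F z).
Definition d_zbar F z : R[i] := 2^-1 * (partial_x F z + imag_unit * partial_y F z).

Definition laplacian F z : R[i] := 4 * d_z (d_zbar F) z.

(* Real C^k regularity on an open set U. *)
Fixpoint Ck (k : nat) U F : Prop :=
  match k with
  | 0 => {in U, continuous F}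
  | k'.+1 => [/\ {in U, continuous F},
      forall z, U z -> dir_derivable F 1 z /\ dir_derivable F imag_unit z,
      Ck k' U (partial_x F) & Ck k' U (partial_y F)]
  end.

Definition test_function U phi : Prop :=
  let supp := closure [set z | phi z != 0] in
  [/\ forall k, Ck k setT phi, compact supp & supp `<=` U].

(* dA is the product Lebesgue measure in the coordinates (x, y) |-> x + i y. *)
Definition of_xy (p : R * R) : R[i] := p.1 +i* p.2.

Definition dA : {measure set (measurableTypeR R * measurableTypeR R) -> \bar R} :=
  (lebesgue_measure \x lebesgue_measure)%E.

Definition integral_dA U F : R[i] :=
  Rintegral dA (of_xy @^-1` U) (fun p => complex.Re (F (of_xy p))) +i*
  Rintegral dA (of_xy @^-1` U) (fun p => complex.Im (F (of_xy p))).

Definition measurable_on U F : Prop :=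
  measurable_fun (of_xy @^-1` U : set (measurableTypeR R * measurableTypeR R))
    (fun p => complex.Re (F (of_xy p))) /\
  measurable_fun (of_xy @^-1` U : set (measurableTypeR R * measurableTypeR R))
    (fun p => complex.Im (F (of_xy p))).

Definition Linfty_loc U F : Prop :=
  measurable_on U F /\
  forall K, compact K -> K `<=` U ->
    exists M : R, {ae dA, forall p, K (of_xy p) -> `|F (of_xy p)| <= M%:C}.

(* G is the weak derivative d_x^m d_y^n F on U. *)
Definition weak_derivative (m n : nat) U F G : Prop :=
  forall phi, test_function U phi ->
    integral_dA U (fun z => F z * iter m partial_x (iter n partial_y phi) z) =
    (-1) ^+ (m + n) * integral_dA U (fun z => G z * phi z).

Definition Wkinfty_loc (k : nat) U F : Prop :=
  Linfty_loc U F /\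
  forall m n, (m + n <= k)%N ->
    exists2 G, Linfty_loc U G & weak_derivative m n U F G.

Definition laplacian_distr U F G : Prop :=
  forall phi, test_function U phi ->
    integral_dA U (fun z => F z * laplacian phi z) =
    integral_dA U (fun z => G z * phi z).

End PlaneCalculus.

(* Main.v *)
(* Near a zero c of order m, f = (z - c)^m h with h(c) <> 0 and P = (z - c) Q with Q(c) <> 0, so
   that f'/f = O(1/|z - c|) and log |f|^2 = O(|z - c|^(-1/2)).  As log |f|^2 has Wirtinger
   derivatives f'/f and its conjugate, u is C^1 and
     d^2u/dz dzbar = 2 P P' conj(f'/f),    d^2u/dzbar^2 = P^2 conj((f'/f)')
   contain no logarithm and are bounded.  Integrating by parts once in z and once in zbar, with
   isolated singularities and bounded integrands, yields the distributional Laplacian.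

   The mixed derivative d^2u/dx dy does contain the logarithm: on a square of half-side e around
   c, u = C (z - c)^2 ln e + O(e^2) with C <> 0.  Testing against d_x d_y of a product bump function
   adapted to that square, an L^oo weak derivative would force |ln e| = O(1).

   The local factorization of holomorphic functions comes from Goursat's theorem and Cauchy's
   formula on squares. *)
Require Import Defs.
From HB Require Import structures.
From mathcomp Require Import all_boot all_order all_algebra.
From mathcomp Require Import all_classical all_reals all_analysis.
From mathcomp Require Import complex.
From mathcomp Require Import ring lra.

Set Implicit Arguments.
Unset Strict Implicit.
Unset Printing Implicit Defensive.

Import Order.TTheory GRing.Theory Num.Theory.
Import numFieldNormedType.Exports.

Local Open Scope classical_set_scope.
Local Open Scope ring_scope.
Local Open Scope complex_scope.
Import Normc.

Local Notation Re := complex.Re.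
Local Notation Im := complex.Im.

(** * Wirtinger differentiability *)

Section Modulus.
Context {R : realType}.
Implicit Types (z w v : R[i]) (F G : R[i] -> R[i]).

(** Why some second derivatives are bounded and others not: near a zero c the leading part of u is a
    constant times (z - c)^2 ln |z - c|. The factor (z - c)^2 is holomorphic, hence killed by
    d/dzbar, so differentiating in zbar first removes the logarithm; [laplacian] composes its two
    derivatives in that order. But d_x d_y (z - c)^2 = 2i, so the mixed derivative keeps it.
    Rescaling shows this without computing second derivatives of u: ln |z - c| = ln e + ln (|z - c|
    / e), and on a square of half-side e the second term times (z - c)^2 is O(e^2).

    The calculus rests on one relation, [wirt F z A B], a first-order expansion in z and zbar at one
    point. It covers holomorphic functions (B = 0), conjugates and logarithms, its product and
    quotient rules are algebraic, and restricted to a line it gives the real derivatives that the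
    fundamental theorem of calculus needs.

    The order m of a zero of f only enters as the factor 2m of the logarithm; P has simple zeros, so
    P^2 exactly balances (f'/f)' = O(|z - c|^-2). *)

Lemma normc_ge0 z : 0 <= normc z.
Proof. by case: z => a b; exact: sqrtr_ge0. Qed.

Lemma normc_eq0 z : (normc z == 0) = (z == 0).
Proof.
by apply/eqP/eqP => [/eq0_normc|->] //; rewrite normc0.
Qed.

Lemma normc_gt0 z : (0 < normc z) = (z != 0).
Proof. by rewrite lt_def normc_eq0 normc_ge0 andbT. Qed.

Lemma normc_exp z n : normc (z ^+ n) = normc z ^+ n.
Proof. by elim: n => [|n IH]; rewrite ?expr0 ?normc1// !exprS normcM IH. Qed.

Lemma normc_dist z w : normc (z - w) = normc (w - z).
Proof. by rewrite -normcN opprB. Qed.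

Lemma normc_conj z : normc (conjc z) = normc z.
Proof. by case: z => a b /=; rewrite sqrrN. Qed.

Lemma conjcB z w : conjc (z - w) = conjc z - conjc w. Proof. exact: rmorphB. Qed.
Lemma conjcM z w : conjc (z * w) = conjc z * conjc w. Proof. exact: rmorphM. Qed.

Lemma normc_real (r : R) : normc r%:C = `|r|.
Proof. by rewrite /= expr0n /= addr0 sqrtr_sqr. Qed.

Lemma ge_normc_Re z : `|Re z| <= normc z.
Proof.
by case: z => a b; rewrite -sqrtr_sqr ler_sqrt ?addr_ge0 ?sqr_ge0// lerDl sqr_ge0.
Qed.

Lemma ge_normc_Im z : `|Im z| <= normc z.
Proof.
by case: z => a b; rewrite -sqrtr_sqr ler_sqrt ?addr_ge0 ?sqr_ge0// lerDr sqr_ge0.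
Qed.

Lemma normc_le_ReIm z : normc z <= `|Re z| + `|Im z|.
Proof.
case: z => a b /=; rewrite -ler_sqr ?nnegrE ?addr_ge0 ?sqrtr_ge0//.
rewrite sqr_sqrtr ?addr_ge0 ?sqr_ge0// sqrrD !real_normK ?num_real//.
by rewrite addrAC lerDl mulrn_wge0// mulr_ge0.
Qed.

Lemma normc_sqr z : normc z ^+ 2 = Re (z * conjc z).
Proof.
case: z => a b; rewrite /= sqr_sqrtr ?addr_ge0 ?sqr_ge0//.
by rewrite mulrN opprK !expr2.
Qed.

Lemma Re_norm z : Re `|z| = normc z. Proof. by []. Qed.

Lemma ltc_normc z (e : R[i]) : 0 < e -> (`|z| < e) = (normc z < Re e).
Proof. by rewrite !ltcE => /andP[/eqP /= -> _]; rewrite eqxx. Qed.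

End Modulus.

(* Unification otherwise unfolds the modulus to a square root. *)
Opaque normc.

Section Calculus.
Context {R : realType}.
Implicit Types (z w v : R[i]) (F G : R[i] -> R[i]).

(** The norm of [R[i]] takes values in [R[i]], so neighbourhoods come with complex radii; the later
    estimates run on real ones. *)
Lemma nbhs_normcP z (A : set R[i]) :
  nbhs z A <-> exists2 e : R, 0 < e & forall w, normc (w - z) < e -> A w.
Proof.
split.
  move/nbhs_normP => [e /= e0 H].
  exists (Re e); first by move: e0; rewrite ltcE => /andP[].
  by move=> w wz; apply: H; rewrite /ball_ /= distrC ltc_normc.
move=> [e e0 H]; apply/nbhs_normP; exists e%:C => /=; first by rewrite ltcR.
by move=> w /=; rewrite /ball_ /= distrC; rewrite ltc_normc ?ltcR// => wz; exact: H.
Qed.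

Lemma cvg_normcP (T : Type) (D : set_system T) {FD : Filter D}
    (F : T -> R[i]) (l : R[i]) :
  F @ D --> l <-> forall e : R, 0 < e -> \forall x \near D, normc (F x - l) < e.
Proof.
split=> [Fl e e0|H A /nbhs_normcP[e e0 eA]].
  by have /Fl : nbhs l [set y | normc (y - l) < e] by apply/nbhs_normcP; exists e.
have := H e e0; apply: filterS => x; exact: eA.
Qed.

Lemma continuous_normcP F z : {for z, continuous F} <->
  forall e : R, 0 < e -> \forall w \near z, normc (F w - F z) < e.
Proof. exact: (@cvg_normcP _ (nbhs z) (nbhs_filter z)). Qed.

Lemma normc_near z (e : R) : 0 < e -> \forall w \near z, normc (w - z) < e.
Proof. by move=> e0; apply/nbhs_normcP; exists e. Qed.

Lemma nearC1 z (P Q : set R[i]) : nbhs z P -> (forall w, P w -> Q w) -> nbhs z Q.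
Proof. by move=> zP PQ; apply: filterS zP. Qed.

Lemma nearC2 z (P Q S : set R[i]) : nbhs z P -> nbhs z Q ->
  (forall w, P w -> Q w -> S w) -> nbhs z S.
Proof. by move=> zP zQ PQS; apply: filterS2 zP zQ. Qed.

Lemma nearCW z (P : set R[i]) : (forall w, P w) -> nbhs z P.
Proof. by move=> H; exact: (filterS (fun w _ => H w) filterT). Qed.

Definition small_o z (r : R[i] -> R[i]) :=
  forall e : R, 0 < e -> \forall w \near z, normc (r w) <= e * normc (w - z).

Lemma small_o_ext z r s :
  (\forall w \near z, r w = s w) -> small_o z r -> small_o z s.
Proof.
by move=> rs nr e e0; near=> w; rewrite -(near rs w)//; near: w; exact: nr.
Unshelve. all: by end_near. Qed.

Lemma small_oD z r s :
  small_o z r -> small_o z s -> small_o z (fun w => r w + s w).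
Proof.
move=> nr ns e e0; have e2 : 0 < e / 2 by lra.
apply: nearC2 (nr _ e2) (ns _ e2) _ => w H K.
by apply: le_trans (le_normcD _ _) _; lra.
Qed.

Lemma small_oM z r G (M : R) : small_o z r ->
  (\forall w \near z, normc (G w) <= M) -> small_o z (fun w => r w * G w).
Proof.
move=> nr GM e e0.
have M0 : 0 < Num.max M 1 by rewrite lt_max ltr01 orbT.
have eM : 0 < e / Num.max M 1 by rewrite divr_gt0.
apply: nearC2 (nr _ eM) GM _ => w H K; rewrite normcM.
have GK : normc (G w) <= Num.max M 1 by rewrite le_max K.
apply: le_trans (ler_pM (normc_ge0 _) (normc_ge0 _) H GK) _.
by rewrite mulrAC divfK ?gt_eqF.
Qed.

(** O(|w - z|) times o(1): the cross term of the product rule, and the quadratic term in the rule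
    for inverses. *)
Lemma small_o_cvg0 z r G (M : R) :
  (\forall w \near z, normc (r w) <= M * normc (w - z)) ->
  (forall e : R, 0 < e -> \forall w \near z, normc (G w) <= e) ->
  small_o z (fun w => r w * G w).
Proof.
move=> rM G0 e e0.
have M0 : 0 < Num.max M 1 by rewrite lt_max ltr01 orbT.
have eM : 0 < e / Num.max M 1 by rewrite divr_gt0.
apply: nearC2 rM (G0 _ eM) _ => w H K; rewrite normcM.
have H' : normc (r w) <= Num.max M 1 * normc (w - z).
  by apply: le_trans H _; rewrite ler_wpM2r ?normc_ge0// le_max lexx.
apply: le_trans (ler_pM (normc_ge0 _) (normc_ge0 _) H' K) _.
by rewrite mulrC mulrA divfK ?gt_eqF.
Qed.

(* [wirt F z A B]: F is real-differentiable at z with Wirtinger derivatives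
   A = dF/dz and B = dF/dzbar. *)
Definition wirt F z (A B : R[i]) :=
  small_o z (fun w => F w - F z - A * (w - z) - B * conjc (w - z)).

Lemma wirt_lipschitz F z A B : wirt F z A B ->
  \forall w \near z, normc (F w - F z) <= (normc A + normc B + 1) * normc (w - z).
Proof.
move=> /(_ 1 ltr01)/nearC1; apply => w H.
rewrite (_ : F w - F z = (F w - F z - A * (w - z) - B * conjc (w - z)) +
  (A * (w - z) + B * conjc (w - z))); last by ring.
apply: le_trans (le_normcD _ _) _.
have := le_normcD (A * (w - z)) (B * conjc (w - z)).
by rewrite !normcM normc_conj; lra.
Qed.

Lemma wirt_small F z A B : wirt F z A B ->
  forall e : R, 0 < e -> \forall w \near z, normc (F w - F z) <= e.
Proof.
move=> FAB e e0; set C := normc A + normc B + 1.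
have C0 : 0 < C by have := normc_ge0 A; have := normc_ge0 B; rewrite /C; lra.
have eC : 0 < e / C by rewrite divr_gt0.
apply: nearC2 (wirt_lipschitz FAB) (normc_near z eC) _ => w H K.
apply: le_trans H _; rewrite -/C mulrC -ler_pdivlMr//; exact: ltW.
Qed.

Lemma wirt_continuous F z A B : wirt F z A B -> {for z, continuous F}.
Proof.
move=> FAB; apply/continuous_normcP => e e0.
have e2 : 0 < e / 2 by lra.
by apply: nearC1 (wirt_small FAB e2) _ => w; lra.
Qed.

Lemma wirt_bounded F z A B : wirt F z A B ->
  \forall w \near z, normc (F w) <= normc (F z) + 1.
Proof.
move=> /wirt_small/(_ 1 ltr01)/nearC1; apply => w H.
have := le_normcD (F w - F z) (F z).
by rewrite subrK; lra.
Qed.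

Lemma continuous_normc_bounded F z : {for z, continuous F} ->
  \forall w \near z, normc (F w) <= normc (F z) + 1.
Proof.
move=> /continuous_normcP/(_ 1 ltr01)/nearC1; apply => w H.
have := le_normcD (F w - F z) (F z).
by rewrite subrK; lra.
Qed.

Lemma wirt_ext F G z A B : (\forall w \near z, F w = G w) ->
  wirt F z A B -> wirt G z A B.
Proof.
move=> FG; have FGz := nbhs_singleton FG.
by apply: small_o_ext; apply: nearC1 FG _ => w ->; rewrite FGz.
Qed.

Lemma wirt_cst (c : R[i]) z : wirt (fun=> c) z 0 0.
Proof.
move=> e e0; near=> w.
by rewrite subrr !mul0r !subr0 normc0 mulr_ge0 ?normc_ge0// ltW.
Unshelve. all: by end_near. Qed.

Lemma wirt_id z : wirt id z 1 0.
Proof.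
move=> e e0; near=> w.
by rewrite mul1r subrr mul0r subr0 normc0 mulr_ge0 ?normc_ge0// ltW.
Unshelve. all: by end_near. Qed.

Lemma wirtD F G z A B A' B' : wirt F z A B -> wirt G z A' B' ->
  wirt (fun w => F w + G w) z (A + A') (B + B').
Proof.
move=> FAB GAB; apply: small_o_ext (small_oD FAB GAB).
by near=> w; ring.
Unshelve. all: by end_near. Qed.

Lemma wirtM F G z A B A' B' : wirt F z A B -> wirt G z A' B' ->
  wirt (fun w => F w * G w) z (A * G z + F z * A') (B * G z + F z * B').
Proof.
move=> FAB GAB.
(* With r_F and r_G the remainders of F and G, that of the product is r_F G(w) + F(z) r_G + (A (w -
   z) + B conj(w - z)) (G(w) - G(z)). *)
have H1 := small_oM FAB (wirt_bounded GAB).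
have H2 := small_oM (M := normc (F z)) GAB (nearCW z (fun=> lexx _)).
have H3 : small_o z
    (fun w => (A * (w - z) + B * conjc (w - z)) * (G w - G z)).
  apply: (@small_o_cvg0 _ _ _ (normc A + normc B)); last exact: wirt_small GAB.
  near=> w; have := le_normcD (A * (w - z)) (B * conjc (w - z)).
  by rewrite !normcM normc_conj mulrDl.
apply: small_o_ext (small_oD H1 (small_oD H2 H3)).
by near=> w; ring.
Unshelve. all: by end_near. Qed.

Lemma wirt_eq F z A B A' B' : wirt F z A B -> A = A' -> B = B' -> wirt F z A' B'.
Proof. by move=> H <- <-. Qed.

Lemma wirtZ F z A B c : wirt F z A B -> wirt (fun w => c * F w) z (c * A) (c * B).
Proof. by move=> /(wirtM (wirt_cst c z))/wirt_eq; apply; ring. Qed.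

Lemma wirtB F G z A B A' B' : wirt F z A B -> wirt G z A' B' ->
  wirt (fun w => F w - G w) z (A - A') (B - B').
Proof.
move=> FAB /(wirtZ (-1)) GAB; have H := wirtD FAB GAB.
apply: wirt_eq (_ : wirt _ _ (A + -1 * A') (B + -1 * B')) _ _; try ring.
by apply: wirt_ext H; near=> w; ring.
Unshelve. all: by end_near. Qed.

Lemma wirt_conj F z A B : wirt F z A B -> wirt (fun w => conjc (F w)) z (conjc B) (conjc A).
Proof.
move=> FAB e e0; apply: nearC1 (FAB e e0) _ => w.
rewrite -(normc_conj (F w - _ - _ - _)).
rewrite !(conjcB, conjcM, conjcK) => H.
by rewrite addrAC.
Qed.

Lemma wirtV F z A B : F z != 0 -> wirt F z A B ->
  wirt (fun w => (F w)^-1) z (- A / F z ^+ 2) (- B / F z ^+ 2).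
Proof.
move=> Fz0 FAB; set c := normc (F z).
have c0 : 0 < c by rewrite normc_gt0.
have c2 : 0 < c / 2 by lra.
have Fw : \forall w \near z, c / 2 <= normc (F w).
  apply: nearC1 (wirt_small FAB c2) _ => w H.
  by have := le_normcD (F w) (F z - F w); rewrite addrC subrK normc_dist -/c; lra.
have Fw0 : \forall w \near z, F w != 0.
  by apply: nearC1 Fw _ => w; rewrite -normc_gt0; lra.
(* 1/F(w) - 1/F(z) = - (F(w) - F(z)) / F(z)^2 + (F(w) - F(z))^2 / (F(w) F(z)^2): [H1] is the
   remainder of the first term, [H2] is the second term. *)
have H1 : small_o z (fun w => (F w - F z - A * (w - z) - B * conjc (w - z)) *
    (- (F z)^-2)).
  exact: (small_oM (M := normc (- (F z)^-2)) FAB (nearCW z (fun=> lexx _))).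
have H2 : small_o z (fun w => (F w - F z) *
   ((F w - F z) * ((F w)^-1 * (F z)^-2))).
  apply: small_o_cvg0 (wirt_lipschitz FAB) _ => e e0.
  have e1 : 0 < e * (c / 2) * c ^+ 2 by rewrite !mulr_gt0// exprn_gt0.
  apply: nearC2 Fw (wirt_small FAB e1) _ => w K H.
  have Kp : 0 < normc (F w) by lra.
  rewrite 2!normcM !normcV normc_exp -/c.
  rewrite mulrA ler_pdivrMr ?exprn_gt0// ler_pdivrMr//.
  apply: le_trans H _; rewrite -!mulrA !ler_pM2l// expr2 mulrCA ler_pM2l//; lra.
apply: small_o_ext (small_oD H1 H2).
by apply: nearC1 Fw0 _ => w w0; field; rewrite w0 Fz0.
Qed.

Lemma derivable_wirt F z : derivable F z 1 -> exists A, wirt F z A 0.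
Proof.
move=> /cvg_ex[A /cvg_normcP H]; exists A => e e0.
have := H e e0; rewrite near_withinE => /nbhs_normcP[d d0 K].
apply/nbhs_normcP; exists d => // w wz.
have [->|wz0] := eqVneq w z.
  by rewrite !subrr conjc0 !mulr0 !subr0 normc0 mulr0.
have := K (w - z); rewrite subr0 subr_eq0 => /(_ wz wz0).
have -> : (F \o shift z) (w - z)%:A = F w.
  by congr F; rewrite -[LHS]/((w - z) * 1 + z) mulr1 subrK.
rewrite -[_ *: _]/((w - z)^-1 * (F w - F z)) => /ltW L.
have wz1 : 0 < normc (w - z) by rewrite normc_gt0 subr_eq0.
rewrite mul0r subr0 (_ : _ - _ - _ = ((w - z)^-1 * (F w - F z) - A) * (w - z)).
  by rewrite normcM ler_wpM2r// ltW.
by field; rewrite subr_eq0.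
Qed.

End Calculus.

(** * Directional derivatives and the logarithm of a modulus *)

Section Partials.
Context {R : realType}.
Implicit Types (z w v : R[i]) (F G : R[i] -> R[i]).

(** Puts real derivatives in the same form as [small_o], so that restricting [wirt] to a line only
    compares two estimates. *)
Lemma is_derive_estimate (f : R -> R) (x d : R) :
  is_derive x 1 f d <->
  forall e : R, 0 < e -> \forall y \near x, `|f y - f x - d * (y - x)| <= e * `|y - x|.
Proof.
split=> [[df <-] e e0|H].
  have /cvgrPdist_lt/(_ e e0) : h^-1 *: (f (h *: 1 + x) - f x) @[h --> 0^'] --> 'D_1 f x by [].
  rewrite near_withinE => /nbhs_normP[r /= r0 K].
  apply/nbhs_normP; exists r => // y; rewrite /ball_ /= => xy.
  have [->|yx] := eqVneq y x; first by rewrite !subrr mulr0 subr0 normr0 mulr0.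
  have yx0 : y - x != 0 by rewrite subr_eq0.
  have xy' : ball_ Num.Def.normr 0 r (y - x) by rewrite /ball_/= sub0r normrN distrC.
  have := K (y - x) xy' yx0.
  rewrite -[_ *: 1]/((y - x) * 1) mulr1 subrK -[_ *: _]/((y - x)^-1 * _).
  move=> /ltW L.
  have := ler_wpM2r (normr_ge0 (y - x)) L.
  by rewrite -normrM mulrBl mulrAC mulVf// mul1r distrC.
have H' : h^-1 *: (f (h *: 1 + x) - f x) @[h --> 0^'] --> d.
  apply/cvgrPdist_le => e e0.
  have /nbhs_normP[r /= r0 K] := H e e0.
  rewrite near_withinE; apply/nbhs_normP; exists r => // h; rewrite /ball_ /=.
  rewrite sub0r normrN => hr h0.
  have := K (h + x); rewrite /ball_ /= opprD addrCA subrr addr0 normrN addrK => /(_ hr).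
  rewrite -[_ *: 1]/(h * 1) mulr1 -[_ *: _]/(h^-1 * _) => L.
  have h1 : 0 < `|h| by rewrite normr_gt0.
  by rewrite -(ler_pM2r h1) -normrM mulrBl mulrAC mulVf// mul1r distrC.
apply: DeriveDef; first by apply/cvg_ex; exists d.
exact/cvg_lim.
Qed.

Lemma near_line (z v : R[i]) (t : R) (P : set R[i]) :
  nbhs (z + t%:C * v) P -> \forall s \near t, P (z + s%:C * v).
Proof.
move=> /nbhs_normcP[e e0 H].
have v1 : 0 < normc v + 1 by have := normc_ge0 v; lra.
apply/nbhs_normP; exists (e / (normc v + 1)) => /=; first by rewrite divr_gt0.
move=> s; rewrite /ball_ /= => ts; apply: H.
rewrite (_ : _ - _ = (s - t)%:C * v); last by rewrite rmorphB/=; ring.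
rewrite normcM normc_real distrC.
move: ts; rewrite ltr_pdivlMr//; apply: le_lt_trans.
by rewrite ler_wpM2l// lerDl ler01.
Qed.

Lemma Re_sub z w : Re (z - w) = Re z - Re w.
Proof. by case: z w => a b []. Qed.
Lemma Im_sub z w : Im (z - w) = Im z - Im w.
Proof. by case: z w => a b []. Qed.
Lemma Re_scale (r : R) z : Re (r%:C * z) = r * Re z.
Proof. by case: z => a b /=; rewrite mul0r subr0. Qed.
Lemma Im_scale (r : R) z : Im (r%:C * z) = r * Im z.
Proof. by case: z => a b /=; rewrite mul0r addr0. Qed.

Lemma wirt_line F z v (t : R) A B : wirt F (z + t%:C * v) A B ->
  forall e : R, 0 < e -> \forall s \near t,
    normc (on_line F z v s - on_line F z v t - (s - t)%:C * (A * v + B * conjc v))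
      <= e * `|s - t|.
Proof.
move=> FAB e e0.
have v1 : 0 < normc v + 1 by have := normc_ge0 v; lra.
have /near_line := FAB (e / (normc v + 1)) (divr_gt0 e0 v1).
apply: filterS => s.
have -> : z + s%:C * v - (z + t%:C * v) = (s - t)%:C * v by rewrite rmorphB/=; ring.
rewrite conjcM conjc_real /on_line => H.
rewrite (_ : _ - _ - _ = F (z + s%:C * v) - F (z + t%:C * v) -
  A * ((s - t)%:C * v) - B * ((s - t)%:C * conjc v)); last by ring.
apply: le_trans H _; rewrite normcM normc_real mulrAC ler_pdivrMr//.
by rewrite -mulrA ler_wpM2l ?(ltW e0)// ler_wpM2l// lerDl ler01.
Qed.

Lemma wirt_line_Re F z v (t : R) A B : wirt F (z + t%:C * v) A B ->
  is_derive t 1 (fun s => Re (on_line F z v s)) (Re (A * v + B * conjc v)).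
Proof.
move=> FAB; apply/is_derive_estimate => e e0.
apply: filterS (wirt_line FAB e0) => s; apply: le_trans.
by apply: le_trans (ge_normc_Re _); rewrite !Re_sub Re_scale mulrC.
Qed.

Lemma wirt_line_Im F z v (t : R) A B : wirt F (z + t%:C * v) A B ->
  is_derive t 1 (fun s => Im (on_line F z v s)) (Im (A * v + B * conjc v)).
Proof.
move=> FAB; apply/is_derive_estimate => e e0.
apply: filterS (wirt_line FAB e0) => s; apply: le_trans.
by apply: le_trans (ge_normc_Im _); rewrite !Im_sub Im_scale mulrC.
Qed.

Lemma wirt_dir F z v A B : wirt F z A B ->
  dir_derivable F v z /\ dir_derive v F z = A * v + B * conjc v.
Proof.
move=> FAB; have FAB0 : wirt F (z + 0%:C * v) A B by rewrite mul0r addr0.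
have dRe := wirt_line_Re FAB0; have dIm := wirt_line_Im FAB0.
split; first by split; apply: ex_derive.
rewrite /dir_derive !derive1E !derive_val.
by case: (A * v + B * conjc v).
Qed.

Lemma conjc_imag_unit : conjc (imag_unit : R[i]) = - imag_unit.
Proof. by rewrite /imag_unit; apply/eqP; rewrite eq_complex /= oppr0 !eqxx. Qed.

Lemma imag_unit_sqr : imag_unit * imag_unit = -1 :> R[i].
Proof. by rewrite -expr2; exact: sqr_i. Qed.

Lemma wirt_partial_x F z A B : wirt F z A B -> partial_x F z = A + B.
Proof. by move=> /(wirt_dir 1)[_]; rewrite /partial_x => ->; rewrite conjc1 !mulr1. Qed.

Lemma wirt_partial_y F z A B : wirt F z A B -> partial_y F z = imag_unit * (A - B).
Proof.
by move=> /(wirt_dir imag_unit)[_]; rewrite /partial_y => ->; rewrite conjc_imag_unit; ring.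
Qed.

Lemma wirt_d_z F z A B : wirt F z A B -> d_z F z = A.
Proof.
move=> FAB; rewrite /d_z (wirt_partial_x FAB) (wirt_partial_y FAB).
by rewrite mulrA imag_unit_sqr; field.
Qed.

Lemma wirt_d_zbar F z A B : wirt F z A B -> d_zbar F z = B.
Proof.
move=> FAB; rewrite /d_zbar (wirt_partial_x FAB) (wirt_partial_y FAB).
by rewrite mulrA imag_unit_sqr; field.
Qed.

Lemma wirt_real_comp (phi : R -> R) (d : R) F z A B :
  (\forall w \near z, F w = (Re (F w))%:C) ->
  is_derive (Re (F z)) 1 phi d -> wirt F z A B ->
  wirt (fun w => (phi (Re (F w)))%:C) z (d%:C * A) (d%:C * B).
Proof.
move=> Freal /is_derive_estimate dphi FAB.
have H1 := small_oM (M := normc d%:C) FAB (nearCW z (fun=> lexx _)).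
have H2 : small_o z (fun w => (phi (Re (F w)) - phi (Re (F z))
    - d * (Re (F w) - Re (F z)))%:C).
  move=> e e0; set C := normc A + normc B + 1.
  have C0 : 0 < C by have := normc_ge0 A; have := normc_ge0 B; rewrite /C; lra.
  have /nbhs_normP[r /= r0 K] := dphi (e / C) (divr_gt0 e0 C0).
  have r2 : 0 < r / 2 by lra.
  apply: nearC2 (wirt_small FAB r2) (wirt_lipschitz FAB) _ => w Fw1 Fw2.
  have RF : `|Re (F w) - Re (F z)| <= normc (F w - F z).
    by rewrite -Re_sub ge_normc_Re.
  rewrite normc_real; apply: le_trans (K _ _) _.
    by rewrite /ball_ /= distrC; lra.
  rewrite mulrAC ler_pdivrMr// -mulrA ler_wpM2l ?(ltW e0)//.
  by rewrite mulrC; exact: le_trans Fw2.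
have Fz := nbhs_singleton Freal.
apply: small_o_ext (small_oD H1 H2).
apply: nearC1 Freal _ => w Fw.
rewrite !rmorphB/= rmorphM/= rmorphB/= -Fw -Fz.
by ring.
Qed.

(** |F|^2 = F conj(F) has Wirtinger derivatives A conj(F) and F conj(A); the chain rule for [ln]
    divides them by |F|^2, which cancels one factor in each. *)
Lemma wirt_ln_norm F z A : F z != 0 -> wirt F z A 0 ->
  wirt (fun w => (ln (normc (F w) ^+ 2))%:C) z (A / F z) (conjc (A / F z)).
Proof.
move=> Fz0 FA.
have E w : normc (F w) ^+ 2 = Re (F w * conjc (F w)) by exact: normc_sqr.
have c0 : 0 < normc (F z) ^+ 2 by rewrite exprn_gt0 ?normc_gt0.
have dln : is_derive (Re (F z * conjc (F z))) 1 (@ln R) (normc (F z) ^+ 2)^-1.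
  by rewrite -E; exact: is_derive1_ln.
have Freal w : F w * conjc (F w) = (Re (F w * conjc (F w)))%:C.
  by case: (F w) => a b; apply/eqP; rewrite eq_complex /= eqxx /= mulrN mulrC addNr eqxx.
have := wirt_real_comp (nearCW z Freal) dln (wirtM FA (wirt_conj FA)).
have N : (normc (F z) ^+ 2)^-1%:C = (F z * conjc (F z))^-1.
  by rewrite Freal -E fmorphV.
have Fb0 : conjc (F z) != 0 by rewrite conjc_eq0.
rewrite N conjc0 mulr0 addr0 mul0r add0r.
move=> /wirt_eq H; have := H (A / F z) (conjc (A / F z)).
rewrite (_ : (fun w => (ln (normc (F w) ^+ 2))%:C) =
  (fun w => (ln (Re (F w * conjc (F w))))%:C)); last first.
  by apply/funext => w; rewrite E.
apply; first by field; rewrite Fz0.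
rewrite conjcM conjc_inv; field; first by rewrite Fb0.
Qed.

End Partials.

(** * Integrals over segments and rectangles *)

Section SegmentIntegral.
Context {R : realType}.
Implicit Types (z w c : R[i]) (F G : R[i] -> R[i]) (f g : R -> R[i]) (a b t M : R).
Notation mu := (@lebesgue_measure R).

Definition ccontinuous f t :=
  {for t, continuous (fun s => Re (f s))} /\
  {for t, continuous (fun s => Im (f s))}.

Definition ccontinuous_on a b f := forall t, a <= t <= b -> ccontinuous f t.

Definition cint a b f : R[i] :=
  (\int[mu]_(t in `[a, b]) Re (f t)) +i* (\int[mu]_(t in `[a, b]) Im (f t)).

Lemma integrable_segment a b (h : R -> R) :
  (forall t, a <= t <= b -> {for t, continuous h}) -> mu.-integrable `[a, b] (EFin \o h).
Proof.
move=> ch; apply: continuous_compact_integrable; first exact: segment_compact.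
by apply: continuous_in_subspaceT => t; rewrite inE /= in_itv /=; exact: ch.
Qed.

Lemma lebesgue_segment a b : a <= b -> fine (mu `[a, b]) = b - a.
Proof.
move=> ab; rewrite lebesgue_measure_itv /= lte_fin; case: ltgtP ab => // -> _.
by rewrite subrr.
Qed.

Lemma Re_add z w : Re (z + w) = Re z + Re w.
Proof. by case: z w => x y []. Qed.
Lemma Im_add z w : Im (z + w) = Im z + Im w.
Proof. by case: z w => x y []. Qed.
Lemma Re_mul z w : Re (z * w) =
  Re z * Re w - Im z * Im w.
Proof. by case: z w => x y []. Qed.
Lemma Im_mul z w : Im (z * w) =
  Re z * Im w + Im z * Re w.
Proof. by case: z w => x y [u v] /=; rewrite addrC; congr (_ + _); rewrite mulrC. Qed.

Lemma complex_eq z w : Re z = Re w -> Im z = Im w -> z = w.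
Proof. by case: z w => x y [u v] /= -> ->. Qed.

Lemma ccontinuousZ c f t : ccontinuous f t -> ccontinuous (fun s => c * f s) t.
Proof.
move=> [fr fi]; split.
  rewrite (_ : (fun s => _) = (fun s => Re c * Re (f s) - Im c * Im (f s))).
    by apply: continuousB; apply: continuousM => //; exact: cst_continuous.
  by apply/funext => s; rewrite Re_mul.
rewrite (_ : (fun s => _) = (fun s => Re c * Im (f s) + Im c * Re (f s))).
  by apply: continuousD; apply: continuousM => //; exact: cst_continuous.
by apply/funext => s; rewrite Im_mul.
Qed.

Lemma ccontinuous_line F z v t : {for z + t%:C * v, continuous F} ->
  ccontinuous (fun s => F (z + s%:C * v)) t.
Proof.
move=> /continuous_normcP FC.
have H e : 0 < e -> \forall s \near t, normc (F (z + s%:C * v) - F (z + t%:C * v)) < e.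
  by move=> /FC/near_line.
split; apply/cvgrPdist_lt => e e0; apply: filterS (H e e0) => s; apply: le_lt_trans.
  by rewrite -Re_sub normc_dist; exact: ge_normc_Re.
by rewrite -Im_sub normc_dist; exact: ge_normc_Im.
Qed.

Lemma horizontalE (x y : R) : x +i* y = (0 +i* y) + x%:C * 1.
Proof. by rewrite mulr1; apply: complex_eq; rewrite /= ?add0r ?addr0. Qed.

Lemma verticalE (x y : R) : x +i* y = (x +i* 0) + y%:C * imag_unit.
Proof.
by apply: complex_eq; rewrite /= ?mul0r ?mulr0 ?subr0 ?mulr1 ?addr0 ?add0r ?subrr ?addr0.
Qed.

Lemma ccontinuous_horizontal F (x y : R) : {for x +i* y, continuous F} ->
  ccontinuous (fun s => F (s +i* y)) x.
Proof.
rewrite horizontalE => /ccontinuous_line.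
by under eq_fun => s do rewrite -horizontalE.
Qed.

Lemma ccontinuous_vertical F (x y : R) : {for x +i* y, continuous F} ->
  ccontinuous (fun s => F (x +i* s)) y.
Proof.
rewrite verticalE => /ccontinuous_line.
by under eq_fun => s do rewrite -verticalE.
Qed.

Section Linear.
Variables (a b : R) (f g : R -> R[i]).
Hypotheses (fc : ccontinuous_on a b f) (gc : ccontinuous_on a b g).

Lemma integrable_Re : mu.-integrable `[a, b] (EFin \o (fun t => Re (f t))).
Proof. by apply: integrable_segment => t /fc[]. Qed.

Lemma integrable_Im : mu.-integrable `[a, b] (EFin \o (fun t => Im (f t))).
Proof. by apply: integrable_segment => t /fc[]. Qed.

End Linear.

Lemma cintD a b f g : ccontinuous_on a b f -> ccontinuous_on a b g ->
  cint a b (fun t => f t + g t) = cint a b f + cint a b g.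
Proof.
move=> fc gc; apply: complex_eq; rewrite /= ?Re_add ?Im_add.
  under eq_Rintegral do rewrite Re_add.
  by rewrite RintegralD//; exact: integrable_Re.
under eq_Rintegral do rewrite Im_add.
by rewrite RintegralD//; exact: integrable_Im.
Qed.

Lemma cintZ a b c f : ccontinuous_on a b f ->
  cint a b (fun t => c * f t) = c * cint a b f.
Proof.
move=> fc; have ir := integrable_Re fc; have ii := integrable_Im fc.
have irZ r : mu.-integrable `[a, b] (EFin \o (fun t => r * Re (f t))).
  by apply: integrable_segment => t /fc[? _]; apply: continuousM => //; exact: cst_continuous.
have iiZ r : mu.-integrable `[a, b] (EFin \o (fun t => r * Im (f t))).
  by apply: integrable_segment => t /fc[_ ?]; apply: continuousM => //; exact: cst_continuous.
apply: complex_eq; rewrite ?Re_mul ?Im_mul /=.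
  under eq_Rintegral do rewrite Re_mul.
  by rewrite RintegralB// !RintegralZl.
under eq_Rintegral do rewrite Im_mul.
by rewrite RintegralD// !RintegralZl.
Qed.

Lemma eq_cint a b f g : (forall t, a <= t <= b -> f t = g t) -> cint a b f = cint a b g.
Proof.
move=> fg; apply: complex_eq => /=; apply: eq_Rintegral => t;
  by rewrite inE /= in_itv /= => /fg ->.
Qed.

Lemma cint_cst a b c : a <= b -> cint a b (fun=> c) = (b - a)%:C * c.
Proof.
move=> ab; apply: complex_eq; rewrite /= Rintegral_cst// lebesgue_segment// mulrC.
  by case: c => x y /=; rewrite mul0r subr0.
by case: c => x y /=; rewrite mul0r addr0.
Qed.

Lemma Rintegral_segment_bound a b (h : R -> R) M : a <= b ->
  (forall t, a <= t <= b -> {for t, continuous h}) ->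
  (forall t, a <= t <= b -> `|h t| <= M) ->
  `|\int[mu]_(t in `[a, b]) h t| <= (b - a) * M.
Proof.
move=> ab hc hM; have hi := integrable_segment hc.
apply: le_trans (le_normr_Rintegral _ hi) _; first by [].
rewrite mulrC -lebesgue_segment// -Rintegral_cst//.
have hn : mu.-integrable `[a, b] (EFin \o (fun t => `|h t|)).
  by apply: integrable_segment => t /hc ht; apply: continuous_comp ht _; exact: norm_continuous.
have hM' : mu.-integrable `[a, b] (EFin \o (fun=> M)).
  by apply: integrable_segment => t _; exact: cst_continuous.
by apply: le_Rintegral hn hM' _ => // t /=; rewrite in_itv /=; exact: hM.
Qed.

(** The factor 2 comes from bounding the real and imaginary parts separately. *)
Lemma cint_bound a b f M : a <= b -> ccontinuous_on a b f ->
  (forall t, a <= t <= b -> normc (f t) <= M) ->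
  normc (cint a b f) <= 2 * (b - a) * M.
Proof.
move=> ab fc fM; apply: le_trans (normc_le_ReIm _) _; rewrite /=.
rewrite -mulrA mulr_natl mulr2n lerD//; apply: Rintegral_segment_bound => //.
- by move=> t /fc[].
- by move=> t /fM; exact: le_trans (ge_normc_Re _).
- by move=> t /fc[].
- by move=> t /fM; exact: le_trans (ge_normc_Im _).
Qed.

Lemma Rintegral_segment_cat a b d (h : R -> R) : a <= b -> b <= d ->
  mu.-integrable `[a, d] (EFin \o h) ->
  \int[mu]_(t in `[a, d]) h t = \int[mu]_(t in `[a, b]) h t + \int[mu]_(t in `[b, d]) h t.
Proof.
move=> ab bd hi; have := @Rintegral_itvB R h (BLeft a) (BRight d) b hi.
rewrite !bnd_simp => /(_ ab bd) E.
rewrite -(@Rintegral_itv_obnd_cbnd _ b); first by rewrite -E addrC subrK.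
by apply: integrableS hi => //; apply: subset_itvr; rewrite bnd_simp.
Qed.

Lemma cint_cat a b d f : a <= b -> b <= d -> ccontinuous_on a d f ->
  cint a d f = cint a b f + cint b d f.
Proof.
move=> ab bd fc; apply: complex_eq => /=; apply: Rintegral_segment_cat => //.
  exact: integrable_Re.
exact: integrable_Im.
Qed.

End SegmentIntegral.

(** * Contour integrals over rectangles *)

Section RectangleIntegral.
Context {R : realType}.
Implicit Types (z w c : R[i]) (F G : R[i] -> R[i]) (x y M : R).

Definition rdiff F z := exists A B, wirt F z A B.
Definition holo F z := exists A, wirt F z A 0.

Lemma holo_rdiff F z : holo F z -> rdiff F z.
Proof. by move=> [A FA]; exists A, 0. Qed.

Lemma rdiff_continuous F z : rdiff F z -> {for z, continuous F}.
Proof. by move=> [A [B FAB]]; exact: wirt_continuous FAB. Qed.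

Lemma rdiffD F G z : rdiff F z -> rdiff G z -> rdiff (fun w => F w + G w) z.
Proof. by move=> [A [B FAB]] [A' [B' GAB]]; do 2!eexists; exact: wirtD FAB GAB. Qed.

Lemma rdiffM F G z : rdiff F z -> rdiff G z -> rdiff (fun w => F w * G w) z.
Proof. by move=> [A [B FAB]] [A' [B' GAB]]; do 2!eexists; exact: wirtM FAB GAB. Qed.

Lemma rdiff_cst c z : rdiff (fun=> c) z.
Proof. by do 2!eexists; exact: wirt_cst. Qed.

Lemma holoD F G z : holo F z -> holo G z -> holo (fun w => F w + G w) z.
Proof. by move=> [A FA] [B GB]; exists (A + B); rewrite -[X in wirt _ _ _ X]addr0; exact: wirtD. Qed.

Lemma holoM F G z : holo F z -> holo G z -> holo (fun w => F w * G w) z.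
Proof.
by move=> [A FA] [B GB]; eexists; apply: wirt_eq (wirtM FA GB) erefl _; rewrite mul0r mulr0 addr0.
Qed.

Lemma holo_cst c z : holo (fun=> c) z.
Proof. by exists 0; exact: wirt_cst. Qed.

Lemma holo_id z : holo id z.
Proof. by exists 1; exact: wirt_id. Qed.

Lemma holoV F z : F z != 0 -> holo F z -> holo (fun w => (F w)^-1) z.
Proof.
by move=> Fz0 [A FA]; eexists; apply: wirt_eq (wirtV Fz0 FA) erefl _; rewrite oppr0 mul0r.
Qed.

Lemma holoX F n z : holo F z -> holo (fun w => F w ^+ n) z.
Proof.
move=> hF; elim: n => [|n IH]; first exact: holo_cst.
by under eq_fun => w do rewrite exprS; exact: holoM.
Qed.

Lemma holo_ext F G z : (\forall w \near z, F w = G w) -> holo F z -> holo G z.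
Proof. by move=> FG [A FA]; exists A; exact: wirt_ext FA. Qed.

Lemma holo_sub c z : holo (fun w => w - c) z.
Proof. exact: (holoD (holo_id z) (holo_cst (- c) z)). Qed.

Definition rect x0 x1 y0 y1 z :=
  x0 <= Re z <= x1 /\ y0 <= Im z <= y1.

Definition rect_boundary x0 x1 y0 y1 z := rect x0 x1 y0 y1 z /\
  [\/ Re z = x0, Re z = x1, Im z = y0 | Im z = y1].

(** Real differentiability supplies the continuity of contour integrands and is stable under sums
    and products. *)
Definition rdiff_on (D : R[i] -> Prop) F := forall z, D z -> rdiff F z.

(** The counterclockwise contour integral of F dz: dz is dx on the horizontal sides and i dy on the
    vertical ones. *)
Definition rint x0 x1 y0 y1 F : R[i] :=
  cint x0 x1 (fun s => F (s +i* y0)) - cint x0 x1 (fun s => F (s +i* y1)) +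
  imag_unit * (cint y0 y1 (fun s => F (x1 +i* s)) - cint y0 y1 (fun s => F (x0 +i* s))).

Section OneRectangle.
Variables (x0 x1 y0 y1 : R).
Hypotheses (x01 : x0 <= x1) (y01 : y0 <= y1).
Notation bd := (rect_boundary x0 x1 y0 y1).

Lemma boundary_bottom s : x0 <= s <= x1 -> bd (s +i* y0).
Proof. by move=> xs; split; [rewrite /rect /= xs lexx y01|constructor 3]. Qed.
Lemma boundary_top s : x0 <= s <= x1 -> bd (s +i* y1).
Proof. by move=> xs; split; [rewrite /rect /= xs lexx y01|constructor 4]. Qed.
Lemma boundary_left s : y0 <= s <= y1 -> bd (x0 +i* s).
Proof. by move=> xs; split; [rewrite /rect /= xs lexx x01|constructor 1]. Qed.
Lemma boundary_right s : y0 <= s <= y1 -> bd (x1 +i* s).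
Proof. by move=> xs; split; [rewrite /rect /= xs lexx x01|constructor 2]. Qed.

Lemma boundary_sides F : rdiff_on bd F ->
  [/\ ccontinuous_on x0 x1 (fun s => F (s +i* y0)),
      ccontinuous_on x0 x1 (fun s => F (s +i* y1)),
      ccontinuous_on y0 y1 (fun s => F (x1 +i* s)) &
      ccontinuous_on y0 y1 (fun s => F (x0 +i* s))].
Proof.
move=> FD; split=> s sab.
- by apply: ccontinuous_horizontal; exact/rdiff_continuous/FD/boundary_bottom.
- by apply: ccontinuous_horizontal; exact/rdiff_continuous/FD/boundary_top.
- by apply: ccontinuous_vertical; exact/rdiff_continuous/FD/boundary_right.
- by apply: ccontinuous_vertical; exact/rdiff_continuous/FD/boundary_left.
Qed.

Lemma rintD F G : rdiff_on bd F -> rdiff_on bd G ->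
  rint x0 x1 y0 y1 (fun z => F z + G z) = rint x0 x1 y0 y1 F + rint x0 x1 y0 y1 G.
Proof.
move=> /boundary_sides[F1 F2 F3 F4] /boundary_sides[G1 G2 G3 G4].
by rewrite /rint !cintD//; ring.
Qed.

Lemma rintZ c F : rdiff_on bd F ->
  rint x0 x1 y0 y1 (fun z => c * F z) = c * rint x0 x1 y0 y1 F.
Proof. by move=> /boundary_sides[F1 F2 F3 F4]; rewrite /rint !cintZ//; ring. Qed.

Lemma eq_rint F G : (forall z, bd z -> F z = G z) ->
  rint x0 x1 y0 y1 F = rint x0 x1 y0 y1 G.
Proof.
move=> FG; rewrite /rint; congr (_ - _ + _ * (_ - _)); apply: eq_cint => s sab; apply: FG.
- exact: boundary_bottom.
- exact: boundary_top.
- exact: boundary_right.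
- exact: boundary_left.
Qed.

Lemma rint_bound F M : rdiff_on bd F -> (forall z, bd z -> normc (F z) <= M) ->
  normc (rint x0 x1 y0 y1 F) <= 4 * ((x1 - x0) + (y1 - y0)) * M.
Proof.
move=> /boundary_sides[F1 F2 F3 F4] FM; rewrite /rint.
have B1 := cint_bound x01 F1 (fun s sab => FM _ (boundary_bottom sab)).
have B2 := cint_bound x01 F2 (fun s sab => FM _ (boundary_top sab)).
have B3 := cint_bound y01 F3 (fun s sab => FM _ (boundary_right sab)).
have B4 := cint_bound y01 F4 (fun s sab => FM _ (boundary_left sab)).
apply: le_trans (le_normcD _ _) _.
have := le_normcD (cint x0 x1 (fun s => F (s +i* y0))) (- cint x0 x1 (fun s => F (s +i* y1))).
have := le_normcD (cint y0 y1 (fun s => F (x1 +i* s))) (- cint y0 y1 (fun s => F (x0 +i* s))).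
rewrite !normcN normcM.
have -> : normc (imag_unit : R[i]) = 1.
  apply/eqP; rewrite -sqrp_eq1 ?normc_ge0// normc_sqr /imag_unit /=.
  by rewrite mul0r mul1r opprK add0r.
lra.
Qed.

(** For the identity, the values on opposite sides differ by the constants i (y0 - y1) and x1 - x0,
    and the two contributions cancel. Goursat's argument subtracts the first-order Taylor polynomial
    by means of this. *)
Lemma rint_affine c d : rint x0 x1 y0 y1 (fun z => c + d * z) = 0.
Proof.
have dz : rdiff_on bd (fun z => d * z).
  by move=> z _; apply: rdiffM; [exact: rdiff_cst|exact/holo_rdiff/holo_id].
have dc : rdiff_on bd (fun=> c) by move=> z _; exact: rdiff_cst.
have di : rdiff_on bd id by move=> z _; exact/holo_rdiff/holo_id.
rewrite rintD// rintZ//.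
have -> : rint x0 x1 y0 y1 (fun=> c) = 0 by rewrite /rint !subrr mulr0 addr0.
suff -> : rint x0 x1 y0 y1 id = 0 by rewrite mulr0 addr0.
have [F1 F2 F3 F4] := boundary_sides di.
have S a b f g : ccontinuous_on a b f -> ccontinuous_on a b g ->
    cint a b f - cint a b g = cint a b (fun t : R => f t + -1 * g t).
  move=> fc gc; rewrite cintD// ?cintZ//; first by rewrite mulN1r.
  by move=> t /gc; exact: ccontinuousZ.
rewrite /rint !S//.
rewrite (@eq_cint _ x0 x1 _ (fun=> imag_unit * (y0 - y1)%:C)); last first.
  by move=> t _; apply: complex_eq; rewrite /imag_unit /=; ring.
rewrite (@eq_cint _ y0 y1 _ (fun=> (x1 - x0)%:C)); last first.
  by move=> t _; apply: complex_eq; rewrite /imag_unit /=; ring.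
by rewrite !cint_cst// !rmorphB/=; ring.
Qed.

Lemma boundary_bounded F : rdiff_on bd F -> exists M, forall z, bd z -> normc (F z) <= M.
Proof.
have H a b (f : R -> R[i]) : a <= b -> ccontinuous_on a b f ->
    exists M, forall t, a <= t <= b -> normc (f t) <= M.
  move=> ab fc.
  have K (h : R -> R) : (forall t, a <= t <= b -> {for t, continuous h}) ->
      exists M, forall t, a <= t <= b -> `|h t| <= M.
    move=> hc.
    have nc : {within `[a, b], continuous (fun t => `|h t|)}.
      apply: continuous_in_subspaceT => t; rewrite inE /= in_itv /= => /hc ht.
      by apply: continuous_comp ht _; exact: norm_continuous.
    have [m _ mP] := EVT_max ab nc.
    by exists `|h m| => t tab; apply: mP; rewrite in_itv.
  have [M1 H1] := K _ (fun t tab => (fc t tab).1).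
  have [M2 H2] := K _ (fun t tab => (fc t tab).2).
  exists (M1 + M2) => t tab; apply: le_trans (normc_le_ReIm _) _.
  by apply: lerD; [exact: H1|exact: H2].
move=> /boundary_sides[F1 F2 F3 F4].
have [M1 H1] := H _ _ _ x01 F1; have [M2 H2] := H _ _ _ x01 F2.
have [M3 H3] := H _ _ _ y01 F3; have [M4 H4] := H _ _ _ y01 F4.
exists (Num.max (Num.max M1 M2) (Num.max M3 M4)) => -[x y] [[/= xs ys] /= [] E].
- by rewrite E !le_max H4// !orbT.
- by rewrite E !le_max H3// !orbT.
- by rewrite E !le_max H1.
- by rewrite E !le_max H2// !orbT.
Qed.

End OneRectangle.

Lemma rint_split_x x0 m x1 y0 y1 F : x0 <= m -> m <= x1 -> y0 <= y1 ->
  rdiff_on (rect_boundary x0 x1 y0 y1) F ->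
  rint x0 x1 y0 y1 F = rint x0 m y0 y1 F + rint m x1 y0 y1 F.
Proof.
move=> xm mx yy FD; have xx := le_trans xm mx.
have [F1 F2 F3 F4] := boundary_sides xx yy FD.
by rewrite /rint (cint_cat xm mx F1) (cint_cat xm mx F2); ring.
Qed.

Lemma rint_split_y x0 x1 y0 m y1 F : x0 <= x1 -> y0 <= m -> m <= y1 ->
  rdiff_on (rect_boundary x0 x1 y0 y1) F ->
  rint x0 x1 y0 y1 F = rint x0 x1 y0 m F + rint x0 x1 m y1 F.
Proof.
move=> xx ym my FD; have yy := le_trans ym my.
have [F1 F2 F3 F4] := boundary_sides xx yy FD.
by rewrite /rint (cint_cat ym my F3) (cint_cat ym my F4); ring.
Qed.

End RectangleIntegral.

(** * Goursat's theorem and Cauchy's formula *)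

Section Goursat.
Context {R : realType}.
Implicit Types (z : R[i]) (F G : R[i] -> R[i]) (x y w h e : R).

Lemma rect_boundary_sub x0 x1 y0 y1 x0' x1' y0' y1' z :
  x0 <= x0' -> x1' <= x1 -> y0 <= y0' -> y1' <= y1 ->
  rect x0' x1' y0' y1' z -> rect x0 x1 y0 y1 z.
Proof. by move=> ? ? ? ? [/andP[? ?] /andP[? ?]]; split; apply/andP; split; lra. Qed.

(** Halving both sides divides the square of the semi-perimeter by 4, so if all four quarters
    violated the lower bound, their sum would violate the original one. This shape of the bound
    survives iteration with the same e. *)
Lemma quarter_rectangle e F x y w h : 0 <= w -> 0 <= h ->
  rdiff_on (rect x (x + (w + w)) y (y + (h + h))) F ->
  e * ((w + w) + (h + h)) ^+ 2 < normc (rint x (x + (w + w)) y (y + (h + h)) F) ->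
  exists x' y', [/\ x <= x' <= x + w, y <= y' <= y + h &
    e * (w + h) ^+ 2 < normc (rint x' (x' + w) y' (y' + h) F)].
Proof.
move=> w0 h0 FD big.
have FD' a b c d : x <= a -> b <= x + (w + w) -> y <= c -> d <= y + (h + h) ->
    rdiff_on (rect_boundary a b c d) F.
  by move=> ? ? ? ? z [/rect_boundary_sub-/(_ x (x + (w + w)) y (y + (h + h))) H _]; apply: FD; exact: H.
have E : rint x (x + (w + w)) y (y + (h + h)) F =
    rint x (x + w) y (y + h) F + rint x (x + w) (y + h) (y + h + h) F +
    (rint (x + w) (x + w + w) y (y + h) F +
     rint (x + w) (x + w + w) (y + h) (y + h + h) F).
  rewrite (@rint_split_x _ _ (x + w)); [|lra|lra|lra|by apply: FD'; lra].
  rewrite (@rint_split_y _ x _ _ (y + h)); [|lra|lra|lra|by apply: FD'; lra].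
  rewrite (@rint_split_y _ (x + w) _ _ (y + h)); [|lra|lra|lra|by apply: FD'; lra].
  by rewrite (addrA x w w) (addrA y h h).
apply: contrapT => /forallNP none.
have small x' y' : x <= x' <= x + w -> y <= y' <= y + h ->
    normc (rint x' (x' + w) y' (y' + h) F) <= e * (w + h) ^+ 2.
  move=> xx yy; rewrite leNgt; apply/negP => lt.
  by apply: (none x'); exists y'.
move: big; rewrite E; apply/negP; rewrite -leNgt.
have -> : e * ((w + w) + (h + h)) ^+ 2 =
    (e * (w + h) ^+ 2 + e * (w + h) ^+ 2) + (e * (w + h) ^+ 2 + e * (w + h) ^+ 2) by ring.
by do 2!apply: le_trans (le_normcD _ _) (lerD _ _); apply: small; lra.
Qed.

Lemma goursat F x y w h : 0 <= w -> 0 <= h ->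
  (forall z, rect x (x + w) y (y + h) z -> holo F z) ->
  rint x (x + w) y (y + h) F = 0.
Proof.
move=> w0 h0 FH; apply/eqP; rewrite -normc_eq0; apply/negP => /negP I0.
set I := normc _ in I0.
have Ipos : 0 < I by rewrite lt_def I0 normc_ge0.
have S0 : 0 < (w + h) ^+ 2 + 1 by rewrite ltr_wpDl// sqr_ge0.
(* The summand 1 makes the initial bound strict and the denominator positive even for a degenerate
   rectangle. *)
pose e := I / ((w + h) ^+ 2 + 1).
have e0 : 0 < e by rewrite divr_gt0.
pose W n := w / 2 ^+ n; pose H n := h / 2 ^+ n.
have W2 n : W n = W n.+1 + W n.+1.
  by rewrite /W exprS; field; rewrite expf_neq0.
have H2 n : H n = H n.+1 + H n.+1.
  by rewrite /H exprS; field; rewrite expf_neq0.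
have W0 n : 0 <= W n by rewrite divr_ge0// exprn_ge0.
have H0 n : 0 <= H n by rewrite divr_ge0// exprn_ge0.
pose good (p : nat * (R * R)) := [/\ x <= p.2.1, p.2.1 + W p.1 <= x + w,
   y <= p.2.2, p.2.2 + H p.1 <= y + h &
   e * (W p.1 + H p.1) ^+ 2 <
     normc (rint p.2.1 (p.2.1 + W p.1) p.2.2 (p.2.2 + H p.1) F)].
(* Conditional on [good p], so that every state has a successor, as dependent choice requires;
   goodness of all states then follows by induction from [good0]. *)
pose next (p q : nat * (R * R)) := good p -> [/\ good q, q.1 = p.1.+1,
  p.2.1 <= q.2.1 <= p.2.1 + W q.1 & p.2.2 <= q.2.2 <= p.2.2 + H q.1].
have FD a b c d : x <= a -> b <= x + w -> y <= c -> d <= y + h ->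
    forall z, rect a b c d z -> holo F z.
  by move=> ? ? ? ? z /(rect_boundary_sub (x0 := x) (x1 := x + w) (y0 := y) (y1 := y + h))
    Hz; apply/FH/Hz.
have step p : {q | next p q}.
  apply: cid; case: (pselect (good p)) => [gp|ngp]; last by exists p => /ngp.
  case: p gp => n [u v] [/= xu uw yv vh]; rewrite [W n]W2 [H n]H2 => big.
  have := uw; have := vh; rewrite [W n]W2 [H n]H2 => vh' uw'.
  have [u' [v' [uu vv small]]] := quarter_rectangle (W0 n.+1) (H0 n.+1)
    (fun z rz => holo_rdiff (FD _ _ _ _ xu uw' yv vh' z rz)) big.
  exists (n.+1, (u', v')) => _; split => //=; split=> //=; lra.
have good0 : good (0%N, (x, y)).
  split; rewrite /= /W /H ?expr0 ?divr1 ?lexx// /e -/I.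
  by rewrite mulrAC ltr_pdivrMr// ltr_pM2l// ltrDl.
have [s [s0 sS]] := dependent_choice step (0%N, (x, y)).
have sg n : good (s n) /\ (s n).1 = n.
  elim: n => [|n [gn En]]; first by rewrite s0.
  by have [gS -> _ _] := sS n gn; rewrite En.
have snest n m : (n <= m)%N -> [/\ (s n).2.1 <= (s m).2.1,
    (s m).2.1 + W m <= (s n).2.1 + W n, (s n).2.2 <= (s m).2.2 &
    (s m).2.2 + H m <= (s n).2.2 + H n].
  elim: m => [|m IH]; first by rewrite leqn0 => /eqP ->; split.
  rewrite leq_eqVlt => /orP[/eqP ->|/IH[a b c d]]; first by split.
  have [_ _] := sS m (sg m).1; rewrite (sg m.+1).2 => /andP[a1 a2] /andP[b1 b2].
  by split; move: (W2 m) (H2 m) b d; lra.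
(* P + iQ lies in all the nested rectangles: P and Q are the suprema of the lower left corners, and
   every right or upper side is an upper bound. *)
pose P := sup (range (fun n => (s n).2.1)); pose Q := sup (range (fun n => (s n).2.2)).
have cross1 n m : (s m).2.1 <= (s n).2.1 + W n.
  case: (leqP m n) => [/snest[mn _ _ _]|/ltnW/snest[_ nm _ _]].
    by have := W0 n; lra.
  by have := W0 m; lra.
have cross2 n m : (s m).2.2 <= (s n).2.2 + H n.
  case: (leqP m n) => [/snest[_ _ mn _]|/ltnW/snest[_ _ _ nm]].
    by have := H0 n; lra.
  by have := H0 m; lra.
have Pn n : (s n).2.1 <= P <= (s n).2.1 + W n.
  apply/andP; split.
    apply: ub_le_sup; last by exists n.
    by exists ((s 0%N).2.1 + W 0%N) => _ [m _ <-]; exact: cross1.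
  apply: ge_sup; first by exists ((s n).2.1), n.
  by move=> _ [m _ <-]; exact: cross1.
have Qn n : (s n).2.2 <= Q <= (s n).2.2 + H n.
  apply/andP; split.
    apply: ub_le_sup; last by exists n.
    by exists ((s 0%N).2.2 + H 0%N) => _ [m _ <-]; exact: cross2.
  apply: ge_sup; first by exists ((s n).2.2), n.
  by move=> _ [m _ <-]; exact: cross2.
have [A FA] : holo F (P +i* Q).
  apply: FH; split => /=.
    by have := Pn 0%N; rewrite s0 /= /W expr0 divr1.
  by have := Qn 0%N; rewrite s0 /= /H expr0 divr1.
(* Minus its Taylor polynomial, F is at most e / 4 times the semi-perimeter on the small rectangle;
   the constant 4 of [rint_bound] then gives exactly e times the squared semi-perimeter, against
   [big]. *)
have e4 : 0 < e / 4 by lra.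
have /nbhs_normcP[d d0 near_d] := FA _ e4.
pose n := Num.bound ((w + h) / d).
have nd : W n + H n < d.
  have := upper_nthrootP (leqnn n); rewrite -/n ltr_pdivrMr// => lt.
  by rewrite /W /H -mulrDl ltr_pdivrMr ?exprn_gt0// mulrC.
have [xs sx ys sy] := (sg n).1.
rewrite (sg n).2; set a := (s n).2.1; set b := (s n).2.2 => big.
have an : a <= P <= a + W n := Pn n.
have bn : b <= Q <= b + H n := Qn n.
have aff z : rdiff (fun z => (A * (P +i* Q) - F (P +i* Q)) + (- A) * z) z.
  apply: rdiffD; first exact: rdiff_cst.
  by apply: rdiffM; [exact: rdiff_cst|exact/holo_rdiff/holo_id].
have aw : a <= a + W n by rewrite lerDl.
have bh : b <= b + H n by rewrite lerDl.
have Fd : rdiff_on (rect_boundary a (a + W n) b (b + H n)) F.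
  move=> z [rz _]; apply/holo_rdiff; apply: FD rz => //.
    by move: sx; rewrite (sg n).2.
  by move: sy; rewrite (sg n).2.
have E := rintD aw bh Fd (fun z _ => aff z).
rewrite rint_affine// addr0 in E.
move: big; rewrite -E; apply/negP; rewrite -leNgt.
have M z : rect_boundary a (a + W n) b (b + H n) z ->
    normc (F z + ((A * (P +i* Q) - F (P +i* Q)) + (- A) * z)) <= e / 4 * (W n + H n).
  move=> [[zx zy] _].
  have zn : normc (z - (P +i* Q)) <= W n + H n.
    apply: le_trans (normc_le_ReIm _) _; rewrite Re_sub Im_sub /=.
    by apply: lerD; rewrite ler_norml; apply/andP; split; lra.
  have := near_d z (le_lt_trans zn nd); rewrite mul0r subr0 => le.
  apply: le_trans (le_trans _ le) _; last by rewrite ler_wpM2l// ltW.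
  by rewrite le_eqVlt; apply/orP; left; apply/eqP; congr normc; ring.
have := rint_bound aw bh (fun z bz => rdiffD (Fd z bz) (aff z)) M.
move/le_trans; apply; rewrite le_eqVlt; apply/orP; left; apply/eqP.
by field.
Qed.

End Goursat.

(** * Contour integrals around a bounded singularity *)

Section Cauchy.
Context {R : realType}.
Implicit Types (z w : R[i]) (F G phi : R[i] -> R[i]) (r M : R).
Variables (x0 x1 y0 y1 : R).
Notation rc := (rect x0 x1 y0 y1).
Notation bd := (rect_boundary x0 x1 y0 y1).
Notation "'oint' F" := (rint x0 x1 y0 y1 F) (at level 10).

Definition rect_interior z := x0 < Re z < x1 /\ y0 < Im z < y1.

Lemma cauchy_rect F a b c d : a <= b -> c <= d ->
  (forall z, rect a b c d z -> holo F z) -> rint a b c d F = 0.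
Proof.
move=> ab cd FH; rewrite (_ : b = a + (b - a)); last by lra.
rewrite (_ : d = c + (d - c)); last by lra.
apply: goursat; [lra|lra|] => z.
by rewrite addrC subrK (addrC c) subrK; exact: FH.
Qed.

(** Four cuts isolate a square of half-side d around z. The four outer rectangles contribute 0 by
    Goursat's theorem, and the square at most 16 d M, which tends to 0 with d. *)
Lemma cauchy_bounded G z M r : rect_interior z -> 0 < r ->
  (forall w, rc w -> w != z -> holo G w) ->
  (forall w, w != z -> normc (w - z) < r -> normc (G w) <= M) ->
  oint G = 0.
Proof.
move: z => [p q] [/= /andP[xp px] /andP[yq qy]] r0 GH GM.
have sub a b c d w : x0 <= a -> b <= x1 -> y0 <= c -> d <= y1 ->
    rect a b c d w -> w != p +i* q -> holo G w.
  by move=> ? ? ? ? H; apply: GH; apply: rect_boundary_sub H.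
have neq (w : R[i]) : (Re w != p) || (Im w != q) -> w != p +i* q.
  by move=> H; rewrite eq_complex negb_and.
have neqB a b c d (w : R[i]) : a < p -> p < b -> c < q -> q < d ->
    rect_boundary a b c d w -> w != p +i* q.
  move=> ? ? ? ? [_ E]; apply: neq; apply/orP.
  by case: E => ->; [left; rewrite lt_eqF|left; rewrite gt_eqF|right; rewrite lt_eqF|right; rewrite gt_eqF].
have on_bd a b c d : x0 <= a -> a < p -> p < b -> b <= x1 -> y0 <= c -> c < q -> q < d -> d <= y1 ->
    rdiff_on (rect_boundary a b c d) G.
  move=> xa ap pb bx yc cq qd dy w bw; apply: holo_rdiff.
  exact: sub xa bx yc dy bw.1 (neqB _ _ _ _ _ ap pb cq qd bw).
have off a b c d : x0 <= a -> a <= b -> b <= x1 -> y0 <= c -> c <= d -> d <= y1 ->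
    [|| b < p, p < a, d < q | q < c] -> rint a b c d G = 0.
  move=> xa ab bx yc cd dy H; apply: cauchy_rect => // w rw.
  apply: sub (rw) _ => //; apply: neq; apply: contraTT H; rewrite negb_or !negbK.
  case: rw => /andP[h1 h2] /andP[h3 h4] /andP[/eqP E1 /eqP E2].
  by rewrite !negb_or -!leNgt -{1}E1 -E2 h2 h4 h3 -E1 h1.
have small d : 0 < d -> d < r / 2 -> x0 < p - d -> p + d < x1 -> y0 < q - d -> q + d < y1 ->
    normc (oint G) <= 16 * d * M.
  move=> d0 dr xd dx yd dy.
  have pd1 : p - d < p by lra.
  have pd2 : p < p + d by lra.
  have qd1 : q - d < q by lra.
  have qd2 : q < q + d by lra.
  have pd : p - d <= p + d by lra.
  have qd : q - d <= q + d by lra.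
  have D1 := on_bd _ _ _ _ (lexx x0) xp px (lexx x1) (lexx y0) yq qy (lexx y1).
  have D2 := on_bd _ _ _ _ (ltW xd) pd1 px (lexx x1) (lexx y0) yq qy (lexx y1).
  have D3 := on_bd _ _ _ _ (ltW xd) pd1 pd2 (ltW dx) (lexx y0) yq qy (lexx y1).
  have D4 := on_bd _ _ _ _ (ltW xd) pd1 pd2 (ltW dx) (ltW yd) qd1 qy (lexx y1).
  have D5 := on_bd _ _ _ _ (ltW xd) pd1 pd2 (ltW dx) (ltW yd) qd1 qd2 (ltW dy).
  rewrite (rint_split_x (m := p - d) _ _ _ D1); [|lra|lra|lra].
  rewrite (off x0 (p - d)) ?pd1 ?orbT ?add0r//; [|lra|lra|lra].
  rewrite (rint_split_x (m := p + d) _ _ _ D2); [|lra|lra|lra].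
  rewrite (off (p + d) x1) ?pd2 ?orbT ?addr0//; [|lra|lra|lra].
  rewrite (rint_split_y (m := q - d) _ _ _ D3); [|lra|lra|lra].
  rewrite (off _ _ y0 (q - d)) ?qd1 ?orbT ?add0r//; [|lra|lra|lra|lra].
  rewrite (rint_split_y (m := q + d) _ _ _ D4); [|lra|lra|lra].
  rewrite (off _ _ (q + d) y1) ?qd2 ?orbT ?addr0//; [|lra|lra|lra|lra].
  have B : forall w, rect_boundary (p - d) (p + d) (q - d) (q + d) w -> normc (G w) <= M.
    move=> [u v] bw; apply: GM; first by apply: neqB bw; lra.
    case: bw => -[/= uu vv] _.
    apply: le_lt_trans (normc_le_ReIm _) _ => /=.
    apply: (@le_lt_trans _ _ (d + d)); last lra.
    by apply: lerD; rewrite ler_norml; apply/andP; split; lra.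
  apply: le_trans (rint_bound pd qd D5 B) _.
  by rewrite le_eqVlt; apply/orP; left; apply/eqP; ring.
apply/eqP; rewrite -normc_eq0; apply/negP => /negP I0.
have {}I0 : 0 < normc (oint G) by rewrite lt_def I0 normc_ge0.
set I := normc _ in I0 small.
pose M' := Num.max M 1.
have M0 : 0 < M' by rewrite lt_max ltr01 orbT.
have MM : M <= M' by rewrite le_max lexx.
(* 17 beats the constant 16 of [small]; the other terms keep the square inside the rectangle and
   inside the disc where G is bounded. *)
pose d := Num.min (Num.min (r / 4) (I / (17 * M')))
  (Num.min (Num.min ((p - x0) / 2) ((x1 - p) / 2)) (Num.min ((q - y0) / 2) ((y1 - q) / 2))).
have d0 : 0 < d.
  by rewrite !lt_min !divr_gt0 ?mulr_gt0//; lra.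
have : d <= d by []. rewrite {2}/d !le_min => /andP[/andP[d1 d2] /andP[/andP[d3 d4] /andP[d5 d6]]].
have := small d d0; rewrite -/I => H.
have {}H : I <= 16 * d * M by apply: H; lra.
move: d2; rewrite ler_pdivlMr ?mulr_gt0// => d2.
have : 16 * d * M <= 16 * d * M' by rewrite ler_wpM2l// mulr_ge0// ltW.
have dM : 0 < d * M' by rewrite mulr_gt0.
by move: d2; rewrite mulrCA => d2; rewrite -mulrA => ?; lra.
Qed.

End Cauchy.

(** * Cauchy's formula and Cauchy transforms *)

Section CauchyFormula.
Context {R : realType}.
Implicit Types (z w : R[i]) (F G phi : R[i] -> R[i]) (r M : R).
Variables (x0 x1 y0 y1 : R).
Notation rc := (rect x0 x1 y0 y1).
Notation bd := (rect_boundary x0 x1 y0 y1).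
Notation "'oint' F" := (rint x0 x1 y0 y1 F) (at level 10).
Hypotheses (x01 : x0 < x1) (y01 : y0 < y1).

Lemma boundary_neq z w : rect_interior x0 x1 y0 y1 z -> bd w -> w - z != 0.
Proof.
case: z w => p q [u v] [/= ? ?] [_ /= E]; rewrite subr_eq0; apply/eqP => -[? ?]; subst.
by case: E => /= ?; lra.
Qed.

Lemma interior_dist z : rect_interior x0 x1 y0 y1 z ->
  exists2 d, 0 < d & forall w, bd w -> d <= normc (w - z).
Proof.
case: z => p q [/= /andP[xp px] /andP[yq qy]].
exists (Num.min (Num.min (p - x0) (x1 - p)) (Num.min (q - y0) (y1 - q))).
  by rewrite !lt_min; lra.
move=> [u v] [_ /= E]; case: E => ->.
- apply: le_trans (ge_normc_Re _); rewrite /= ler0_norm ?opprB; last lra.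
  by rewrite !ge_min lexx.
- apply: le_trans (ge_normc_Re _); rewrite /= ger0_norm; last lra.
  by rewrite !ge_min lexx orbT.
- apply: le_trans (ge_normc_Im _); rewrite /= ler0_norm ?opprB; last lra.
  by rewrite !ge_min lexx !orbT.
- apply: le_trans (ge_normc_Im _); rewrite /= ger0_norm; last lra.
  by rewrite !ge_min lexx !orbT.
Qed.

Lemma holo_kernel z w k : w - z != 0 -> holo (fun t => (t - z) ^- k) w.
Proof.
by move=> wz; apply: holoV; [rewrite expf_neq0|apply: holoX; exact: holo_sub].
Qed.

Lemma kernel_rdiff phi z k : rect_interior x0 x1 y0 y1 z -> rdiff_on bd phi ->
  rdiff_on bd (fun w => phi w * (w - z) ^- k).
Proof.
move=> zi phid w bw; apply: rdiffM; first exact: phid.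
by apply/holo_rdiff/holo_kernel/boundary_neq.
Qed.

(* Not divided by 2 pi i: Cauchy's formula compares the transform of F with that of 1, about which
   only nonvanishing is needed. *)
Definition cauchy_transform k phi z := oint (fun w => phi w * (w - z) ^- k).

(** The difference quotient (F(w) - F(z)) / (w - z) is holomorphic off z and bounded near z because
    F is Lipschitz at z, so its contour integral vanishes. *)
Lemma cauchy_formula F z : rect_interior x0 x1 y0 y1 z -> (forall w, rc w -> holo F w) ->
  cauchy_transform 1 F z = F z * cauchy_transform 1 (fun=> 1) z.
Proof.
move=> zi FH.
have zr : rc z by case: zi => /andP[? ?] /andP[? ?]; split; lra.
have bF : rdiff_on bd F by move=> w [rw _]; exact/holo_rdiff/FH.
have b1 : rdiff_on bd (fun=> 1) by move=> w _; exact: rdiff_cst.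
have k1 := kernel_rdiff 1 zi b1.
have kc : rdiff_on bd (fun w => - F z * (1 * (w - z) ^- 1)).
  by move=> w bw; apply: rdiffM; [exact: rdiff_cst|exact: k1].
suff : oint (fun w => F w * (w - z) ^- 1 + - F z * (1 * (w - z) ^- 1)) = 0.
  rewrite rintD ?(ltW x01) ?(ltW y01)//; last exact: kernel_rdiff.
  rewrite rintZ ?(ltW x01) ?(ltW y01)// => /eqP.
  by rewrite mulNr subr_eq0 => /eqP.
have [A FA] := FH z zr.
have /nbhs_normcP[d d0 H] := wirt_lipschitz FA.
apply: (@cauchy_bounded _ x0 x1 y0 y1 _ z (normc A + normc 0 + 1) d) => // w.
  move=> rw; rewrite -subr_eq0 => wz; apply: holoD; first apply: holoM (FH _ rw) _.
    exact: holo_kernel.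
  by apply: holoM; [exact: holo_cst|apply: holoM; [exact: holo_cst|exact: holo_kernel]].
rewrite -subr_eq0 => wz /H {}H.
rewrite mul1r -mulrDl normcM normcV expr1 ler_pdivrMr//.
by rewrite normc_gt0.
Qed.

(** Differentiation under the integral sign: a quadratic remainder, uniform over the contour, takes
    the place of a convergence theorem. *)
Lemma rint_kernel phi (K : R[i] -> R[i] -> R[i]) (K' : R[i] -> R[i]) z (C : R) :
  rdiff_on bd (fun t => phi t * K' t) ->
  (\forall w \near z, rdiff_on bd (fun t => phi t * K w t)) ->
  rdiff_on bd phi ->
  (\forall w \near z, forall t, bd t ->
     normc (K w t - K z t - K' t * (w - z)) <= C * normc (w - z) ^+ 2) ->
  wirt (fun w => oint (fun t => phi t * K w t)) z (oint (fun t => phi t * K' t)) 0.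
Proof.
move=> dK' dK dphi KC.
have [M phiM] := boundary_bounded (ltW x01) (ltW y01) dphi.
pose M' := Num.max M 1; pose C' := Num.max C 1.
have M0 : 0 < M' by rewrite lt_max ltr01 orbT.
have C0 : 0 < C' by rewrite lt_max ltr01 orbT.
pose L := 4 * ((x1 - x0) + (y1 - y0)).
have L0 : 0 < L by apply: mulr_gt0 => //; apply: addr_gt0; rewrite subr_gt0.
have D0 : 0 < L * (M' * C') by apply: mulr_gt0 => //; apply: mulr_gt0.
move=> e e0.
have near_e : \forall w \near z, normc (w - z) < e / (L * (M' * C')).
  by apply: normc_near; rewrite divr_gt0.
have dKz := nbhs_singleton dK.
have near_K : \forall w \near z, rdiff_on bd (fun t => phi t * K w t) /\
    forall t, bd t -> normc (K w t - K z t - K' t * (w - z)) <= C * normc (w - z) ^+ 2.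
  by apply: nearC2 dK KC _ => w; split.
apply: nearC2 near_e near_K _ => w we [dKw KCw].
have x01' := ltW x01; have y01' := ltW y01.
have dZ c (f : R[i] -> R[i]) : rdiff_on bd f -> rdiff_on bd (fun t => c * f t).
  by move=> df t bt; apply: rdiffM; [exact: rdiff_cst|exact: df].
have dD (f g : R[i] -> R[i]) : rdiff_on bd f -> rdiff_on bd g ->
    rdiff_on bd (fun t => f t + g t).
  by move=> df dg t bt; apply: rdiffD; [exact: df|exact: dg].
have E : oint (fun t => phi t * K w t) - oint (fun t => phi t * K z t) -
    oint (fun t => phi t * K' t) * (w - z) - 0 * conjc (w - z) =
    oint (fun t => phi t * K w t + (-1 * (phi t * K z t) + (- (w - z)) * (phi t * K' t))).
  rewrite rintD//; last by apply: dD; exact: dZ.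
  by rewrite rintD ?rintZ//; [ring|exact: dZ|exact: dZ].
rewrite E.
have dall : rdiff_on bd (fun t => phi t * K w t +
    (-1 * (phi t * K z t) + (- (w - z)) * (phi t * K' t))).
  by apply: (dD) => //; apply: dD; exact: dZ.
apply: le_trans (rint_bound x01' y01' (M := M' * (C' * normc (w - z) ^+ 2)) dall _) _.
  move=> t bt.
  rewrite (_ : _ + _ = phi t * (K w t - K z t - K' t * (w - z))); last by ring.
  rewrite normcM ler_pM ?normc_ge0//.
    by apply: le_trans (phiM t bt) _; rewrite le_max lexx.
  by apply: le_trans (KCw t bt) _; rewrite ler_wpM2r ?sqr_ge0// le_max lexx.
move: we; rewrite ltr_pdivlMr// => /ltW we.
have := ler_wpM2l (normc_ge0 (w - z)) we.
rewrite -/L expr2 mulrC (mulrC e).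
by congr (_ <= _); ring.
Qed.

Lemma cauchy_transform1_wirt phi z : rect_interior x0 x1 y0 y1 z -> rdiff_on bd phi ->
  wirt (cauchy_transform 1 phi) z (cauchy_transform 2 phi z) 0.
Proof.
move=> zi dphi; have [d d0 dP] := interior_dist zi.
have d2 : 0 < d / 2 by lra.
have near_i : \forall w \near z, normc (w - z) < d / 2 by exact: normc_near.
have far w : normc (w - z) < d / 2 -> forall t, bd t -> d / 2 <= normc (t - w).
  move=> wz t /dP zt; have := le_normcD (t - w) (w - z).
  by rewrite addrA subrK; lra.
have nz w : normc (w - z) < d / 2 -> forall t, bd t -> t - w != 0.
  by move=> /far H t /H; rewrite -normc_gt0; lra.
(* The remainder of the kernel is (w - z)^2 / ((t - w) (t - z)^2), where |t - w| >= d / 2 and |t -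
   z| >= d. *)
apply: (@rint_kernel _ (fun w t => (t - w) ^- 1) (fun t => (t - z) ^- 2) _ ((d / 2)^-1 * (d ^+ 2)^-1)) => //.
- exact: kernel_rdiff.
- apply: nearC1 near_i _ => w /nz wn t bt; apply: rdiffM; first exact: dphi.
  by apply/holo_rdiff/holo_kernel/wn.
apply: nearC1 near_i _ => w wz t bt.
have tw := nz w wz t bt; have tz := boundary_neq zi bt.
rewrite (_ : _ - _ - _ = (t - w)^-1 * ((t - z) ^+ 2)^-1 * (w - z) ^+ 2); last first.
  by rewrite expr1; field; rewrite tw tz.
rewrite !normcM !normcV !normc_exp ler_wpM2r ?sqr_ge0//.
rewrite ler_pM ?invr_ge0 ?sqr_ge0 ?normc_ge0// lef_pV2 ?posrE ?exprn_gt0 ?normc_gt0//.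
  exact: far.
by rewrite ler_sqr ?nnegrE ?normc_ge0 ?(ltW d0)//; exact: dP.
Qed.

(** The second transform is the derivative of the first, so this is what makes derivatives of
    holomorphic functions holomorphic again. *)
Lemma cauchy_transform2_holo phi z : rect_interior x0 x1 y0 y1 z -> rdiff_on bd phi ->
  holo (cauchy_transform 2 phi) z.
Proof.
move=> zi dphi; have [d d0 dP] := interior_dist zi.
have d2 : 0 < d / 2 by lra.
have near_i : \forall w \near z, normc (w - z) < d / 2 by exact: normc_near.
have far w : normc (w - z) < d / 2 -> forall t, bd t -> d / 2 <= normc (t - w).
  move=> wz t /dP zt; have := le_normcD (t - w) (w - z).
  by rewrite addrA subrK; lra.
have nz w : normc (w - z) < d / 2 -> forall t, bd t -> t - w != 0.
  by move=> /far H t /H; rewrite -normc_gt0; lra.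
(* The remainder is (w - z)^2 (t - w)^-2 (t - z)^-2 times (3 (t - z) - 2 (w - z)) / (t - z), and the
   last factor is at most 3 + 2 since |w - z| < d <= |t - z|. *)
eexists; apply: (@rint_kernel _ (fun w t => (t - w) ^- 2) (fun t => 2 * (t - z) ^- 3) _
    (5 * ((d / 2) ^- 2 * d ^- 2))) => //.
- move=> t bt; apply: rdiffM; first exact: dphi.
  by apply: rdiffM; [exact: rdiff_cst|apply/holo_rdiff/holo_kernel/boundary_neq].
- apply: nearC1 near_i _ => w /nz wn t bt; apply: rdiffM; first exact: dphi.
  by apply/holo_rdiff/holo_kernel/wn.
apply: nearC1 near_i _ => w wz t bt.
have tw := nz w wz t bt; have tz := boundary_neq zi bt.
rewrite (_ : _ - _ - _ = ((3 * (t - z) - 2 * (w - z)) / (t - z)) *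
  ((t - w) ^- 2 * (t - z) ^- 2) * (w - z) ^+ 2); last first.
  by field; rewrite tw tz.
rewrite !normcM !normcV !normc_exp ler_wpM2r ?sqr_ge0//.
have tz0 : 0 < normc (t - z) by rewrite normc_gt0.
rewrite ler_pM ?mulr_ge0 ?invr_ge0 ?sqr_ge0 ?normc_ge0//.
  rewrite ler_pdivrMr//; apply: le_trans (le_normcD _ _) _.
  have n3 : normc (3 : R[i]) = 3 by rewrite (_ : 3 = 3%:C) ?normc_real ?ger0_norm// rmorph_nat.
  have n2 : normc (2 : R[i]) = 2 by rewrite (_ : 2 = 2%:C) ?normc_real ?ger0_norm// rmorph_nat.
  by rewrite normcN !normcM n3 n2; have := dP t bt; lra.
rewrite ler_pM ?invr_ge0 ?sqr_ge0 ?normc_ge0// lef_pV2 ?posrE ?exprn_gt0 ?normc_gt0//.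
  by rewrite ler_sqr ?nnegrE ?normc_ge0 ?(ltW d2)//; exact: far.
by rewrite ler_sqr ?nnegrE ?normc_ge0 ?(ltW d0)//; exact: dP.
Qed.

End CauchyFormula.

(** * Factorization at zeros *)

Section HolomorphicTheory.
Context {R : realType}.
Implicit Types (z w : R[i]) (F G phi : R[i] -> R[i]) (r M : R) (V : set R[i]).
Notation mu := (@lebesgue_measure R).

Lemma Im_inv z : Im z^-1 = - Im z / (Re z ^+ 2 + Im z ^+ 2).
Proof. by case: z => a b; rewrite /= mulNr. Qed.

Lemma Re_inv z : Re z^-1 = Re z / (Re z ^+ 2 + Im z ^+ 2).
Proof. by case: z => a b. Qed.

Lemma Rintegral_segment_ge a b (h : R -> R) M : a <= b ->
  (forall t, a <= t <= b -> {for t, continuous h}) ->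
  (forall t, a <= t <= b -> M <= h t) ->
  (b - a) * M <= \int[mu]_(t in `[a, b]) h t.
Proof.
move=> ab hc hM; rewrite mulrC -lebesgue_segment// -Rintegral_cst//.
have hM' : mu.-integrable `[a, b] (EFin \o (fun=> M)).
  by apply: integrable_segment => t _; exact: cst_continuous.
by apply: le_Rintegral hM' (integrable_segment hc) _ => // t /=; rewrite in_itv /=; exact: hM.
Qed.

Lemma Rintegral_segment_le a b (h : R -> R) M : a <= b ->
  (forall t, a <= t <= b -> {for t, continuous h}) ->
  (forall t, a <= t <= b -> h t <= M) ->
  \int[mu]_(t in `[a, b]) h t <= (b - a) * M.
Proof.
move=> ab hc hM; rewrite mulrC -lebesgue_segment// -Rintegral_cst//.
have hM' : mu.-integrable `[a, b] (EFin \o (fun=> M)).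
  by apply: integrable_segment => t _; exact: cst_continuous.
by apply: le_Rintegral (integrable_segment hc) hM' _ => // t /=; rewrite in_itv /=; exact: hM.
Qed.

Section Square.
Variables (c : R[i]) (r : R).
Hypothesis r0 : 0 < r.
Local Notation x0 := (Re c - r).
Local Notation x1 := (Re c + r).
Local Notation y0 := (Im c - r).
Local Notation y1 := (Im c + r).

Definition square z := rect x0 x1 y0 y1 z.
Definition square_boundary z := rect_boundary x0 x1 y0 y1 z.
Definition square_transform k phi z := cauchy_transform x0 x1 y0 y1 k phi z.

Lemma square_interior z : normc (z - c) < r -> rect_interior x0 x1 y0 y1 z.
Proof.
move=> zc; have := ge_normc_Re (z - c); have := ge_normc_Im (z - c).
rewrite Re_sub Im_sub => iz rz.
have {}iz := le_lt_trans iz zc; have {}rz := le_lt_trans rz zc.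
move: iz rz; rewrite !ltr_norml => /andP[? ?] /andP[? ?].
by rewrite /rect_interior; split; apply/andP; split; have := r0; lra.
Qed.

Let x01 : x0 < x1. Proof. by have := r0; lra. Qed.
Let y01 : y0 < y1. Proof. by have := r0; lra. Qed.

(** The exact value is 2 pi i. Bounding the imaginary contribution of each side below by 1 avoids
    computing it. *)
Lemma square_transform1_center_neq0 : square_transform 1 (fun=> 1) c != 0.
Proof.
have ci : rect_interior x0 x1 y0 y1 c by apply: square_interior; rewrite subrr normc0.
have bk : rdiff_on (rect_boundary x0 x1 y0 y1) (fun w => 1 * (w - c) ^- 1).
  by apply: kernel_rdiff => // w _; exact: rdiff_cst.
have [F1 F2 F3 F4] := boundary_sides (ltW x01) (ltW y01) bk.
suff : 4 <= Im (square_transform 1 (fun=> 1) c).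
  by apply: contraTneq => ->; rewrite /= -ltNge ltr0n.
rewrite /square_transform /cauchy_transform /rint Im_add Im_sub Im_mul Re_sub Im_sub.
rewrite [Re imag_unit]/= [Im imag_unit]/= mul0r mul1r add0r.
have dx : x1 - x0 = 2 * r by have := r0; lra.
have dy : y1 - y0 = 2 * r by have := r0; lra.
(* Up to sign, the integrand on each side is r / (u^2 + r^2), with u running over an interval of
   length 2 r. *)
have key (u : R) : - r <= u <= r -> r / (u ^+ 2 + r ^+ 2) >= 1 / (2 * r).
  move=> ur; have u2 : u ^+ 2 <= r ^+ 2.
    by rewrite -[u ^+ 2]real_normK ?num_real// ler_sqr ?nnegrE ?normr_ge0 ?(ltW r0)// ler_norml.
  have s0 : 0 < u ^+ 2 + r ^+ 2 by rewrite ltr_wpDl ?sqr_ge0 ?exprn_gt0.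
  rewrite ler_pdivrMr ?mulr_gt0// mulrAC ler_pdivlMr// mul1r; have := r0; lra.
have kE (w : R[i]) : 1 * (w - c) ^- 1 = (w - c)^-1 by rewrite mul1r expr1.
have r2 : 2 * r * (1 / (2 * r)) = 1 by field; have := r0; lra.
have B1 : 1 <= Im (cint x0 x1 (fun s => 1 * (s +i* y0 - c) ^- 1)).
  rewrite -r2 -dx; apply: Rintegral_segment_ge (ltW x01) (fun t tt => (F1 t tt).2) _.
  move=> t /andP[t0 t1]; rewrite kE Im_inv Re_sub Im_sub /=.
  have -> : y0 - Im c = - r by have := r0; lra.
  by rewrite opprK sqrrN dx; apply: key; have := r0; lra.
have B2 : Im (cint x0 x1 (fun s => 1 * (s +i* y1 - c) ^- 1)) <= - 1.
  rewrite -[X in _ <= - X]r2 -dx -mulrN; apply: Rintegral_segment_le (ltW x01) (fun t tt => (F2 t tt).2) _.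
  move=> t /andP[t0 t1]; rewrite kE Im_inv Re_sub Im_sub /=.
  have -> : y1 - Im c = r by have := r0; lra.
  by rewrite mulNr lerN2 dx; apply: key; have := r0; lra.
have B3 : 1 <= Re (cint y0 y1 (fun s => 1 * (x1 +i* s - c) ^- 1)).
  rewrite -r2 -dy; apply: Rintegral_segment_ge (ltW y01) (fun t tt => (F3 t tt).1) _.
  move=> t /andP[t0 t1]; rewrite kE Re_inv Re_sub Im_sub /=.
  have -> : x1 - Re c = r by have := r0; lra.
  by rewrite dy [_ ^+ 2 + _]addrC; apply: key; have := r0; lra.
have B4 : Re (cint y0 y1 (fun s => 1 * (x0 +i* s - c) ^- 1)) <= - 1.
  rewrite -[X in _ <= - X]r2 -dy -mulrN; apply: Rintegral_segment_le (ltW y01) (fun t tt => (F4 t tt).1) _.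
  move=> t /andP[t0 t1]; rewrite kE Re_inv Re_sub Im_sub /=.
  have -> : x0 - Re c = - r by have := r0; lra.
  by rewrite mulNr lerN2 dy sqrrN [_ ^+ 2 + _]addrC; apply: key; have := r0; lra.
have := r0; lra.
Qed.

Lemma square_transform1_wirt phi z : normc (z - c) < r ->
  rdiff_on square_boundary phi ->
  wirt (square_transform 1 phi) z (square_transform 2 phi z) 0.
Proof. by move=> /square_interior zi dphi; apply: cauchy_transform1_wirt. Qed.

Lemma square_transform1_holo phi z : normc (z - c) < r ->
  rdiff_on square_boundary phi -> holo (square_transform 1 phi) z.
Proof. by move=> zr dphi; eexists; exact: square_transform1_wirt. Qed.

Lemma square_transform2_holo phi z : normc (z - c) < r ->
  rdiff_on square_boundary phi -> holo (square_transform 2 phi) z.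
Proof. by move=> /square_interior zi dphi; apply: cauchy_transform2_holo. Qed.

Lemma square_formula F z : normc (z - c) < r -> (forall w, square w -> holo F w) ->
  square_transform 1 F z = F z * square_transform 1 (fun=> 1) z.
Proof. by move=> /square_interior zi FH; apply: cauchy_formula. Qed.

Lemma square_boundary_dist w : square_boundary w -> r <= normc (w - c).
Proof.
move=> [_ [] E].
- by apply: le_trans (ge_normc_Re _); rewrite Re_sub E ler0_norm; have := r0; lra.
- by apply: le_trans (ge_normc_Re _); rewrite Re_sub E ger0_norm; have := r0; lra.
- by apply: le_trans (ge_normc_Im _); rewrite Im_sub E ler0_norm; have := r0; lra.
- by apply: le_trans (ge_normc_Im _); rewrite Im_sub E ger0_norm; have := r0; lra.
Qed.

Lemma square_dist w : square w -> normc (w - c) <= 2 * r.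
Proof.
move=> [/andP[h1 h2] /andP[h3 h4]]; apply: le_trans (normc_le_ReIm _) _.
rewrite Re_sub Im_sub; have -> : 2 * r = r + r by ring.
by rewrite lerD// ler_norml; apply/andP; split; lra.
Qed.

Lemma cst_rdiff_on (D : R[i] -> Prop) (k : R[i]) : rdiff_on D (fun=> k).
Proof. by move=> w _; exact: rdiff_cst. Qed.

Lemma square_transform1_neq0 :
  \forall z \near c, normc (z - c) < r /\ square_transform 1 (fun=> 1) z != 0.
Proof.
have cc : normc (c - c) < r by rewrite subrr normc0.
have W := square_transform1_wirt cc (@cst_rdiff_on square_boundary 1).
have k0 : 0 < normc (square_transform 1 (fun=> 1) c) / 2.
  by rewrite divr_gt0// normc_gt0 square_transform1_center_neq0.
apply: nearC2 (normc_near c r0) (wirt_small W k0) _ => z zr H; split => //.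
apply/eqP => E; move: H; rewrite E sub0r normcN.
by move: k0; have := r0; lra.
Qed.

End Square.

Lemma open_square V c : open V -> V c -> exists2 r, 0 < r & square c r `<=` V.
Proof.
move=> oV Vc; have /nbhs_normcP[e e0 eV] : nbhs c V by exact: open_nbhs_nbhs.
have e3 : 0 < e / 3 by lra.
exists (e / 3) => // w /square_dist wc; apply: eV; lra.
Qed.

Lemma near_nearC z (P : set R[i]) : nbhs z P -> \forall w \near z, nbhs w P.
Proof. by move=> /nbhs_interior. Qed.

(** Near c, Cauchy's formula reads F = T / k with k the transform of 1, known only to be nonzero
    there. The quotient rule expresses [d_z F] through T, k and their derivatives [T2] and [k2], all
    of them holomorphic. *)
Lemma holo_d_z V F : open V -> (forall z, V z -> holo F z) ->
  forall z, V z -> wirt F z (d_z F z) 0 /\ holo (d_z F) z.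
Proof.
move=> oV FH c Vc; split.
  by have [A FA] := FH c Vc; rewrite (wirt_d_z FA).
have [r r0 rV] := open_square oV Vc.
have FH' w : square c r w -> holo F w by move=> /rV /FH.
have dF : rdiff_on (square_boundary c r) F by move=> w [sw _]; exact/holo_rdiff/FH'.
pose k := square_transform c r 1 (fun=> 1); pose k2 := square_transform c r 2 (fun=> 1).
pose T := square_transform c r 1 F; pose T2 := square_transform c r 2 F.
have dT w : normc (w - c) < r -> wirt T w (T2 w) 0 /\ holo T2 w.
  by move=> wc; split; [exact: square_transform1_wirt|exact: square_transform2_holo].
have dk w : normc (w - c) < r -> wirt k w (k2 w) 0 /\ holo k2 w.
  move=> wc; have d1 := @cst_rdiff_on (square_boundary c r) 1.
  by split; [exact: square_transform1_wirt|exact: square_transform2_holo].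
have near_c := square_transform1_neq0 c r0.
have E : \forall w \near c, d_z F w = T2 w * (k w)^-1 + T w * (- k2 w * (k w ^+ 2)^-1).
  apply: nearC1 (near_nearC near_c) _ => w near_w.
  have [wc kw] := nbhs_singleton near_w.
  have FE : \forall v \near w, T v * (k v)^-1 = F v.
    by apply: nearC1 near_w _ => v [vc kv]; rewrite /T square_formula// mulfK.
  have W := wirt_ext FE (wirtM (dT w wc).1 (wirtV kw (dk w wc).1)).
  by rewrite (wirt_d_z W).
have [cc kc] := nbhs_singleton near_c.
have [dTc hT2] := dT c cc; have [dkc hk2] := dk c cc.
have hT : holo T c by eexists; exact: dTc.
have hk : holo k c by eexists; exact: dkc.
apply: holo_ext (_ : \forall w \near c, _ = d_z F w) _.
  by apply: nearC1 E _ => w ->.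
apply: holoD; apply: holoM => //; first exact: holoV.
apply: holoM; last by apply: holoV; [rewrite expf_neq0|exact: holoX].
apply: holo_ext (holoM (holo_cst (-1) c) hk2).
by apply: nearCW => w; rewrite mulN1r.
Qed.

(** The value of G at a is the one given by a Cauchy integral: (w - a) / ((t - a) (t - w)) = 1 / (t
    - w) - 1 / (t - a), and the second term integrates against F to a multiple of F(a) = 0. The
    factorization is stated on the whole plane, where it holds by definition of G, so that it can be
    used as an equality of functions. *)
Lemma holo_factor V F a : open V -> V a -> (forall z, V z -> holo F z) -> F a = 0 ->
  exists2 G, forall z, V z -> holo G z & forall z, F z = (z - a) * G z.
Proof.
move=> oV Va FH Fa0.
have [r r0 rV] := open_square oV Va.
have FH' w : square a r w -> holo F w by move=> /rV /FH.
have ai : rect_interior (Re a - r) (Re a + r)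
    (Im a - r) (Im a + r) a.
  by apply: (square_interior r0); rewrite subrr normc0.
have nbd w : square_boundary a r w -> w - a != 0.
  move=> /square_boundary_dist H; rewrite -normc_gt0.
  exact: lt_le_trans r0 (H r0).
have d1 := @cst_rdiff_on (square_boundary a r) 1.
pose k := square_transform a r 1 (fun=> 1).
pose phi w := F w * (w - a) ^- 1.
have dphi : rdiff_on (square_boundary a r) phi.
  move=> w bw; apply/holo_rdiff/holoM; first by apply: FH'; exact: bw.1.
  exact/holo_kernel/nbd.
pose H w := square_transform a r 1 phi w * (k w)^-1.
have near_a := square_transform1_neq0 a r0.
have [aa ka] := nbhs_singleton near_a.
have hH : holo H a.
  apply: holoM; first exact: square_transform1_holo.
  by apply: holoV => //; exact: square_transform1_holo.
pose G w := if w == a then H a else F w / (w - a).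
have FG z : F z = (z - a) * G z.
  rewrite /G; case: eqP => [->|/eqP za]; first by rewrite subrr mul0r.
  by rewrite mulrC divfK// subr_eq0.
exists G => // z Vz; have [->|za] := eqVneq z a.
  apply: holo_ext hH; apply: nearC1 near_a _ => w [wa kw].
  rewrite /G; case: eqP => [->//|/eqP]; rewrite -subr_eq0 => wna.
  apply: (mulIf kw); rewrite /H divfK//.
  have TF := square_formula r0 wa FH'; have TFa := square_formula r0 aa FH'.
  rewrite Fa0 mul0r in TFa.
  rewrite mulrAC -TF -[LHS]mulr1 -[1 in LHS](divff wna) mulrA; congr (_ / _).
  have x01 : Re a - r <= Re a + r by lra.
  have y01 : Im a - r <= Im a + r by lra.
  have wi := square_interior r0 wa.
  have dF : rdiff_on (square_boundary a r) F by move=> t bt; exact/holo_rdiff/FH'/bt.1.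
  have dFw := kernel_rdiff 1 wi dF; have dFa := kernel_rdiff 1 ai dF.
  have dphiw := kernel_rdiff 1 wi dphi.
  rewrite mulrC /square_transform /cauchy_transform -rintZ//.
  (* The zero added on the right is minus the transform of F at a, supplying the second partial
     fraction. *)
  rewrite -[RHS]addr0 -(mulr0 (-1)) -TFa.
  rewrite /square_transform /cauchy_transform -rintZ// -rintD//; last first.
    by move=> t bt; apply: rdiffM; [exact: rdiff_cst|exact: dFa].
  apply: eq_rint => // t bt.
  have tw : t - w != 0 by apply: boundary_neq wi bt; lra.
  by have ta := nbd t bt; rewrite /phi !expr1; field; rewrite tw ta.
have V' : nbhs z (fun w => w != a).
  apply/nbhs_normcP; exists (normc (z - a)); first by rewrite normc_gt0 subr_eq0.
  move=> w H1; apply/eqP => wa; rewrite wa in H1.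
  by rewrite normc_dist ltxx in H1.
apply: holo_ext (_ : \forall w \near z, F w * (w - a)^-1 = G w) _.
  by apply: nearC1 V' _ => w wna; rewrite /G (negbTE wna).
apply: holoM; first exact: FH.
by apply: holoV; [rewrite subr_eq0|exact: holo_sub].
Qed.

(** On the square of half-side r, the quotient F / (z - a)^n is at most M / r^n on the boundary.
    Cauchy's formula for this quotient and |z - a| < r / 2 then bound F(z) by a constant times 2^-n,
    for every n. *)
Lemma holo_vanish V F a : open V -> V a -> (forall z, V z -> holo F z) ->
  (forall n, exists2 G, forall z, V z -> holo G z & forall z, F z = (z - a) ^+ n * G z) ->
  \forall z \near a, F z = 0.
Proof.
move=> oV Va FH Fn.
have [r r0 rV] := open_square oV Va.
have FH' w : square a r w -> holo F w by move=> /rV /FH.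
have x01 : Re a - r <= Re a + r by lra.
have y01 : Im a - r <= Im a + r by lra.
have dF : rdiff_on (square_boundary a r) F by move=> t bt; exact/holo_rdiff/FH'/bt.1.
have [M FM] := boundary_bounded x01 y01 dF.
have r2 : 0 < r / 2 by lra.
apply: nearC2 (square_transform1_neq0 _ r0) (normc_near a r2) _ => z [zr kz] zr2.
set k := square_transform _ _ _ _ _ in kz.
pose L := 4 * ((Re a + r - (Re a - r)) + (Im a + r - (Im a - r))).
have bound n : normc (F z) * normc k <= 2^-1 ^+ n * (L * (M / (r / 2))).
  have [G GH FG] := Fn n.
  have GH' w : square a r w -> holo G w by move=> /rV /GH.
  have dG : rdiff_on (square_boundary a r) G by move=> t bt; exact/holo_rdiff/GH'/bt.1.
  have zi := square_interior r0 zr.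
  have dGz := kernel_rdiff 1 zi dG.
  rewrite FG normcM normc_exp -mulrA -normcM -square_formula//.
  have Gb w : square_boundary a r w -> normc (G w * (w - z) ^- 1) <= M / r ^+ n / (r / 2).
    move=> bw; have wa := square_boundary_dist r0 bw.
    have wa0 : 0 < normc (w - a) by lra.
    have wz : r / 2 <= normc (w - z).
      have := le_normcD (w - z) (z - a); rewrite addrA subrK; lra.
    rewrite normcM normcV expr1; apply: ler_pM.
    - exact: normc_ge0.
    - by rewrite invr_ge0 normc_ge0.
    - rewrite ler_pdivlMr ?exprn_gt0//; apply: le_trans (FM w bw).
      rewrite FG normcM normc_exp mulrC ler_wpM2r ?normc_ge0//.
      by apply: lerXn2r; rewrite ?nnegrE ?normc_ge0 ?(ltW r0).
    - by rewrite lef_pV2// posrE; lra.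
  have B := rint_bound x01 y01 dGz Gb.
  apply: le_trans (ler_pM _ _ (_ : _ <= (r / 2) ^+ n) B) _.
  - by rewrite exprn_ge0// normc_ge0.
  - exact: normc_ge0.
  - by apply: lerXn2r; rewrite ?nnegrE ?normc_ge0 ?(ltW r2)// ltW.
  rewrite -/L exprMn le_eqVlt; apply/orP; left; apply/eqP; field.
  by rewrite expf_neq0 ?gt_eqF.
apply/eqP; rewrite -normc_eq0; apply/negP => /negP Fz0.
have {}Fz0 : 0 < normc (F z) * normc k.
  by apply: mulr_gt0; [rewrite lt_def Fz0 normc_ge0|rewrite normc_gt0].
set X := normc (F z) * normc k in bound Fz0; set Y := L * _ in bound.
pose n := Num.bound (`|Y| / X).
have := upper_nthrootP (leqnn n); rewrite ltr_pdivrMr// => lt.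
have := bound n; rewrite exprVn ler_pdivlMl ?exprn_gt0// => le.
by have := le_lt_trans (le_trans le (ler_norm Y)) lt; rewrite ltxx.
Qed.

(** Otherwise every quotient vanishes at a, the division by z - a never stops, and [holo_vanish]
    applies. *)
Lemma holo_order V F a : open V -> V a -> (forall z, V z -> holo F z) ->
  ~ (\forall z \near a, F z = 0) ->
  exists n G, [/\ forall z, V z -> holo G z, forall z, F z = (z - a) ^+ n * G z & G a != 0].
Proof.
move=> oV Va FH F0; apply: contrapT => none; apply: F0.
apply: (holo_vanish oV Va FH); elim => [|n [G GH FG]].
  by exists F => // z; rewrite expr0 mul1r.
have Ga : G a = 0.
  apply/eqP/negPn/negP => Ga0; apply: none; by exists n, G.
have [G' GH' GG'] := holo_factor oV Va GH Ga.
by exists G' => // z; rewrite FG GG' exprSr mulrA.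
Qed.

End HolomorphicTheory.

(** * The function P^2 log |f|^2 *)

Section LogarithmicDerivative.
Context {R : realType}.
Implicit Types (z w a : R[i]) (F G f h : R[i] -> R[i]) (V : set R[i]).

Definition logd f z := d_z f z / f z.

Definition lognorm f z : R := ln (normc (f z) ^+ 2).

Lemma open_neq0 V F : open V -> (forall z, V z -> holo F z) ->
  open [set z | V z /\ F z != 0].
Proof.
move=> oV FH; rewrite openE => z [Vz Fz]; rewrite /interior.
have c0 : 0 < normc (F z) by rewrite normc_gt0.
have Vn : nbhs z V by exact: open_nbhs_nbhs.
have [A FA] := FH z Vz.
have c2 : 0 < normc (F z) / 2 by lra.
apply: nearC2 Vn (wirt_small FA c2) _ => w Vw Hw; split => //.
apply/eqP => Fw; move: Hw; rewrite Fw sub0r normcN; lra.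
Qed.

Lemma near_open V z : open V -> V z -> nbhs z V.
Proof. by move=> oV Vz; exact: open_nbhs_nbhs. Qed.

Lemma d_z_mul F G z : holo F z -> holo G z ->
  d_z (fun w => F w * G w) z = d_z F z * G z + F z * d_z G z.
Proof.
by move=> [A FA] [B GB]; rewrite (wirt_d_z FA) (wirt_d_z GB) (wirt_d_z (wirtM FA GB)).
Qed.

Lemma holo_wirt F z : holo F z -> wirt F z (d_z F z) 0.
Proof. by move=> [A FA]; rewrite (wirt_d_z FA). Qed.

Lemma holo_logd V f : open V -> (forall z, V z -> holo f z) ->
  forall z, V z -> f z != 0 -> holo (logd f) z /\ holo (d_z (logd f)) z.
Proof.
move=> oV fH z Vz fz.
have o1 := open_neq0 oV fH.
have H w : (V w /\ f w != 0) -> holo (logd f) w.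
  move=> [Vw fw]; apply: holoM; first exact: (holo_d_z oV fH Vw).2.
  by apply: holoV => //; exact: fH.
split; first exact: H.
by apply: (holo_d_z o1 H _).2.
Qed.

Lemma wirt_lognorm f z : holo f z -> f z != 0 ->
  wirt (fun w => (lognorm f w)%:C) z (logd f z) (conjc (logd f z)).
Proof. by move=> /holo_wirt fA fz; exact: wirt_ln_norm. Qed.

Lemma logd_mul F G z : holo F z -> holo G z -> F z != 0 -> G z != 0 ->
  logd (fun w => F w * G w) z = logd F z + logd G z.
Proof. by move=> hF hG Fz Gz; rewrite /logd d_z_mul//; field; rewrite Fz Gz. Qed.

Lemma d_z_sub a z : d_z (fun w => w - a) z = 1.
Proof.
have := wirtD (wirt_id z) (wirt_cst (- a) z).
by move=> /wirt_d_z ->; rewrite addr0.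
Qed.

Lemma logd_subX a n z : z != a -> logd (fun w => (w - a) ^+ n) z = n%:R / (z - a).
Proof.
rewrite -subr_eq0 => za; elim: n => [|n IH].
  rewrite /logd (_ : d_z _ z = 0) ?mul0r//.
  by under eq_fun => w do rewrite expr0; exact: wirt_d_z (wirt_cst 1 z).
under eq_fun => w do rewrite exprS.
rewrite logd_mul//; last 3 first.
- exact: holo_sub.
- by apply: holoX; exact: holo_sub.
- by rewrite expf_neq0.
rewrite IH /logd d_z_sub -mulrDl; congr (_ / _); first by rewrite -natr1 addrC.
Qed.

Section Zero.
Variables (V : set R[i]) (f h : R[i] -> R[i]) (a : R[i]) (m : nat).
Hypotheses (oV : open V) (Va : V a) (hH : forall z, V z -> holo h z) (ha : h a != 0)
  (fE : forall z, f z = (z - a) ^+ m * h z).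

Let hl := holo_logd oV hH.

Lemma near_zero_logd : \forall z \near a, V z /\ h z != 0 /\
  (z != a -> logd f z = m%:R / (z - a) + logd h z).
Proof.
have := near_open (open_neq0 oV hH) (conj Va ha).
move=> /nearC1; apply => z [Vz hz]; split=> //; split=> // za.
have -> : f = (fun w => (w - a) ^+ m * h w) by apply/funext.
rewrite logd_mul ?logd_subX//.
- by apply: holoX; exact: holo_sub.
- exact: hH.
- by rewrite expf_neq0// subr_eq0.
Qed.

Lemma near_zero_d_z_logd : \forall z \near a,
  (z != a -> d_z (logd f) z = - (m%:R / (z - a) ^+ 2) + d_z (logd h) z).
Proof.
apply: nearC1 (near_nearC near_zero_logd) _ => z nz za.
have [Vz [hz _]] := nbhs_singleton nz.
have za0 : z - a != 0 by rewrite subr_eq0.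
have na : \forall w \near z, w != a.
  apply/nbhs_normcP; exists (normc (z - a)); first by rewrite normc_gt0.
  move=> w H1; apply/eqP => wa; rewrite wa in H1.
  by rewrite normc_dist ltxx in H1.
have W0 : wirt (fun w => w - a) z 1 0.
  by apply: wirt_eq (wirtB (wirt_id z) (wirt_cst a z)) _ _; rewrite subr0.
have W1 := wirtZ m%:R (wirtV (F := fun w => w - a) za0 W0).
have W2 := wirtD W1 (holo_wirt (hl Vz hz).1).
rewrite (wirt_d_z (wirt_ext (_ : \forall w \near z, _ = logd f w) W2)).
  by rewrite mulrA mulrN1 mulNr.
by apply: nearC2 nz na _ => w [_ [_ E]] wa; rewrite E.
Qed.

Lemma logd_bounds : exists2 C, 0 < C & \forall z \near a, z != a ->
  normc (logd f z) <= C / normc (z - a) /\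
  normc (d_z (logd f) z) <= C / normc (z - a) ^+ 2.
Proof.
pose c1 := normc (logd h a) + 1; pose c2 := normc (d_z (logd h) a) + 1.
have [hl1 hl2] := hl Va ha.
have n1 := continuous_normc_bounded (rdiff_continuous (holo_rdiff hl1)).
have n2 := continuous_normc_bounded (rdiff_continuous (holo_rdiff hl2)).
have c10 : 0 < c1 by rewrite ltr_wpDl// normc_ge0.
have c20 : 0 < c2 by rewrite ltr_wpDl// normc_ge0.
have m0 : 0 <= m%:R :> R by [].
exists (m%:R + c1 + c2); first by lra.
have nm : normc (m%:R : R[i]) = m%:R.
  by rewrite (_ : m%:R = (m%:R)%:C) ?normc_real ?ger0_norm// rmorph_nat.
have E : \forall z \near a, normc (z - a) < 1 /\ (z != a ->
    logd f z = m%:R / (z - a) + logd h z /\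
    d_z (logd f) z = - (m%:R / (z - a) ^+ 2) + d_z (logd h) z).
  apply: nearC2 (normc_near a ltr01) _ _; last by move=> z; exact: conj.
  apply: nearC2 near_zero_logd near_zero_d_z_logd _ => z [_ [_ H1]] H2 za.
  by split; [exact: H1|exact: H2].
have B : \forall z \near a, normc (logd h z) <= c1 /\ normc (d_z (logd h) z) <= c2.
  by apply: nearC2 n1 n2 _ => z; exact: conj.
apply: nearC2 E B _ => z [z1 E] [b1 b2] za.
have [-> ->] := E za.
have t0 : 0 < normc (z - a) by rewrite normc_gt0 subr_eq0.
set t := normc (z - a) in z1 t0 *.
have t2 : t ^+ 2 <= 1 by rewrite expr_le1// ltW.
split.
  apply: le_trans (le_normcD _ _) _.
  rewrite normcM normcV nm -/t -addrA mulrDl lerD2l.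
  rewrite ler_pdivlMr//; apply: (@le_trans _ _ c1); last by rewrite lerDl ltW.
  by apply: le_trans (ler_pM (normc_ge0 _) (ltW t0) b1 (ltW z1)) _; rewrite mulr1.
apply: le_trans (le_normcD _ _) _.
rewrite normcN normcM normcV normc_exp nm -/t -addrA mulrDl lerD2l.
rewrite ler_pdivlMr ?exprn_gt0//; apply: (@le_trans _ _ c2); last by rewrite lerDr ltW.
by apply: le_trans (ler_pM (normc_ge0 _) (sqr_ge0 _) b2 t2) _; rewrite mulr1.
Qed.

Lemma lognorm_zero z : z != a -> h z != 0 ->
  lognorm f z = (2 * m)%:R * ln (normc (z - a)) + lognorm h z.
Proof.
move=> za hz; have {}za : 0 < normc (z - a) by rewrite normc_gt0 subr_eq0.
have {}hz : 0 < normc (h z) by rewrite normc_gt0.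
rewrite /lognorm fE normcM normc_exp exprMn lnM ?posrE ?exprn_gt0//.
by rewrite -exprM mulnC lnXn// mulr_natl.
Qed.

Lemma lognorm_bounded : exists C, \forall z \near a, h z != 0 /\ `|lognorm h z| <= C.
Proof.
have L := wirt_lognorm (hH Va) ha.
exists (normc ((lognorm h a)%:C) + 1).
apply: nearC2 (wirt_bounded L) near_zero_logd _ => z.
by rewrite !normc_real => b [_ [hz _]]; split.
Qed.

End Zero.

(* |ln t| = 2 ln (1 / sqrt t) <= 2 / sqrt t *)
Lemma ln_sqrt_bound (t : R) : 0 < t -> t <= 1 -> `|ln t| <= 2 / Num.sqrt t.
Proof.
move=> t0 t1; have s0 : 0 < Num.sqrt t by rewrite sqrtr_gt0.
have lt0 : ln t <= 0 by rewrite ln_le0.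
rewrite ler0_norm// -lnV ?posrE//.
have -> : t^-1 = (Num.sqrt t)^-1 ^+ 2 by rewrite exprVn sqr_sqrtr// ltW.
rewrite lnXn ?invr_gt0//; have i0 : 0 < (Num.sqrt t)^-1 by rewrite invr_gt0.
by have := ln_sublinear i0; rewrite mulr2n; lra.
Qed.

(** The exponent 1/2 is a convenient one below 1: P log |f|^2 still tends to 0 at a zero. The
    constant 4 m is 2 m from the order of the zero times 2 from [ln_sqrt_bound]. *)
Lemma lognorm_sqrt_bound V f h a m : open V -> V a -> (forall z, V z -> holo h z) ->
  h a != 0 -> (forall z, f z = (z - a) ^+ m * h z) ->
  exists2 C, 0 < C & \forall z \near a, z != a ->
    `|lognorm f z| <= C / Num.sqrt (normc (z - a)).
Proof.
move=> oV Va hH ha fE; have [C hC] := lognorm_bounded oV Va hH ha fE.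
have m0 : 0 <= (4 * m)%:R :> R by [].
pose C' := Num.max C 1; have C0 : 0 < C' by rewrite lt_max ltr01 orbT.
exists ((4 * m)%:R + C'); first by lra.
apply: nearC2 hC (normc_near a ltr01) _ => z [hz b] z1 za.
rewrite (lognorm_zero fE)//.
have t0 : 0 < normc (z - a) by rewrite normc_gt0 subr_eq0.
have lb := ln_sqrt_bound t0 (ltW z1).
set t := normc (z - a) in t0 z1 lb *.
have s0 : 0 < Num.sqrt t by rewrite sqrtr_gt0.
have s1 : Num.sqrt t <= 1 by rewrite -sqrtr1 ler_sqrt// ltW.
apply: le_trans (ler_normD _ _) _; rewrite mulrDl; apply: lerD.
  rewrite normrM ger0_norm//.
  have -> : (4 * m)%:R / Num.sqrt t = (2 * m)%:R * (2 / Num.sqrt t).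
    by rewrite !natrM; ring.
  by rewrite ler_wpM2l.
apply: (@le_trans _ _ C'); first by rewrite le_max b.
by rewrite ler_pdivlMr// ler_piMr// ltW.
Qed.

End LogarithmicDerivative.

(** * The function u, its derivatives and their size near the zeros *)

Section Potential.
Context {R : realType}.
Implicit Types (z w : R[i]) (F G : R[i] -> R[i]).

Lemma continuous_ext F G z : (\forall w \near z, G w = F w) ->
  {for z, continuous G} -> {for z, continuous F}.
Proof.
move=> GF /continuous_normcP Gc; apply/continuous_normcP => e e0.
have Gz := nbhs_singleton GF.
by apply: nearC2 GF (Gc e e0) _ => w <-; rewrite -Gz.
Qed.

Lemma continuous_bounded_by F z (b : R -> R) :
  F z = 0 -> (\forall w \near z, w != z -> normc (F w) <= b (normc (w - z))) ->
  (forall e, 0 < e -> exists2 d : R, 0 < d & forall t, 0 < t -> t < d -> b t < e) ->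
  {for z, continuous F}.
Proof.
move=> Fz Fb b0; apply/continuous_normcP => e e0.
have [d d0 bd] := b0 e e0.
apply: nearC2 Fb (normc_near z d0) _ => w Fw wd.
have [->|wz] := eqVneq w z; first by rewrite subrr normc0.
rewrite Fz subr0; apply: le_lt_trans (Fw wz) _; apply: bd => //.
by rewrite normc_gt0 subr_eq0.
Qed.

Lemma continuous_lin c d F G z : {for z, continuous F} -> {for z, continuous G} ->
  {for z, continuous (fun w => c * F w + d * G w)}.
Proof.
move=> /continuous_normcP Fc /continuous_normcP Gc; apply/continuous_normcP => e e0.
pose M := normc c + normc d + 1.
have M0 : 0 < M by have := normc_ge0 c; have := normc_ge0 d; rewrite /M; lra.
have eM : 0 < e / M by rewrite divr_gt0.
apply: nearC2 (Fc _ eM) (Gc _ eM) _ => w Fw Gw.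
rewrite (_ : _ - _ = c * (F w - F z) + d * (G w - G z)); last by ring.
apply: le_lt_trans (le_normcD _ _) _; rewrite !normcM.
have H1 := ler_wpM2l (normc_ge0 c) (ltW Fw); have H2 := ler_wpM2l (normc_ge0 d) (ltW Gw).
have E : e = normc c * (e / M) + normc d * (e / M) + e / M.
  by rewrite /M; field; rewrite gt_eqF.
by rewrite [X in _ < X]E; lra.
Qed.

Lemma sqrt_small (C e : R) : 0 < C -> 0 < e ->
  exists2 d : R, 0 < d & forall t, 0 < t -> t < d -> C * Num.sqrt t < e.
Proof.
move=> C0 e0; exists ((e / C) ^+ 2); first by rewrite exprn_gt0 ?divr_gt0.
move=> t t0 td; rewrite mulrC -ltr_pdivlMr//.
have -> : e / C = Num.sqrt ((e / C) ^+ 2) by rewrite sqrtr_sqr gtr0_norm ?divr_gt0.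
by rewrite ltr_sqrt// exprn_gt0 ?divr_gt0.
Qed.

Lemma le_sqrt (t : R) : 0 < t -> t < 1 -> t <= Num.sqrt t.
Proof.
move=> t0 t1; rewrite -{1}(sqr_sqrtr (ltW t0)) expr2 ler_piMr ?sqrtr_ge0//.
by rewrite -sqrtr1 ler_sqrt// ltW.
Qed.

Variables (U V : set R[i]) (f : R[i] -> R[i]) (N : nat) (a : 'I_N -> R[i]).
Hypotheses (oU : open U) (oV : open V) (UV : U `<=` V)
  (fH : forall z, V z -> holo f z) (inj_a : injective a)
  (zerof : U `&` [set z | f z = 0] = range a).

Definition zeros_poly z := \prod_(j < N) (z - a j).
Local Notation P := zeros_poly.
Local Notation P' := (d_z zeros_poly).
Local Notation L := (logd f).

Lemma zeroP z : U z -> f z = 0 -> exists j, z = a j.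
Proof.
move=> Uz fz; have : (U `&` [set z | f z = 0]) z by [].
by rewrite zerof => -[j _ <-]; exists j.
Qed.

Lemma zero_a j : U (a j) /\ f (a j) = 0.
Proof. by have : range a (a j) by []; rewrite -zerof => -[]. Qed.

Lemma prod_holo (s : seq 'I_N) z : holo (fun w => \prod_(j <- s) (w - a j)) z.
Proof.
elim: s => [|j s IH].
  by under eq_fun => w do rewrite big_nil; exact: holo_cst.
by under eq_fun => w do rewrite big_cons; apply: holoM => //; exact: holo_sub.
Qed.

Lemma zeros_poly_holo z : holo P z.
Proof. by rewrite /zeros_poly; exact: prod_holo. Qed.

Lemma zeros_poly_zero j : P (a j) = 0.
Proof. by rewrite /zeros_poly (bigD1 j)//= subrr mul0r. Qed.

Lemma zeros_poly_zero_in z : U z -> f z = 0 -> P z = 0.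
Proof. by move=> Uz /(zeroP Uz)[j ->]; exact: zeros_poly_zero. Qed.

Lemma zeros_poly_factor j : exists Q, [/\ forall z, holo Q z,
  forall z, P z = (z - a j) * Q z & Q (a j) != 0].
Proof.
exists (fun z => \prod_(i <- [seq i <- index_enum 'I_N | i != j]) (z - a i)); split.
- by move=> z; exact: prod_holo.
- by move=> z; rewrite /zeros_poly (bigD1 j)//= big_filter.
rewrite big_filter; apply/prodf_neq0 => i ij.
by rewrite subr_eq0; apply: contra ij => /eqP/inj_a ->.
Qed.

Lemma zero_isolated z : U z -> \forall w \near z, U w /\ (w != z -> f w != 0).
Proof.
move=> Uz; have nj j : nbhs z (fun w => w != z -> w != a j).
  have [->|za] := eqVneq (a j) z; first by apply: nearCW => w.
  apply/nbhs_normcP; exists (normc (a j - z)); first by rewrite normc_gt0 subr_eq0.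
  by move=> w H _; apply/eqP => wa; rewrite wa ltxx in H.
have nall : nbhs z (fun w => forall j, w != z -> w != a j) by exact: (filter_forall (nbhs_filter z) nj).
apply: nearC2 (near_open oU Uz) nall _ => w Uw wa; split => // wz.
apply/eqP => fw; have [j wj] := zeroP Uw fw.
by have := wa j wz; rewrite wj eqxx.
Qed.

Lemma not_open_point z : ~ \forall w \near z, w = z.
Proof.
move=> /nbhs_normcP[e e0 H]; have := H (z + (e / 2)%:C).
rewrite addrAC subrr add0r normc_real gtr0_norm ?divr_gt0// => /(_ _).
have -> : e / 2 < e by lra.
move=> /(_ isT) E; have : normc (z + (e / 2)%:C - z) = 0 by rewrite E subrr normc0.
by rewrite addrAC subrr add0r normc_real gtr0_norm ?divr_gt0//; lra.
Qed.

(** The order is finite because f cannot vanish on a neighbourhood of z: the zeros in U are finitely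
    many, hence isolated, and a point is not open in the plane. *)
Lemma zero_factor z : U z -> f z = 0 -> exists m h,
  [/\ (0 < m)%N, forall w, V w -> holo h w, forall w, f w = (w - z) ^+ m * h w & h z != 0].
Proof.
move=> Uz fz; have Vz := UV Uz.
have [|m [h [hH fE hz]]] := holo_order oV Vz fH.
  move=> f0; apply: (@not_open_point z).
  apply: nearC2 f0 (zero_isolated Uz) _ => w fw [_ H].
  by apply: contrapT => /eqP /H; rewrite fw eqxx.
exists m, h; split => //; rewrite lt0n; apply/eqP => m0; move/eqP: fz.
by rewrite fE m0 expr0 mul1r (negbTE hz).
Qed.

Lemma zero_bounds z : U z -> f z = 0 -> exists2 C, 0 < C & \forall w \near z, w != z ->
  [/\ normc (P w) <= C * normc (w - z), normc (P' w) <= C,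
      normc (L w) <= C / normc (w - z), normc (d_z L w) <= C / normc (w - z) ^+ 2 &
      `|lognorm f w| <= C / Num.sqrt (normc (w - z))].
Proof.
move=> Uz fz; have Vz := UV Uz.
have [m [h [m0 hH fE hz]]] := zero_factor Uz fz.
have [C1 C10 B1] := logd_bounds oV Vz hH hz fE.
have [C2 C20 B2] := lognorm_sqrt_bound oV Vz hH hz fE.
have PH : forall w, [set: R[i]] w -> holo P w by move=> w _; exact: zeros_poly_holo.
have [WP hP'] := holo_d_z openT PH (I : [set: R[i]] z).
have B3 := wirt_lipschitz WP.
have B4 := continuous_normc_bounded (rdiff_continuous (holo_rdiff hP')).
rewrite (zeros_poly_zero_in Uz fz) normc0 in B3.
set C3 := _ + 1 in B3; set C4 := _ + 1 in B4.
have C30 : 0 <= C3 by rewrite !addr_ge0// normc_ge0.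
have C40 : 0 <= C4 by rewrite !addr_ge0// normc_ge0.
exists (C1 + C2 + C3 + C4); first lra.
have B12 : \forall w \near z, w != z -> [/\ normc (L w) <= C1 / normc (w - z),
    normc (d_z L w) <= C1 / normc (w - z) ^+ 2 &
    `|lognorm f w| <= C2 / Num.sqrt (normc (w - z))].
  by apply: nearC2 B1 B2 _ => w H1 H2 wz; have [? ?] := H1 wz; split=> //; exact: H2.
have B34 : \forall w \near z, normc (P w) <= C3 * normc (w - z) /\ normc (P' w) <= C4.
  by apply: nearC2 B3 B4 _ => w; rewrite subr0.
apply: nearC2 B12 B34 _ => w H12 [H3 H4] wz; have [H1 H1' H2] := H12 wz.
have t0 : 0 < normc (w - z) by rewrite normc_gt0 subr_eq0.
have le c X : 0 <= X -> c <= C1 + C2 + C3 + C4 -> c * X <= (C1 + C2 + C3 + C4) * X.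
  by move=> X0 cC; rewrite ler_wpM2r.
split.
- by apply: le_trans H3 (le _ _ _ _); [exact: normc_ge0|lra].
- by lra.
- by apply: le_trans H1 (le _ _ _ _); [rewrite invr_ge0 normc_ge0|lra].
- by apply: le_trans H1' (le _ _ _ _); [rewrite invr_ge0 sqr_ge0|lra].
- by apply: le_trans H2 (le _ _ _ _); [rewrite invr_ge0 sqrtr_ge0|lra].
Qed.

(** The function u without its case distinction, open to the product rule. At a zero of f in U the
    factor P absorbs the default value of the logarithm. *)
Definition pot z : R[i] := P z ^+ 2 * (lognorm f z)%:C.
(* The formal Wirtinger derivatives of [pot], [zb] standing for zbar. *)
Definition pot_z z : R[i] := 2 * P z * P' z * (lognorm f z)%:C + P z ^+ 2 * L z.
Definition pot_zb z : R[i] := P z ^+ 2 * conjc (L z).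
Definition pot_zzb z : R[i] := 2 * P z * P' z * conjc (L z).
Definition pot_zbzb z : R[i] := P z ^+ 2 * conjc (d_z L z).

Lemma P'_holo z : holo P' z.
Proof. by apply: (holo_d_z openT (fun w _ => zeros_poly_holo w) I).2. Qed.

Lemma wirt_P2 z : wirt (fun w => P w ^+ 2) z (2 * P z * P' z) 0.
Proof.
have H := holo_wirt (zeros_poly_holo z).
have := wirtM H H; rewrite mul0r mulr0 addr0.
have -> : (fun w => P w * P w) = (fun w => P w ^+ 2) by apply/funext => w; rewrite expr2.
by move/wirt_eq; apply => //; ring.
Qed.

Lemma wirt_pot z : U z -> f z != 0 -> wirt pot z (pot_z z) (pot_zb z).
Proof.
move=> Uz fz; have Lg := wirt_lognorm (fH (UV Uz)) fz.
by apply: wirt_eq (wirtM (wirt_P2 z) Lg) _ _ => //; rewrite mul0r add0r.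
Qed.

Lemma wirt_pot_zb z : U z -> f z != 0 -> wirt pot_zb z (pot_zzb z) (pot_zbzb z).
Proof.
move=> Uz fz; have [hL _] := holo_logd oV fH (UV Uz) fz.
have := wirtM (wirt_P2 z) (wirt_conj (holo_wirt hL)).
by rewrite conjc0 mulr0 addr0 mul0r add0r.
Qed.

Lemma rdiff_conj F z : rdiff F z -> rdiff (fun w => conjc (F w)) z.
Proof. by move=> [A [B FAB]]; do 2!eexists; exact: wirt_conj FAB. Qed.

Lemma rdiff_P2 z : rdiff (fun w => P w ^+ 2) z.
Proof. by do 2!eexists; exact: wirt_P2. Qed.

Lemma rdiff_2PP' z : rdiff (fun w => 2 * P w * P' w) z.
Proof.
apply: rdiffM; last exact/holo_rdiff/P'_holo.
by apply: rdiffM; [exact: rdiff_cst|exact/holo_rdiff/zeros_poly_holo].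
Qed.

Lemma rdiff_pot_z z : U z -> f z != 0 -> rdiff pot_z z.
Proof.
move=> Uz fz; have [hL _] := holo_logd oV fH (UV Uz) fz.
apply: rdiffD; apply: rdiffM; [exact: rdiff_2PP'| |exact: rdiff_P2|exact: holo_rdiff].
by do 2!eexists; exact: wirt_lognorm (fH (UV Uz)) fz.
Qed.

Lemma rdiff_pot_zzb z : U z -> f z != 0 -> rdiff pot_zzb z.
Proof.
move=> Uz fz; have [hL _] := holo_logd oV fH (UV Uz) fz.
by apply: rdiffM; [exact: rdiff_2PP'|exact/rdiff_conj/holo_rdiff].
Qed.

Lemma rdiff_pot_zbzb z : U z -> f z != 0 -> rdiff pot_zbzb z.
Proof.
move=> Uz fz; have [_ hL'] := holo_logd oV fH (UV Uz) fz.
by apply: rdiffM; [exact: rdiff_P2|exact/rdiff_conj/holo_rdiff].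
Qed.

(** Every term has a factor P, which absorbs the default values of the logarithm and of the division
    by f(z) = 0. So these formulas agree at the zeros with the values 0 prescribed there for u and
    g. *)
Lemma pot_at_zero z : U z -> f z = 0 ->
  [/\ pot z = 0, pot_z z = 0, pot_zb z = 0, pot_zzb z = 0 & pot_zbzb z = 0].
Proof.
move=> Uz fz; rewrite /pot /pot_z /pot_zb /pot_zzb /pot_zbzb (zeros_poly_zero_in Uz fz).
by rewrite expr0n /= !(mulr0, mul0r) addr0.
Qed.

Lemma normc2 : normc (2 : R[i]) = 2.
Proof. by rewrite (_ : 2 = 2%:C) ?normc_real ?ger0_norm// rmorph_nat. Qed.

(** With t = |w - z|: P = O(t), P' = O(1), f'/f = O(1/t), (f'/f)' = O(1/t^2) and log |f|^2 =
    O(t^(-1/2)). Products give O(t^(3/2)) for the function, O(t^(1/2)) for its first derivatives and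
    O(1) for the log-free second ones. The constant 3 is 2 + 1, from the two terms of [pot_z]. *)
Lemma pot_bounds z : U z -> f z = 0 -> exists2 C, 0 < C & \forall w \near z, w != z ->
  [/\ normc (pot w) <= C * Num.sqrt (normc (w - z)) * normc (w - z),
      normc (pot_z w) <= C * Num.sqrt (normc (w - z)),
      normc (pot_zb w) <= C * Num.sqrt (normc (w - z)),
      normc (pot_zzb w) <= C & normc (pot_zbzb w) <= C].
Proof.
move=> Uz fz; have [C C0 B] := zero_bounds Uz fz.
have C3 : 0 < C ^+ 3 by rewrite exprn_gt0.
exists (3 * C ^+ 3); first by rewrite mulr_gt0.
apply: nearC2 B (normc_near z ltr01) _ => w Bw w1 wz.
have [B1 B2 B3 B4 B5] := Bw wz.
have t0 : 0 < normc (w - z) by rewrite normc_gt0 subr_eq0.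
set t := normc (w - z) in t0 w1 B1 B3 B4 B5 *.
have ts := le_sqrt t0 w1; have s0 : 0 < Num.sqrt t by rewrite sqrtr_gt0.
have ss : t = Num.sqrt t * Num.sqrt t by rewrite -expr2 sqr_sqrtr// ltW.
set s := Num.sqrt t in ts s0 ss B5 *.
have P2 : normc (P w) ^+ 2 <= C ^+ 2 * t ^+ 2.
  by rewrite -exprMn lerXn2r// nnegrE ?normc_ge0// mulr_ge0 ?ltW.
have PP : 2 * normc (P w) * normc (P' w) <= 2 * C ^+ 2 * t.
  have := ler_pM (normc_ge0 _) (normc_ge0 _) B1 B2; rewrite expr2; lra.
have PP0 : 0 <= 2 * normc (P w) * normc (P' w) by rewrite !mulr_ge0 ?normc_ge0.
have E1 : C ^+ 2 * t ^+ 2 * (C / s) = C ^+ 3 * s * t.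
  by rewrite ss; field; rewrite gt_eqF.
have E2 : 2 * C ^+ 2 * t * (C / s) = 2 * (C ^+ 3 * s).
  by rewrite {1}ss; field; rewrite gt_eqF.
have E3 : C ^+ 2 * t ^+ 2 * (C / t) = C ^+ 3 * t by field; rewrite gt_eqF.
have E4 : 2 * C ^+ 2 * t * (C / t) = 2 * C ^+ 3 by field; rewrite gt_eqF.
have E5 : C ^+ 2 * t ^+ 2 * (C / t ^+ 2) = C ^+ 3 by field; rewrite gt_eqF.
have Cts : C ^+ 3 * t <= C ^+ 3 * s by rewrite ler_wpM2l// ltW.
have Cst : 0 < C ^+ 3 * s by rewrite mulr_gt0.
have Cstt : 0 < C ^+ 3 * s * t by rewrite mulr_gt0.
have N2 : normc (2 * P w * P' w) = 2 * normc (P w) * normc (P' w).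
  by rewrite !normcM normc2.
rewrite /pot /pot_z /pot_zb /pot_zzb /pot_zbzb; split.
- rewrite normcM normc_exp normc_real.
  have := ler_pM (sqr_ge0 _) (normr_ge0 _) P2 B5; rewrite E1; lra.
- apply: le_trans (le_normcD _ _) _.
  rewrite normcM N2 [normc (P w ^+ 2 * _)]normcM normc_exp normc_real.
  have := ler_pM PP0 (normr_ge0 _) PP B5; rewrite E2.
  have := ler_pM (sqr_ge0 _) (normc_ge0 _) P2 B3; rewrite E3; lra.
- rewrite normcM normc_exp normc_conj.
  have := ler_pM (sqr_ge0 _) (normc_ge0 _) P2 B3; rewrite E3; lra.
- rewrite normcM N2 normc_conj.
  have := ler_pM PP0 (normc_ge0 _) PP B3; rewrite E4; lra.
- rewrite normcM normc_exp normc_conj.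
  have := ler_pM (sqr_ge0 _) (normc_ge0 _) P2 B4; rewrite E5; lra.
Qed.

(** At a zero, [pot] is O(t^(3/2)) = o(t), hence differentiable with both derivatives 0, the values
    taken there by [pot_z] and [pot_zb]. *)
Lemma wirt_pot_in z : U z -> wirt pot z (pot_z z) (pot_zb z).
Proof.
move=> Uz; have [fz|fz] := eqVneq (f z) 0; last exact: wirt_pot.
have [p0 pz0 pb0 _ _] := pot_at_zero Uz fz; rewrite pz0 pb0.
have [C C0 B] := pot_bounds Uz fz.
move=> e e0; have [d d0 H] := sqrt_small C0 e0.
apply: nearC2 B (normc_near z d0) _ => w Bw wd.
rewrite p0 !mul0r !subr0.
have [->|wz] := eqVneq w z; first by rewrite p0 subrr normc0 mulr0.
have [b _ _ _ _] := Bw wz; apply: le_trans b _.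
by rewrite ler_wpM2r ?normc_ge0// ltW// H// normc_gt0 subr_eq0.
Qed.

Lemma continuous_pot_z z : U z -> {for z, continuous pot_z}.
Proof.
move=> Uz; have [fz|fz] := eqVneq (f z) 0; last exact/rdiff_continuous/rdiff_pot_z.
have [_ pz0 _ _ _] := pot_at_zero Uz fz.
have [C C0 B] := pot_bounds Uz fz.
apply: (@continuous_bounded_by _ _ (fun t => C * Num.sqrt t)) => //.
  by apply: nearC1 B _ => w Bw wz; have [_ b _ _ _] := Bw wz.
by move=> e e0; exact: sqrt_small.
Qed.

Lemma continuous_pot_zb z : U z -> {for z, continuous pot_zb}.
Proof.
move=> Uz; have [fz|fz] := eqVneq (f z) 0.
  have [_ _ pb0 _ _] := pot_at_zero Uz fz.
  have [C C0 B] := pot_bounds Uz fz.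
  apply: (@continuous_bounded_by _ _ (fun t => C * Num.sqrt t)) => //.
    by apply: nearC1 B _ => w Bw wz; have [_ _ b _ _] := Bw wz.
  by move=> e e0; exact: sqrt_small.
by apply: wirt_continuous (wirt_pot_zb Uz fz).
Qed.

Lemma locally_bounded_pot2 z : U z ->
  exists C, \forall w \near z, normc (pot_zzb w) <= C /\ normc (pot_zbzb w) <= C.
Proof.
move=> Uz; have [fz|fz] := eqVneq (f z) 0.
  have [_ _ _ z0 z0'] := pot_at_zero Uz fz.
  have [C C0 B] := pot_bounds Uz fz.
  exists C; apply: nearC1 B _ => w Bw; have [->|wz] := eqVneq w z.
    by rewrite z0 z0' normc0 ltW.
  by have [] := Bw wz.
have n1 := continuous_normc_bounded (rdiff_continuous (rdiff_pot_zzb Uz fz)).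
have n2 := continuous_normc_bounded (rdiff_continuous (rdiff_pot_zbzb Uz fz)).
exists (Num.max (normc (pot_zzb z) + 1) (normc (pot_zbzb z) + 1)).
by apply: nearC2 n1 n2 _ => w b1 b2; rewrite !le_max b1 b2 orbT.
Qed.

Lemma Ck1_pot u : (forall z, U z -> u z = pot z) -> Ck 1 U u.
Proof.
move=> uE; have W z : U z -> wirt u z (pot_z z) (pot_zb z).
  move=> Uz; apply: wirt_ext (wirt_pot_in Uz).
  by apply: nearC1 (near_open oU Uz) _ => w /uE.
split.
- by move=> z /set_mem /W; exact: wirt_continuous.
- by move=> z /W Wz; split; exact: (wirt_dir _ Wz).1.
- move=> z /set_mem Uz; apply: (@continuous_ext _ (fun w => 1 * pot_z w + 1 * pot_zb w)).
    apply: nearC1 (near_open oU Uz) _ => w /W /wirt_partial_x ->.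
    by rewrite !mul1r.
  by apply: continuous_lin; [exact: continuous_pot_z|exact: continuous_pot_zb].
move=> z /set_mem Uz.
apply: (@continuous_ext _ (fun w => imag_unit * pot_z w + (- imag_unit) * pot_zb w)).
  apply: nearC1 (near_open oU Uz) _ => w /W /wirt_partial_y ->.
  by rewrite mulrBr mulNr.
by apply: continuous_lin; [exact: continuous_pot_z|exact: continuous_pot_zb].
Qed.

(** [d_zbar u] equals [pot_zb] on a whole neighbourhood of z and is already free of the logarithm,
    so the remaining [d_z] can be taken on [pot_zb]. *)
Lemma laplacian_pot u z : (forall z, U z -> u z = pot z) -> U z -> f z != 0 ->
  laplacian u z = 4 * pot_zzb z.
Proof.
move=> uE Uz fz; rewrite /laplacian; congr (_ * _).
apply: wirt_d_z; apply: wirt_ext (wirt_pot_zb Uz fz).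
apply: nearC1 (near_open oU Uz) _ => w Uw.
rewrite (wirt_d_zbar (A := pot_z w) (B := pot_zb w))//.
apply: wirt_ext (wirt_pot_in Uw).
by apply: nearC1 (near_open oU Uw) _ => v /uE.
Qed.

End Potential.

(** * Plane integrals and integration by parts *)

Section PlaneMeasure.
Context {R : realType}.
Implicit Types (z w : R[i]) (F G : R[i] -> R[i]) (A D : set R[i]) (h : R[i] -> R).
Notation plane := (measurableTypeR R * measurableTypeR R)%type.
Notation mu := (@lebesgue_measure R).

(** The sigma-algebra is that of the product, the topology that of the modulus. They meet through a
    countable union of open rectangles with rational ends, enumerated by [unpickle]. *)
Lemma open_plane_measurable A : open A -> measurable (@of_xy R @^-1` A : set plane).
Proof.
move=> oA.
pose rectangle (q : rat * rat * (rat * rat)) : set plane :=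
  `]ratr q.1.1, ratr q.1.2[%classic `*` `]ratr q.2.1, ratr q.2.2[%classic.
have -> : (@of_xy R @^-1` A : set plane) =
    \bigcup_(n in [set n | exists2 q, unpickle n = Some q & rectangle q `<=` @of_xy R @^-1` A])
    (if unpickle n is Some q then rectangle q else set0).
  apply/seteqP; split=> [[x y] Axy|[x y] [n [q nE qA]]]; last by rewrite nE; exact: qA.
  have /nbhs_normcP[e e0 eA] : nbhs (of_xy (x, y)) A by exact: open_nbhs_nbhs.
  have H (t : R) : exists q1 q2 : rat, [/\ t - e / 2 < ratr q1, ratr q1 < t, t < ratr q2 & ratr q2 < t + e / 2].
    have /rat_in_itvoo[q1] : t - e / 2 < t by lra.
    have /rat_in_itvoo[q2] : t < t + e / 2 by lra.
    by rewrite !in_itv /= => /andP[? ?] /andP[? ?]; exists q1, q2.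
  have [p1 [p2 [H1 H2 H3 H4]]] := H x; have [q1 [q2 [H5 H6 H7 H8]]] := H y.
  have [n nE] : exists n, unpickle n = Some (p1, p2, (q1, q2)).
    by eexists; exact: pickleK.
  exists n; last first.
    by rewrite nE; split; rewrite /= in_itv /=; apply/andP; split.
  exists (p1, p2, (q1, q2)) => //.
  move=> [u v] [/=]; rewrite !in_itv /= => /andP[? ?] /andP[? ?]; apply: eA.
  apply: le_lt_trans (normc_le_ReIm _) _; rewrite Re_sub Im_sub /=.
  have -> : e = e / 2 + e / 2 by lra.
  by apply: ltrD; rewrite ltr_norml; apply/andP; split; lra.
apply: bigcup_measurable => n _; case: (unpickle n) => [q|//].
by apply: measurableX; exact: measurable_itv.
Qed.

Lemma closed_plane_measurable A : closed A -> measurable (@of_xy R @^-1` A : set plane).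
Proof.
move=> cA; have -> : (@of_xy R @^-1` A : set plane) = ~` (@of_xy R @^-1` (~` A)).
  by rewrite -[LHS]setCK.
by apply: measurableC; apply: open_plane_measurable; exact: closed_openC.
Qed.

Lemma continuous_plane_measurable D h : open D ->
  (forall z, D z -> forall e : R, 0 < e -> \forall w \near z, `|h w - h z| < e) ->
  measurable_fun (@of_xy R @^-1` D : set plane) (h \o @of_xy R).
Proof.
move=> oD hc; apply: (measurability _ (measurable_realfun.RGenOpens.measurableE R)).
move=> _ [_ [a [b ->] <-]] /=.
have -> : (@of_xy R @^-1` D : set plane) `&` (h \o @of_xy R) @^-1` `]a, b[ =
    @of_xy R @^-1` (D `&` h @^-1` `]a, b[) by [].
apply: open_plane_measurable; rewrite openE => z [Dz]; rewrite /= in_itv /= => /andP[az zb].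
have e0 : 0 < Num.min (h z - a) (b - h z) by rewrite lt_min !subr_gt0 az.
apply: nearC2 (near_open oD Dz) (hc z Dz _ e0) _ => w Dw.
rewrite lt_min !ltr_norml => /andP[/andP[h1 h2] /andP[h3 h4]].
by split => //=; rewrite in_itv /=; apply/andP; split; lra.
Qed.

Lemma near_neq_seq (S : seq R[i]) z : \forall w \near z, w \in S -> w = z.
Proof.
elim: S => [|s S IH]; first by apply: nearCW.
have ns : \forall w \near z, w = s -> w = z.
  have [->|sz] := eqVneq s z; first by apply: nearCW.
  apply/nbhs_normcP; exists (normc (s - z)); first by rewrite normc_gt0 subr_eq0.
  by move=> w H ws; rewrite ws ltxx in H.
apply: nearC2 IH ns _ => w H1 H2; rewrite in_cons => /orP[/eqP/H2//|]; exact: H1.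
Qed.

Lemma finite_closed (S : seq R[i]) (X : set R[i]) : (forall z, X z -> z \in S) -> closed X.
Proof.
move=> XS; rewrite -[X]setCK; apply: open_closedC; rewrite openE => z Xz.
by apply: nearC1 (near_neq_seq S z) _ => w H Xw; apply: Xz; rewrite -(H (XS _ Xw)).
Qed.

(* Points of S carry arbitrary values: any function is measurable on a finite set. *)
Lemma piecewise_plane_measurable (S : seq R[i]) D h : open D ->
  (forall z, D z -> z \notin S -> forall e : R, 0 < e -> \forall w \near z, `|h w - h z| < e) ->
  measurable_fun (@of_xy R @^-1` D : set plane) (h \o @of_xy R).
Proof.
move=> oD hc.
have cS : closed [set` S] by apply: (@finite_closed S).
have oDS : open (D `&` ~` [set` S]) by apply: openI => //; exact: closed_openC.
have mDS := continuous_plane_measurable (h := h) oDS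
  (fun z Dz => hc z Dz.1 (introN idP Dz.2)).
move=> mD Y mY.
have -> : (@of_xy R @^-1` D : set plane) `&` (h \o @of_xy R) @^-1` Y =
   ((@of_xy R @^-1` (D `&` ~` [set` S]) : set plane) `&` (h \o @of_xy R) @^-1` Y) `|`
   @of_xy R @^-1` (D `&` [set` S] `&` h @^-1` Y).
  apply/seteqP; split => [p [Dp Yp]|p [[[Dp _] Yp]|[[Dp _] Yp]]]; [|by []|by []].
  by have [pS|pS] := pselect (of_xy p \in S); [right|left].
apply: measurableU; first by apply: mDS => //; exact: open_plane_measurable.
apply: closed_plane_measurable.
by apply: (@finite_closed S) => z [[_ zS] _].
Qed.

Definition box (r : R) : set R[i] := [set z | `|Re z| <= r /\ `|Im z| <= r].

Lemma box_preimage r : (@of_xy R @^-1` box r : set plane) = `[- r, r] `*` `[- r, r].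
Proof.
by apply/seteqP; split => -[x y]; rewrite /box /= !in_itv /= !ler_norml; case.
Qed.

Lemma box_measurable r : measurable (@of_xy R @^-1` box r : set plane).
Proof. by rewrite box_preimage; apply: measurableX; exact: measurable_itv. Qed.

Lemma box_finite r : (@dA R (@of_xy R @^-1` box r) < +oo)%E.
Proof.
pose J : set (measurableTypeR R) := `[- r, r]%classic.
have E : (dA (J `*` J) = mu J * mu J)%E by apply: product_measure1E; exact: measurable_itv.
rewrite box_preimage; apply: le_lt_trans (_ : _ <= (mu J * mu J)%E)%E _; first by rewrite E.
by rewrite lebesgue_measure_itv /=; case: ifP => _; rewrite ?mul0e// -EFinM ltry.
Qed.

Definition bounded_plane (r M : R) (k : plane -> R) :=
  [/\ measurable_fun setT k, (forall p, `|k p| <= M) & forall p, ~ box r (of_xy p) -> k p = 0].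

Lemma bounded_plane_integrable r M k : bounded_plane r M k ->
  (@dA R).-integrable setT (EFin \o k).
Proof.
move=> [mk kM k0].
have -> : EFin \o k = (EFin \o k) \_ (@of_xy R @^-1` box r).
  apply/funext => p; rewrite /patch; case: ifPn => //.
  by rewrite notin_setE /= => /k0 ->.
apply/(integrable_mkcond _ (box_measurable r)).
apply: measurable_bounded_integrable.
- exact: box_measurable.
- exact: box_finite.
- exact: measurable_funTS.
exists M; split; first exact: num_real.
by move=> x Mx p _; apply: le_trans (kM p) (ltW Mx).
Qed.

(** Serves for the inner integrals in Fubini's theorem, which are controlled only off the lines
    through exceptional points. *)
Lemma negligible_finite (S : seq R) (k : R -> \bar R) :
  (forall y, y \notin S -> k y = 0%E) -> (\int[mu]_y k y = 0)%E.
Proof.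
move=> k0.
have -> : k = k \_ [set` S].
  apply/funext => y; rewrite /patch; case: ifPn => //.
  by rewrite notin_setE => yS; apply: k0; apply/negP.
rewrite -integral_mkcond.
have cS (X : set R) : X `<=` [set` S] -> countable X.
  by move=> XS; apply: finite_set_countable; exact: sub_finite_set XS (finite_seq S).
have mX (X : set R) : X `<=` [set` S] -> measurable (X : set (measurableTypeR R)).
  by move=> XS; apply: countable_measurable; [move=> t; exact: measurable_set1|exact: cS].
apply: null_set_integral; first exact: mX.
  by move=> _ Y mY; apply: mX => y [].
by apply: countable_lebesgue_measure0; exact: cS.
Qed.

Lemma segment_integral_derivative (r : R) (w wx : R -> R) : 0 < r ->
  (forall x : R, is_derive x 1 w (wx x)) -> continuous wx ->
  (forall x, r <= `|x| -> w x = 0 /\ wx x = 0) ->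
  (\int[mu]_x (wx x)%:E = 0)%E.
Proof.
move=> r0 dw cwx out.
have -> : (fun x => (wx x)%:E) = (fun x => (wx x)%:E) \_ `[- r, r].
  apply/funext => x; rewrite /patch; case: ifPn => //.
  rewrite notin_setE /= in_itv /= -ler_norml => /negP; rewrite -ltNge => /ltW /out[_ ->//].
rewrite -integral_mkcond.
have cw : continuous w.
  by move=> x; apply/differentiable_continuous/derivable1_diffP; exact: ex_derive.
rewrite (@continuous_FTC2 _ wx w).
- by rewrite (out r _).1 ?ger0_norm ?(ltW r0)// (out (- r) _).1 ?normrN ?ger0_norm ?(ltW r0)// subee.
- by lra.
- by apply: continuous_in_subspaceT => x _; exact: cwx.
- split.
  + by move=> x _; exact: ex_derive.
  + by apply: cvg_at_right_filter; exact: cw.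
  + by apply: cvg_at_left_filter; exact: cw.
by move=> x _; rewrite derive1E; exact: derive_val.
Qed.

(** By Fubini's theorem with x innermost: off the finitely many heights in S, the inner integral is
    that of the derivative of a compactly supported function. *)
Lemma plane_integral_x r M (S : seq R) (w wx : R -> R -> R) : 0 < r ->
  (forall y, y \notin S -> forall x : R, is_derive x 1 (w^~ y) (wx x y)) ->
  (forall y, y \notin S -> continuous (wx^~ y)) ->
  (forall x y, r <= `|x| -> w x y = 0 /\ wx x y = 0) ->
  bounded_plane r M (fun p => wx p.1 p.2) ->
  (\int[@dA R]_p (wx p.1 p.2)%:E = 0)%E.
Proof.
move=> r0 dw cwx out bw.
have iw := bounded_plane_integrable bw.
rewrite -(integral21_prod_meas1 iw).
apply: (@negligible_finite S) => y yS.
apply: (@segment_integral_derivative r (w^~ y)) => //; first exact: dw.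
  exact: cwx.
by move=> x /out; apply.
Qed.

Lemma plane_integral_y r M (S : seq R) (w wy : R -> R -> R) : 0 < r ->
  (forall x, x \notin S -> forall y : R, is_derive y 1 (w x) (wy x y)) ->
  (forall x, x \notin S -> continuous (wy x)) ->
  (forall x y, r <= `|y| -> w x y = 0 /\ wy x y = 0) ->
  bounded_plane r M (fun p => wy p.1 p.2) ->
  (\int[@dA R]_p (wy p.1 p.2)%:E = 0)%E.
Proof.
move=> r0 dw cwy out bw.
have iw := bounded_plane_integrable bw.
rewrite -(integral12_prod_meas1 iw).
apply: (@negligible_finite S) => x xS.
apply: (@segment_integral_derivative r (w x)) => //; first exact: dw.
  exact: cwy.
by move=> y /out; apply.
Qed.

End PlaneMeasure.

(** * From partial derivatives to differentials, and symmetry of mixed derivatives *)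

Section SmoothFunctions.
Context {R : realType}.
Implicit Types (z w v : R[i]) (F G : R[i] -> R[i]) (h hx hy : R[i] -> R).

Lemma derivable_shift (k : R -> R) (x : R) : derivable (fun t => k (x + t)) 0 1 ->
  is_derive x 1 k (derive1 (fun t => k (x + t)) 0).
Proof.
move=> dk; have /is_derive_estimate H : is_derive (0 : R) 1 (fun t => k (x + t))
    (derive1 (fun t => k (x + t)) 0).
  by apply: DeriveDef => //; rewrite derive1E.
apply/is_derive_estimate => e e0; have /nbhs_normP[d /= d0 Hd] := H e e0.
apply/nbhs_normP; exists d => // y; rewrite /ball_ /= => xy.
have yx : ball_ Num.Def.normr 0 d (y - x) by rewrite /ball_ /= sub0r normrN distrC.
have := Hd (y - x) yx; rewrite subr0 addr0.
by rewrite [x + _]addrC subrK.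
Qed.

Lemma dir_derivable_line F v z (l : R -> R[i]) (t0 : R) : (forall t, l (t0 + t) = z + t%:C * v) ->
  dir_derivable F v z ->
  is_derive t0 1 (fun s => Re (F (l s))) (Re (dir_derive v F z)) /\
  is_derive t0 1 (fun s => Im (F (l s))) (Im (dir_derive v F z)).
Proof.
move=> lE; have E (p : R[i] -> R) : (fun t => p (on_line F z v t)) = (fun t => p (F (l (t0 + t)))).
  by apply/funext => t; rewrite /on_line lE.
rewrite /dir_derivable /dir_derive !E => -[d1 d2]; split => /=.
  exact: (@derivable_shift (fun s => Re (F (l s)))).
exact: (@derivable_shift (fun s => Im (F (l s)))).
Qed.

Lemma dir_derivable_horizontal F (x y : R) : dir_derivable F 1 (x +i* y) ->
  is_derive x 1 (fun s => Re (F (s +i* y))) (Re (partial_x F (x +i* y))) /\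
  is_derive x 1 (fun s => Im (F (s +i* y))) (Im (partial_x F (x +i* y))).
Proof.
apply: (@dir_derivable_line F 1 _ (fun s => s +i* y)) => t.
by rewrite mulr1; apply: complex_eq; rewrite /= ?addr0.
Qed.

Lemma dir_derivable_vertical F (x y : R) : dir_derivable F imag_unit (x +i* y) ->
  is_derive y 1 (fun s => Re (F (x +i* s))) (Re (partial_y F (x +i* y))) /\
  is_derive y 1 (fun s => Im (F (x +i* s))) (Im (partial_y F (x +i* y))).
Proof.
apply: (@dir_derivable_line F imag_unit _ (fun s => x +i* s)) => t.
by apply: complex_eq; rewrite /= ?mul0r ?mulr0 ?mulr1 ?subrr ?addr0.
Qed.

Lemma mean_value (k dk : R -> R) (s t : R) : (forall x : R, is_derive x 1 k (dk x)) ->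
  exists2 c, `|c - s| <= `|t - s| & k t - k s = dk c * (t - s).
Proof.
move=> dK.
have ck x : {for x, continuous k}.
  by apply/differentiable_continuous/derivable1_diffP; exact: ex_derive.
have cw a b : {within `[a, b], continuous k} by apply: continuous_in_subspaceT => x _; exact: ck.
case: (ltgtP s t) => [st|ts|E]; last by exists t; rewrite E !subrr ?mulr0.
  have [c] := MVT st (fun x _ => dK x) (cw s t).
  by rewrite in_itv /= => /andP[? ?] E; exists c; rewrite // !ger0_norm; lra.
have [c] := MVT ts (fun x _ => dK x) (cw t s).
rewrite in_itv /= => /andP[? ?] E; exists c; last by rewrite -opprB E -mulrN opprB.
by rewrite distrC [X in _ <= X]distrC !ger0_norm; lra.
Qed.

Definition C1_at h hx hy :=
  [/\ forall x y : R, is_derive x 1 (fun s => h (s +i* y)) (hx (x +i* y)),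
      forall x y : R, is_derive y 1 (fun s => h (x +i* s)) (hy (x +i* y)) &
      forall z (e : R), 0 < e -> \forall w \near z, `|hx w - hx z| <= e].

(** The increment from x + iy to u + iv passes through x + iv: the vertical part uses the derivative
    at x + iy itself, the horizontal part the mean value theorem and the continuity of hx. *)
Lemma C1_differentiable h hx hy z : C1_at h hx hy -> forall e : R, 0 < e ->
  \forall w \near z, `|h w - h z - hx z * Re (w - z) - hy z * Im (w - z)| <=
     e * normc (w - z).
Proof.
move=> [dx dy cx] e e0; have e2 : 0 < e / 2 by lra.
have /nbhs_normcP[d1 d10 H1] := cx z _ e2.
case: z H1 => x y H1.
have /is_derive_estimate/(_ _ e2)/nbhs_normP[d2 /= d20 H2] := dy x y.
have d0 : 0 < Num.min d1 d2 by rewrite lt_min d10.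
apply: nearC1 (normc_near (x +i* y) d0) _ => -[u v]; rewrite lt_min => /andP[w1 w2].
have [c cx' E] := mean_value x u (fun s => dx s v).
have nx := ge_normc_Re ((u +i* v) - (x +i* y)).
have ny := ge_normc_Im ((u +i* v) - (x +i* y)).
rewrite Re_sub Im_sub /= in nx ny *.
have K1 : `|hx (c +i* v) - hx (x +i* y)| <= e / 2.
  apply: H1; apply: le_lt_trans w1.
  have H (p : R[i]) : normc p = Num.sqrt (Re p ^+ 2 + Im p ^+ 2).
    by apply/eqP; rewrite -(eqrXn2 (n := 2)) ?normc_ge0 ?sqrtr_ge0// normc_sqr
      sqr_sqrtr ?addr_ge0 ?sqr_ge0//; case: p => p q /=; rewrite mulrN opprK -!expr2.
  rewrite !H !Re_sub !Im_sub /= ler_wsqrtr// lerD2r.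
  by rewrite -[X in X <= _]real_normK ?num_real// -[X in _ <= X]real_normK ?num_real// lerXn2r ?nnegrE.
have K2 : `|h (x +i* v) - h (x +i* y) - hy (x +i* y) * (v - y)| <= e / 2 * `|v - y|.
  by apply: H2; rewrite /ball_ /= distrC; apply: le_lt_trans w2.
rewrite (_ : h (u +i* v) - _ - _ - _ = (hx (c +i* v) - hx (x +i* y)) * (u - x) +
   (h (x +i* v) - h (x +i* y) - hy (x +i* y) * (v - y))); last by lra.
apply: le_trans (ler_normD _ _) _; rewrite normrM.
have := ler_pM (normr_ge0 _) (normr_ge0 _) K1 nx.
have := ler_wpM2l (ltW e2) ny; lra.
Qed.

(* Both iterated difference quotients equal the second difference of h. *)
Lemma schwarz h hx hy hxy hyx z : C1_at h hx hy ->
  (forall x y : R, is_derive y 1 (fun s => hx (x +i* s)) (hxy (x +i* y))) ->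
  (forall x y : R, is_derive x 1 (fun s => hy (s +i* y)) (hyx (x +i* y))) ->
  (forall e : R, 0 < e -> \forall w \near z, `|hxy w - hxy z| <= e) ->
  (forall e : R, 0 < e -> \forall w \near z, `|hyx w - hyx z| <= e) ->
  hxy z = hyx z.
Proof.
move=> [dx dy _] dxy dyx cxy cyx.
apply/eqP; rewrite -subr_eq0 -normr_eq0; apply/negP => /negP N0.
have {}N0 : 0 < `|hxy z - hyx z| by rewrite lt_def N0 normr_ge0.
have e0 : 0 < `|hxy z - hyx z| / 3 by lra.
have /nbhs_normcP[d1 d10 H1] := cxy _ e0.
have /nbhs_normcP[d2 d20 H2] := cyx _ e0.
pose t := Num.min d1 d2 / 3.
have t0 : 0 < t by rewrite divr_gt0// lt_min d10.
have [t1 t2] : t + t < d1 /\ t + t < d2.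
  have : Num.min d1 d2 <= d1 by rewrite ge_min lexx.
  have : Num.min d1 d2 <= d2 by rewrite ge_min lexx orbT.
  have -> : Num.min d1 d2 = 3 * t by rewrite /t; field.
  by split; lra.
case: z cxy cyx N0 e0 H1 H2 => x y cxy cyx N0 e0 H1 H2.
have tE (a : R) : a + t - a = t by lra.
have near_pt (d c c' : R) : t + t < d -> `|c - x| <= t -> `|c' - y| <= t ->
    normc ((c +i* c') - (x +i* y)) < d.
  move=> td cx cy; apply: le_lt_trans (normc_le_ReIm _) _.
  by rewrite Re_sub Im_sub /=; lra.
have [c1 c1x E1] := mean_value x (x + t)
  (k := fun s => h (s +i* (y + t)) - h (s +i* y))
  (dk := fun s => hx (s +i* (y + t)) - hx (s +i* y)) (fun s => is_deriveB (dx s _) (dx s _)).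
have [c2 c2y E2] := mean_value y (y + t) (fun s => dxy c1 s).
have [c3 c3y E3] := mean_value y (y + t)
  (k := fun s => h ((x + t) +i* s) - h (x +i* s))
  (dk := fun s => hy ((x + t) +i* s) - hy (x +i* s)) (fun s => is_deriveB (dy _ s) (dy _ s)).
have [c4 c4x E4] := mean_value x (x + t) (fun s => dyx s c3).
rewrite !tE (gtr0_norm t0) in c1x c2y c3y c4x E1 E2 E3 E4.
have B1 := H1 (c1 +i* c2) (near_pt _ _ _ t1 c1x c2y).
have B2 := H2 (c4 +i* c3) (near_pt _ _ _ t2 c4x c3y).
have E : hxy (c1 +i* c2) * t * t = hyx (c4 +i* c3) * t * t.
  by rewrite -E2 -E4 -E1 -E3; ring.
have {}E : hxy (c1 +i* c2) = hyx (c4 +i* c3).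
  have tn0 : t != 0 by rewrite gt_eqF.
  exact/(mulIf tn0)/(mulIf tn0).
rewrite E in B1.
have := ler_distD (hyx (c4 +i* c3)) (hxy (x +i* y)) (hyx (x +i* y)).
by rewrite (distrC (hxy _) (hyx (c4 +i* c3))); lra.
Qed.

Lemma continuous_ReIm F z : {for z, continuous F} -> forall e : R, 0 < e ->
  \forall w \near z, `|Re (F w) - Re (F z)| <= e /\
    `|Im (F w) - Im (F z)| <= e.
Proof.
move=> /continuous_normcP Fc e e0; apply: nearC1 (Fc e e0) _ => w /ltW Fw.
by rewrite -Re_sub -Im_sub; split; [apply: le_trans (ge_normc_Re _) Fw|apply: le_trans (ge_normc_Im _) Fw].
Qed.

Lemma Ck1_C1_at F : Ck 1 setT F ->
  C1_at (fun z => Re (F z)) (fun z => Re (partial_x F z)) (fun z => Re (partial_y F z)) /\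
  C1_at (fun z => Im (F z)) (fun z => Im (partial_x F z)) (fun z => Im (partial_y F z)).
Proof.
move=> [_ dF cx _].
have cx' z : {for z, continuous (partial_x F)} by apply: cx; rewrite inE.
split; split=> [x y|x y|z e e0].
- exact: (dir_derivable_horizontal (dF _ I).1).1.
- exact: (dir_derivable_vertical (dF _ I).2).1.
- by apply: nearC1 (continuous_ReIm (cx' z) e0) _ => w [].
- exact: (dir_derivable_horizontal (dF _ I).1).2.
- exact: (dir_derivable_vertical (dF _ I).2).2.
- by apply: nearC1 (continuous_ReIm (cx' z) e0) _ => w [].
Qed.

(** [Ck] speaks only of partial derivatives; this turns those of a test function into a
    differential, to which the rules for [wirt] apply. *)
Lemma Ck1_wirt F z : Ck 1 setT F -> wirt F z (d_z F z) (d_zbar F z).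
Proof.
move=> /Ck1_C1_at[CR CI] e e0; have e2 : 0 < e / 2 by lra.
apply: nearC2 (C1_differentiable z CR e2) (C1_differentiable z CI e2) _ => w H1 H2.
have -> : F w - F z - d_z F z * (w - z) - d_zbar F z * conjc (w - z) =
   F w - F z - (Re (w - z))%:C * partial_x F z - (Im (w - z))%:C * partial_y F z.
  rewrite /d_z /d_zbar; set p := partial_x F z; set q := partial_y F z.
  have E1 (v : R[i]) : v + conjc v = 2 * (Re v)%:C by case: v => a b; apply: complex_eq => /=; ring.
  have E2 (v : R[i]) : imag_unit * (v - conjc v) = - 2 * (Im v)%:C.
    by case: v => a b; apply: complex_eq; rewrite /imag_unit /=; ring.
  move: (w - z) => v.
  have -> : 2^-1 * (p - imag_unit * q) * v = 2^-1 * (p * v) - 2^-1 * (imag_unit * v) * q by ring.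
  have -> : 2^-1 * (p + imag_unit * q) * conjc v = 2^-1 * (p * conjc v) + 2^-1 * (imag_unit * conjc v) * q by ring.
  have -> : (Re v)%:C = 2^-1 * (v + conjc v) by rewrite E1; field.
  have -> : (Im v)%:C = - 2^-1 * (imag_unit * (v - conjc v)) by rewrite E2; field.
  by ring.
apply: le_trans (normc_le_ReIm _) _.
move: H1 H2; move: (w - z) (partial_x F z) (partial_y F z) => v p q H1 H2.
rewrite !Re_sub !Im_sub !Re_scale !Im_scale.
apply: (@le_trans _ _ (e / 2 * normc v + e / 2 * normc v)); last by lra.
by apply: lerD; rewrite (mulrC (Re v)) (mulrC (Im v)).
Qed.

End SmoothFunctions.

(** * Linearity of plane integrals, and Stokes' formula in Wirtinger form *)

Section PlaneIntegral.
Context {R : realType}.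
Implicit Types (z w c d : R[i]) (F G W : R[i] -> R[i]) (S : seq R[i]) (r M : R).
Notation plane := (measurableTypeR R * measurableTypeR R)%type.

Definition outside r : set R[i] := [set z | r <= `|Re z| \/ r <= `|Im z|].

(** A class of integrands on which Fubini's theorem and linearity are available: bounded, zero
    outside a box, continuous off a finite set S, which will consist of zeros of f. *)
Definition compact_piecewise r S F :=
  [/\ forall z, z \notin S -> {for z, continuous F}, exists M, forall z, normc (F z) <= M
    & forall z, outside r z -> F z = 0].

Lemma compact_piecewise_Re r S F : compact_piecewise r S F ->
  exists M, bounded_plane r M (fun p => Re (F (of_xy p))).
Proof.
move=> [Fc [M FM] F0]; exists M; split.
- apply: (@piecewise_plane_measurable _ S setT (fun z => Re (F z)) openT) => z _ zS e e0.
  have e2 : 0 < e / 2 by lra.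
  by apply: nearC1 (continuous_ReIm (Fc z zS) e2) _ => w [H _]; lra.
- by move=> p; apply: le_trans (FM (of_xy p)); exact: ge_normc_Re.
move=> p np; rewrite F0//; apply: contrapT => /not_orP[/negP H1 /negP H2]; apply: np.
by rewrite -!ltNge in H1 H2; split; exact: ltW.
Qed.

Lemma compact_piecewise_Im r S F : compact_piecewise r S F ->
  exists M, bounded_plane r M (fun p => Im (F (of_xy p))).
Proof.
move=> [Fc [M FM] F0]; exists M; split.
- apply: (@piecewise_plane_measurable _ S setT (fun z => Im (F z)) openT) => z _ zS e e0.
  have e2 : 0 < e / 2 by lra.
  by apply: nearC1 (continuous_ReIm (Fc z zS) e2) _ => w [_ H]; lra.
- by move=> p; apply: le_trans (FM (of_xy p)); exact: ge_normc_Im.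
move=> p np; rewrite F0//; apply: contrapT => /not_orP[/negP H1 /negP H2]; apply: np.
by rewrite -!ltNge in H1 H2; split; exact: ltW.
Qed.

Lemma compact_piecewise_lin r S c d A B : compact_piecewise r S A -> compact_piecewise r S B ->
  compact_piecewise r S (fun z => c * A z + d * B z).
Proof.
move=> [Ac [M AM] A0] [Bc [M' BM] B0]; split.
- by move=> z zS; apply: continuous_lin; [exact: Ac|exact: Bc].
- exists (normc c * M + normc d * M') => z; apply: le_trans (le_normcD _ _) _.
  by rewrite !normcM lerD// ler_wpM2l ?normc_ge0.
by move=> z oz; rewrite A0// B0// !mulr0 addr0.
Qed.

Definition plane_integrable F :=
  (@dA R).-integrable setT (EFin \o (fun p => Re (F (of_xy p)))) /\
  (@dA R).-integrable setT (EFin \o (fun p => Im (F (of_xy p)))).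

Lemma compact_piecewise_integrable r S F : compact_piecewise r S F -> plane_integrable F.
Proof.
move=> nF; have [M BR] := compact_piecewise_Re nF; have [M' BI] := compact_piecewise_Im nF.
by split; [exact: bounded_plane_integrable BR|exact: bounded_plane_integrable BI].
Qed.

Lemma integrable_scale (k : plane -> R) (a : R) :
  (@dA R).-integrable setT (EFin \o k) -> (@dA R).-integrable setT (EFin \o (fun p => a * k p)).
Proof.
move=> ik; rewrite (_ : EFin \o _ = (fun p => a%:E * (EFin \o k) p)%E).
  exact: integrableZl.
by apply/funext => p /=; rewrite EFinM.
Qed.

Lemma integrable_add (k l : plane -> R) :
  (@dA R).-integrable setT (EFin \o k) -> (@dA R).-integrable setT (EFin \o l) ->
  (@dA R).-integrable setT (EFin \o (fun p => k p + l p)).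
Proof.
move=> ik il; rewrite (_ : EFin \o _ = ((EFin \o k) \+ (EFin \o l))%E).
  exact: integrableD.
by apply/funext => p /=; rewrite EFinD.
Qed.

Lemma plane_integrableZ c F : plane_integrable F -> plane_integrable (fun z => c * F z).
Proof.
move=> [FR FI]; split.
  under [X in EFin \o X]eq_fun => p do rewrite Re_mul -mulNr.
  by apply: integrable_add; exact: integrable_scale.
under [X in EFin \o X]eq_fun => p do rewrite Im_mul.
by apply: integrable_add; exact: integrable_scale.
Qed.

Lemma plane_integralD F G : plane_integrable F -> plane_integrable G ->
  integral_dA setT (fun z => F z + G z) = integral_dA setT F + integral_dA setT G.
Proof.
move=> [FR FI] [GR GI]; rewrite /integral_dA preimage_setT; apply: complex_eq => /=.
  by under eq_Rintegral do rewrite Re_add; rewrite RintegralD.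
by under eq_Rintegral do rewrite Im_add; rewrite RintegralD.
Qed.

Lemma plane_integralZ c F : plane_integrable F ->
  integral_dA setT (fun z => c * F z) = c * integral_dA setT F.
Proof.
move=> [FR FI]; rewrite /integral_dA preimage_setT; apply: complex_eq; rewrite ?Re_mul ?Im_mul /=.
  under eq_Rintegral do rewrite Re_mul -mulNr.
  by rewrite RintegralD ?RintegralZl ?mulNr//; exact: integrable_scale.
under eq_Rintegral do rewrite Im_mul.
by rewrite RintegralD ?RintegralZl//; exact: integrable_scale.
Qed.

Lemma integral_dA_zero_outside (D : set R[i]) F : (forall z, ~ D z -> F z = 0) ->
  integral_dA D F = integral_dA setT F.
Proof.
move=> F0; rewrite /integral_dA preimage_setT.
have H (k : R[i] -> R) : k 0 = 0 ->
    (fun p : plane => k (F (of_xy p))) \_ (@of_xy R @^-1` D) = (fun p => k (F (of_xy p))).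
  move=> k0; apply/funext => p; rewrite /patch; case: ifPn => //.
  by rewrite notin_setE => /F0 ->; rewrite k0.
by rewrite Rintegral_mkcond [in X in _ +i* X]Rintegral_mkcond !H.
Qed.

(* Stokes: horizontal and vertical lines meeting S form a null set, and on the other ones
   the fundamental theorem of calculus applies. *)
Lemma plane_integral_wirt r S W A B : 0 < r ->
  (forall z, z \notin S -> wirt W z (A z) (B z)) ->
  (forall z, outside r z -> W z = 0) ->
  compact_piecewise r S A -> compact_piecewise r S B ->
  integral_dA setT A = 0 /\ integral_dA setT B = 0.
Proof.
move=> r0 dW W0 nA nB.
have iA := compact_piecewise_integrable nA; have iB := compact_piecewise_integrable nB.
have nlin c d := compact_piecewise_lin c d nA nB.
have NS (x y : R) : x \notin map (@complex.Re R) S \/ y \notin map (@complex.Im R) S -> x +i* y \notin S.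
  by move=> H; apply/negP => xyS; case: H => /negP; apply;
    [exact: (map_f (@complex.Re R) xyS)|exact: (map_f (@complex.Im R) xyS)].
have contH c d (x y : R) : x +i* y \notin S -> ccontinuous (fun s => c * A (s +i* y) + d * B (s +i* y)) x /\
    ccontinuous (fun s => c * A (x +i* s) + d * B (x +i* s)) y.
  move=> xyS; have [nc _ _] := nlin c d.
  by split; [exact: ccontinuous_horizontal (nc _ xyS)|exact: ccontinuous_vertical (nc _ xyS)].
have horizontal (x y : R) : y \notin map (@complex.Im R) S ->
    is_derive x 1 (fun s => Re (W (s +i* y))) (Re (1 * A (x +i* y) + 1 * B (x +i* y))) /\
    is_derive x 1 (fun s => Im (W (s +i* y))) (Im (1 * A (x +i* y) + 1 * B (x +i* y))).
  move=> yS; have := dW (x +i* y) (NS x y (or_intror yS)); rewrite {1}horizontalE => Wxy.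
  have := wirt_line_Re Wxy; have := wirt_line_Im Wxy.
  rewrite /on_line conjc1 (mulrC (A _)) (mulrC (B _)).
  rewrite (_ : (fun s => Re _) = (fun s => Re (W (s +i* y)))); last first.
    by apply/funext => s; rewrite -horizontalE.
  rewrite (_ : (fun s => Im _) = (fun s => Im (W (s +i* y)))) //.
  by apply/funext => s; rewrite -horizontalE.
have vertical (x y : R) : x \notin map (@complex.Re R) S ->
    is_derive y 1 (fun s => Re (W (x +i* s))) (Re (imag_unit * A (x +i* y) + (- imag_unit) * B (x +i* y))) /\
    is_derive y 1 (fun s => Im (W (x +i* s))) (Im (imag_unit * A (x +i* y) + (- imag_unit) * B (x +i* y))).
  move=> xS; have := dW (x +i* y) (NS x y (or_introl xS)); rewrite {1}verticalE => Wxy.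
  have := wirt_line_Re Wxy; have := wirt_line_Im Wxy.
  rewrite /on_line conjc_imag_unit (mulrC (A _)) (mulrC (B _)).
  rewrite (_ : (fun s => Re _) = (fun s => Re (W (x +i* s)))); last first.
    by apply/funext => s; rewrite -verticalE.
  rewrite (_ : (fun s => Im _) = (fun s => Im (W (x +i* s)))) //.
  by apply/funext => s; rewrite -verticalE.
(* A + B and i (A - B) are the x- and y-derivatives of W. Both integrate to 0, and the two equations
   are solved for the integrals of A and B. *)
have P1 : integral_dA setT (fun z => 1 * A z + 1 * B z) = 0.
  have [M1 B1] := compact_piecewise_Re (nlin 1 1).
  have [M2 B2] := compact_piecewise_Im (nlin 1 1).
  have [_ _ n0] := nlin 1 1.
  have E1 := @plane_integral_x _ r M1 _ (fun x y => Re (W (x +i* y)))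
    (fun x y => Re (1 * A (x +i* y) + 1 * B (x +i* y))) r0
    (fun y yS x => (horizontal x y yS).1)
    (fun y yS x => (contH 1 1 x y (NS x y (or_intror yS))).1.1).
  have E2 := @plane_integral_x _ r M2 _ (fun x y => Im (W (x +i* y)))
    (fun x y => Im (1 * A (x +i* y) + 1 * B (x +i* y))) r0
    (fun y yS x => (horizontal x y yS).2)
    (fun y yS x => (contH 1 1 x y (NS x y (or_intror yS))).1.2).
  rewrite /integral_dA preimage_setT; apply: complex_eq => /=; rewrite /Rintegral.
    by rewrite E1// => x y rx; rewrite W0 ?n0//; left.
  by rewrite E2// => x y rx; rewrite W0 ?n0//; left.
have P2 : integral_dA setT (fun z => imag_unit * A z + (- imag_unit) * B z) = 0.
  have [M1 B1] := compact_piecewise_Re (nlin imag_unit (- imag_unit)).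
  have [M2 B2] := compact_piecewise_Im (nlin imag_unit (- imag_unit)).
  have [_ _ n0] := nlin imag_unit (- imag_unit).
  have E1 := @plane_integral_y _ r M1 _ (fun x y => Re (W (x +i* y)))
    (fun x y => Re (imag_unit * A (x +i* y) + (- imag_unit) * B (x +i* y))) r0
    (fun x xS y => (vertical x y xS).1)
    (fun x xS y => (contH _ _ x y (NS x y (or_introl xS))).2.1).
  have E2 := @plane_integral_y _ r M2 _ (fun x y => Im (W (x +i* y)))
    (fun x y => Im (imag_unit * A (x +i* y) + (- imag_unit) * B (x +i* y))) r0
    (fun x xS y => (vertical x y xS).2)
    (fun x xS y => (contH _ _ x y (NS x y (or_introl xS))).2.2).
  rewrite /integral_dA preimage_setT; apply: complex_eq => /=; rewrite /Rintegral.
    by rewrite E1// => x y ry; rewrite W0 ?n0//; right.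
  by rewrite E2// => x y ry; rewrite W0 ?n0//; right.
move: P1 P2; rewrite !plane_integralD ?plane_integralZ//; try exact: plane_integrableZ.
rewrite !mul1r mulNr -mulrBr => P1 /eqP; rewrite mulf_eq0 => /orP[/eqP[]|/eqP P2].
  by move=> /eqP; rewrite oner_eq0.
split.
  have : 2 * integral_dA setT A = 0 by rewrite mulr_natl mulr2n -[RHS](addr0 0) -{1}P1 -P2; ring.
  by move/eqP; rewrite mulf_eq0 pnatr_eq0 => /eqP.
have : 2 * integral_dA setT B = 0 by rewrite mulr_natl mulr2n -[RHS](subr0 0) -{1}P1 -P2; ring.
by move/eqP; rewrite mulf_eq0 pnatr_eq0 => /eqP.
Qed.

End PlaneIntegral.

(** * Supports and second derivatives of test functions *)

Section TestFunctions.
Context {R : realType}.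
Implicit Types (z w c d : R[i]) (F G phi : R[i] -> R[i]) (r M : R) (K U : set R[i]).

Lemma compact_locally_bounded K F : compact K ->
  (forall z, K z -> exists M, \forall w \near z, normc (F w) <= M) ->
  exists M, forall z, K z -> normc (F z) <= M.
Proof.
move=> /compact_near_coveringP cK Fb.
have [] := cK nat \oo (fun n z => normc (F z) <= n%:R) _ _.
  move=> z /Fb[M FM]; exists ([set w | normc (F w) <= M], [set n | M <= n%:R]) => /=.
    by split => //; exact: nbhs_infty_ger.
  by move=> [w n] /= [Fw Mn]; exact: le_trans Mn.
by move=> n _ Kn; exists n%:R => z /(Kn n (leqnn n)).
Qed.

Lemma box_compact r : compact (box r : set R[i]).
Proof.
have -> : (box r : set R[i]) = @of_xy R @` (`[- r, r]%classic `*` `[- r, r]%classic).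
  apply/seteqP; split => [[x y]|z [[x y]]]; rewrite /box /=.
    by rewrite !ler_norml => -[h1 h2]; exists (x, y); rewrite //= !in_itv.
  by rewrite !in_itv /= => -[h1 h2] <- /=; rewrite !ler_norml.
apply: continuous_compact; last by apply: compact_setX; exact: segment_compact.
apply: continuous_subspaceT => -[x y].
apply/(@cvg_normcP _ _ _ (nbhs_filter _)) => e e0; have e2 : 0 < e / 2 by lra.
exists ([set u | `|x - u| < e / 2], [set v | `|y - v| < e / 2]).
  by split; apply/nbhs_normP; exists (e / 2).
move=> [u v] [/= ux vy]; apply: le_lt_trans (normc_le_ReIm _) _.
by rewrite Re_sub Im_sub /= (distrC u) (distrC v); lra.
Qed.

Lemma continuousM_normc F G z : {for z, continuous F} -> {for z, continuous G} ->
  {for z, continuous (fun w => F w * G w)}.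
Proof.
move=> Fc Gc; have Gb := continuous_normc_bounded Gc.
move: Fc Gc => /continuous_normcP Fc /continuous_normcP Gc.
apply/continuous_normcP => e e0.
pose M := normc (F z) + normc (G z) + 2.
have M0 : 0 < M by have := normc_ge0 (F z); have := normc_ge0 (G z); rewrite /M; lra.
have eM : 0 < e / M by rewrite divr_gt0.
have FG : \forall w \near z, normc (F w - F z) < e / M /\ normc (G w - G z) < e / M.
  by apply: nearC2 (Fc _ eM) (Gc _ eM) _ => w; exact: conj.
apply: nearC2 FG Gb _ => w [Fw Gw] Gw1.
rewrite (_ : _ - _ = (F w - F z) * G w + F z * (G w - G z)); last by ring.
apply: le_lt_trans (le_normcD _ _) _; rewrite !normcM.
have H1 := ler_pM (normc_ge0 _) (normc_ge0 _) (ltW Fw) Gw1.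
have H2 := ler_wpM2l (normc_ge0 (F z)) (ltW Gw).
have E : e = e / M * (normc (G z) + 1) + normc (F z) * (e / M) + e / M.
  by rewrite /M; field; rewrite gt_eqF.
by rewrite [X in _ < X]E; lra.
Qed.

Lemma compact_piecewise_bounded r (S : seq R[i]) F :
  (forall z, z \notin S -> {for z, continuous F}) ->
  (forall z, exists M, \forall w \near z, normc (F w) <= M) ->
  (forall z, outside r z -> F z = 0) -> compact_piecewise r S F.
Proof.
move=> Fc Fb F0; split => //.
have [M HM] := compact_locally_bounded (@box_compact r) (fun z _ => Fb z).
exists (Num.max M 0) => z; rewrite le_max.
have [bz|nz] := pselect (box r z); first by rewrite HM.
rewrite F0 ?normc0 ?lexx ?orbT//; apply: contrapT => /not_orP[/negP H1 /negP H2]; apply: nz.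
by rewrite -!ltNge in H1 H2; split; exact: ltW.
Qed.

Definition tsupport phi : set R[i] := closure [set z | phi z != 0].

Lemma near_off_tsupport phi z : ~ tsupport phi z -> \forall w \near z, ~ tsupport phi w.
Proof.
by move=> nz; apply: near_open nz; exact: closed_openC (@closed_closure _ _).
Qed.

Lemma off_tsupport phi z : ~ tsupport phi z -> phi z = 0.
Proof.
by move=> nz; apply/eqP/negPn/negP => pz; apply: nz; exact: subset_closure.
Qed.

Lemma compact_outside K : compact K -> exists2 r, 0 < r & forall z, outside r z -> ~ K z.
Proof.
move=> cK; have [M HM] : exists M, forall z, K z -> normc z <= M.
  apply: compact_locally_bounded => // z _; exists (normc z + 1).
  exact: wirt_bounded (wirt_id z).
exists (Num.max M 0 + 1); first by rewrite ltr_wpDl// le_max lexx orbT.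
move=> z oz /HM zM; have : normc z < Num.max M 0 + 1 by rewrite ltr_pwDr// le_max zM.
case: oz => oz; have := ge_normc_Re z; have := ge_normc_Im z; lra.
Qed.

Section Derivatives.
Variables (phi : R[i] -> R[i]).
Hypothesis smooth : forall k, Ck k setT phi.
Let px := partial_x phi.
Let py := partial_y phi.

Let Cx k : Ck k setT px. Proof. by have [_ _] := smooth k.+1. Qed.
Let Cy k : Ck k setT py. Proof. by have [_ _ _] := smooth k.+1. Qed.

Let cont F z : Ck 0 setT F -> {for z, continuous F}.
Proof. by move=> /(_ z); rewrite inE; apply. Qed.

Lemma smooth_d_z_continuous F z : Ck 1 setT F ->
  {for z, continuous (d_z F)} /\ {for z, continuous (d_zbar F)}.
Proof.
move=> [_ _ cx cy].
have cx' := @cont _ z cx; have cy' := @cont _ z cy.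
split.
  apply: (@continuous_ext _ (d_z F) (fun w => 2^-1 * partial_x F w + (- 2^-1 * imag_unit) * partial_y F w)).
    by apply: nearCW => w; rewrite /d_z; ring.
  exact: continuous_lin.
apply: (@continuous_ext _ (d_zbar F) (fun w => 2^-1 * partial_x F w + (2^-1 * imag_unit) * partial_y F w)).
  by apply: nearCW => w; rewrite /d_zbar; ring.
exact: continuous_lin.
Qed.

Lemma partial_comm z : partial_y px z = partial_x py z.
Proof.
have [CR CI] := Ck1_C1_at (smooth 1).
have [_ dxF xx xy] := Cx 1; have [_ dyF yx yy] := Cy 1.
have cxy := @cont _ z xy; have cyx := @cont _ z yx.
apply: complex_eq.
  apply: (@schwarz _ _ _ _ (fun z => Re (partial_y px z))
    (fun z => Re (partial_x py z)) z CR) => [x y|x y|e e0|e e0].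
  - exact: (dir_derivable_vertical (dxF _ I).2).1.
  - exact: (dir_derivable_horizontal (dyF _ I).1).1.
  - by apply: nearC1 (continuous_ReIm cxy e0) _ => w [H _]; exact: H.
  - by apply: nearC1 (continuous_ReIm cyx e0) _ => w [H _]; exact: H.
apply: (@schwarz _ _ _ _ (fun z => Im (partial_y px z))
    (fun z => Im (partial_x py z)) z CI) => [x y|x y|e e0|e e0].
- exact: (dir_derivable_vertical (dxF _ I).2).2.
- exact: (dir_derivable_horizontal (dyF _ I).1).2.
- by apply: nearC1 (continuous_ReIm cxy e0) _ => w [_ H]; exact: H.
- by apply: nearC1 (continuous_ReIm cyx e0) _ => w [_ H]; exact: H.
Qed.

Lemma wirt_wirtinger z :
  wirt (d_z phi) z (2^-1 * (d_z px z - imag_unit * d_z py z))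
    (2^-1 * (d_zbar px z - imag_unit * d_zbar py z)) /\
  wirt (d_zbar phi) z (2^-1 * (d_z px z + imag_unit * d_z py z))
    (2^-1 * (d_zbar px z + imag_unit * d_zbar py z)).
Proof.
have Wx := Ck1_wirt z (Cx 1); have Wy := Ck1_wirt z (Cy 1).
by split; [exact: wirtZ (wirtB Wx (wirtZ imag_unit Wy))|
  exact: wirtZ (wirtD Wx (wirtZ imag_unit Wy))].
Qed.

(** Integration by parts produces the zbar-derivative of [d_z phi], whereas [laplacian] contains
    [d_z (d_zbar phi)]; equality of the mixed partial derivatives identifies them. *)
Lemma wirt_d_z_phi z : wirt (d_z phi) z (d_z (d_z phi) z) (d_z (d_zbar phi) z).
Proof.
have [W1 W2] := wirt_wirtinger z.
rewrite (wirt_d_z W1) (wirt_d_z W2).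
apply: wirt_eq W1 erefl _; rewrite /d_z /d_zbar partial_comm.
set a := partial_x px z; set b := partial_x py z; set c := partial_y py z.
have i2 : imag_unit * imag_unit = -1 :> R[i] := imag_unit_sqr.
have E1 : imag_unit * (2^-1 * (b + imag_unit * c)) = 2^-1 * (imag_unit * b - c) :> R[i].
  by transitivity (2^-1 * (imag_unit * b + imag_unit * imag_unit * c)); [ring|rewrite i2; ring].
have E2 : imag_unit * (2^-1 * (b - imag_unit * c)) = 2^-1 * (imag_unit * b + c) :> R[i].
  by transitivity (2^-1 * (imag_unit * b - imag_unit * imag_unit * c)); [ring|rewrite i2; ring].
by rewrite E1 E2; ring.
Qed.

Lemma laplacian_phi_continuous z : {for z, continuous (fun w => d_z (d_zbar phi) w)} /\
  {for z, continuous (fun w => d_z (d_z phi) w)}.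
Proof.
have [x1 _] := smooth_d_z_continuous z (Cx 1).
have [y1 _] := smooth_d_z_continuous z (Cy 1).
have E w : d_z (d_z phi) w = 2^-1 * d_z px w + (- (2^-1 * imag_unit)) * d_z py w /\
    d_z (d_zbar phi) w = 2^-1 * d_z px w + (2^-1 * imag_unit) * d_z py w.
  have [W1 W2] := wirt_wirtinger w; rewrite (wirt_d_z W1) (wirt_d_z W2).
  by move: (d_z px w) (d_z py w) => A B; split; ring.
split.
  apply: (@continuous_ext _ (fun w => d_z (d_zbar phi) w)
    (fun w => 2^-1 * d_z px w + (2^-1 * imag_unit) * d_z py w)).
    by apply: nearCW => w; rewrite (E w).2.
  exact: continuous_lin.
apply: (@continuous_ext _ (fun w => d_z (d_z phi) w)
  (fun w => 2^-1 * d_z px w + (- (2^-1 * imag_unit)) * d_z py w)).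
  by apply: nearCW => w; rewrite (E w).1.
exact: continuous_lin.
Qed.

Lemma derivatives_off_tsupport z : ~ tsupport phi z ->
  [/\ phi z = 0, d_z phi z = 0, d_zbar phi z = 0, d_z (d_z phi) z = 0 & d_z (d_zbar phi) z = 0].
Proof.
have E w : ~ tsupport phi w -> [/\ phi w = 0, d_z phi w = 0 & d_zbar phi w = 0].
  move=> nw; have W : wirt phi w 0 0.
    apply: wirt_ext (wirt_cst 0 w).
    by apply: nearC1 (near_off_tsupport nw) _ => v /off_tsupport.
  by split; [exact: off_tsupport|exact: wirt_d_z W|exact: wirt_d_zbar W].
move=> nz; have [-> -> ->] := E z nz.
have n0 F : (forall w, ~ tsupport phi w -> F w = 0) -> d_z F z = 0.
  move=> F0; apply: wirt_d_z; apply: wirt_ext (wirt_cst 0 z).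
  by apply: nearC1 (near_off_tsupport nz) _ => v /F0.
by split=> //; apply: n0 => w /E[].
Qed.

End Derivatives.

End TestFunctions.

(** * The distributional Laplacian *)

(** Extends the product by 0 beyond U: a point outside U is off the support, which is closed, so the
    product vanishes on a neighbourhood of it. *)
Lemma compact_piecewise_mul {R : realType} (U : set R[i]) (r : R) (S : seq R[i])
    (k psi phi : R[i] -> R[i]) :
  (forall z, outside r z -> ~ tsupport phi z) -> tsupport phi `<=` U ->
  (forall z, U z -> z \notin S -> {for z, continuous k}) ->
  (forall z, U z -> exists M : R, \forall w \near z, normc (k w) <= M) ->
  (forall z, {for z, continuous psi}) -> (forall z, ~ tsupport phi z -> psi z = 0) ->
  compact_piecewise r S (fun z => k z * psi z).
Proof.
move=> out sU kc kb pc p0.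
have off z : ~ tsupport phi z -> \forall w \near z, 0 = k w * psi w.
  by move=> nz; apply: nearC1 (near_off_tsupport nz) _ => w /p0 ->; rewrite mulr0.
apply: compact_piecewise_bounded.
- move=> z zS; have [Uz|nUz] := pselect (U z).
    by apply: continuousM_normc; [exact: kc|exact: pc].
  have nz : ~ tsupport phi z by move=> /sU.
  apply: continuous_ext (off z nz) _.
  exact: rdiff_continuous (rdiff_cst 0 z).
- move=> z; have [Uz|nUz] := pselect (U z).
    have [M kM] := kb z Uz; exists (M * (normc (psi z) + 1)).
    apply: nearC2 kM (continuous_normc_bounded (pc z)) _ => w kw pw.
    by rewrite normcM; apply: ler_pM; rewrite ?normc_ge0.
  have nz : ~ tsupport phi z by move=> /sU.
  exists 0; apply: nearC1 (off z nz) _ => w <-.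
  by rewrite normc0.
by move=> z /out/p0 ->; rewrite mulr0.
Qed.

Section Distributions.
Context {R : realType}.
Implicit Types (z w c d : R[i]) (F G phi : R[i] -> R[i]) (r M : R).
Variables (U V : set R[i]) (f : R[i] -> R[i]) (N : nat) (a : 'I_N -> R[i]).
Hypotheses (oU : open U) (oV : open V) (UV : U `<=` V)
  (fH : forall z, V z -> holo f z)
  (zerof : U `&` [set z | f z = 0] = range a).
Local Notation pot := (pot f a).
Local Notation pot_z := (pot_z f a).
Local Notation pot_zb := (pot_zb f a).
Local Notation pot_zzb := (pot_zzb f a).
Local Notation pot_zbzb := (pot_zbzb f a).

Let S := [seq a j | j : 'I_N].

Let off_zeros z : U z -> z \notin S -> f z != 0.
Proof.
move=> Uz; apply: contra => /eqP fz.
by have [j ->] := zeroP zerof Uz fz; exact: codom_f.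
Qed.

Lemma pot_weak_laplacian phi : test_function U phi ->
  [/\ plane_integrable (fun z => pot z * d_z (d_zbar phi) z),
      plane_integrable (fun z => pot_zzb z * phi z) &
      integral_dA setT (fun z => pot z * d_z (d_zbar phi) z) =
      integral_dA setT (fun z => pot_zzb z * phi z)].
Proof.
move=> [smooth cK KU].
have {}KU : tsupport phi `<=` U := KU.
have {}cK : compact (tsupport phi) := cK.
have [r r0 out] := compact_outside cK.
have Wphi z := Ck1_wirt z (smooth 1%N).
have Wphiz z := wirt_d_z_phi smooth z.
have D z (nz : ~ tsupport phi z) := derivatives_off_tsupport nz.
have cphi z : {for z, continuous phi} := wirt_continuous (Wphi z).
have cphiz z : {for z, continuous (d_z phi)} := wirt_continuous (Wphiz z).
have cphizb z : {for z, continuous (d_zbar phi)} := (smooth_d_z_continuous z (smooth 1%N)).2.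
have cL z : {for z, continuous (d_z (d_zbar phi))} := (laplacian_phi_continuous smooth z).1.
have cZZ z : {for z, continuous (d_z (d_z phi))} := (laplacian_phi_continuous smooth z).2.
have cb F z : {for z, continuous F} -> exists M, \forall w \near z, normc (F w) <= M.
  by move=> Fc; exists (normc (F z) + 1); exact: continuous_normc_bounded.
have cpot z (Uz : U z) : {for z, continuous pot} := wirt_continuous (wirt_pot_in oU oV UV fH zerof Uz).
have cpot_z z := continuous_pot_z oU oV UV fH zerof (z := z).
have cpot_zb z := continuous_pot_zb oU oV UV fH zerof (z := z).
have bd z Uz := locally_bounded_pot2 oU oV UV fH zerof (z := z) Uz.
have z0 z (nz : ~ tsupport phi z) : phi z = 0 by case: (D z nz).
have z1 z (nz : ~ tsupport phi z) : d_z phi z = 0 by case: (D z nz).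
have z2 z (nz : ~ tsupport phi z) : d_zbar phi z = 0 by case: (D z nz).
have z3 z (nz : ~ tsupport phi z) : d_z (d_z phi) z = 0 by case: (D z nz).
have z4 z (nz : ~ tsupport phi z) : d_z (d_zbar phi) z = 0 by case: (D z nz).
have cm (k psi : R[i] -> R[i]) : (forall z, U z -> {for z, continuous k}) -> (forall z, {for z, continuous psi}) ->
    (forall z, ~ tsupport phi z -> psi z = 0) -> compact_piecewise r S (fun z => k z * psi z).
  move=> kc pc p0.
  exact: (@compact_piecewise_mul _ U r S k psi phi out KU (fun z Uz _ => kc z Uz)
    (fun z Uz => cb k z (kc z Uz)) pc p0).
have n1 := cm _ _ cpot_z cphiz z1; have n2 := cm _ _ cpot cZZ z3.
have n3 := cm _ _ cpot_zb cphiz z1; have n4 := cm _ _ cpot cL z4.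
have n7 := cm _ _ cpot_zb cphizb z2.
have n5 : compact_piecewise r S (fun z => pot_zzb z * phi z).
  apply: (@compact_piecewise_mul _ U r S pot_zzb phi phi out KU _ _ cphi z0) => z Uz.
    by move=> zS; exact: rdiff_continuous (rdiff_pot_zzb _ oV UV fH Uz (off_zeros Uz zS)).
  by have [M HM] := bd z Uz; exists M; apply: nearC1 HM _ => w [].
have n6 : compact_piecewise r S (fun z => pot_zbzb z * phi z).
  apply: (@compact_piecewise_mul _ U r S pot_zbzb phi phi out KU _ _ cphi z0) => z Uz.
    by move=> zS; exact: rdiff_continuous (rdiff_pot_zbzb _ oV UV fH Uz (off_zeros Uz zS)).
  by have [M HM] := bd z Uz; exists M; apply: nearC1 HM _ => w [].
have off z G : ~ U z -> (forall w, ~ tsupport phi w -> G w = 0) -> wirt G z 0 0.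
  move=> nUz G0; have nz : ~ tsupport phi z by move=> /KU.
  apply: wirt_ext (wirt_cst 0 z).
  by apply: nearC1 (near_off_tsupport nz) _ => w /G0 ->.
(* First integration by parts, in zbar, moving one derivative onto [pot], which is differentiable on
   all of U. *)
have [_ I1] : integral_dA setT (fun z => 1 * (pot_z z * d_z phi z) + 1 * (pot z * d_z (d_z phi) z)) = 0 /\
    integral_dA setT (fun z => 1 * (pot_zb z * d_z phi z) + 1 * (pot z * d_z (d_zbar phi) z)) = 0.
  apply: (@plane_integral_wirt _ r S (fun z => pot z * d_z phi z)).
  - exact: r0.
  - move=> z _; have [Uz|nUz] := pselect (U z).
      have := wirtM (wirt_pot_in oU oV UV fH zerof Uz) (Wphiz z).
      by rewrite !mul1r.
    have nz : ~ tsupport phi z by move=> /KU.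
    have [_ -> _ -> ->] := D z nz; rewrite !mulr0 addr0.
    by apply: off nUz _ => w /D[_ -> _ _ _]; rewrite mulr0.
  - by move=> z /out/D[_ -> _ _ _]; rewrite mulr0.
  - exact: compact_piecewise_lin n1 n2.
  - exact: compact_piecewise_lin n3 n4.
(* Second one, in z. Here [pot_zb] is differentiated off the zeros only, and since the proof goes
   through x- and y-derivatives, [pot_zbzb] has to be bounded as well. *)
have [I2 _] : integral_dA setT (fun z => 1 * (pot_zzb z * phi z) + 1 * (pot_zb z * d_z phi z)) = 0 /\
    integral_dA setT (fun z => 1 * (pot_zbzb z * phi z) + 1 * (pot_zb z * d_zbar phi z)) = 0.
  apply: (@plane_integral_wirt _ r S (fun z => pot_zb z * phi z)).
  - exact: r0.
  - move=> z zS; have [Uz|nUz] := pselect (U z).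
      have := wirtM (wirt_pot_zb _ oV UV fH Uz (off_zeros Uz zS)) (Wphi z).
      by rewrite !mul1r.
    have nz : ~ tsupport phi z by move=> /KU.
    have [-> -> -> _ _] := D z nz; rewrite !mulr0 addr0.
    by apply: off nUz _ => w /D[-> _ _ _ _]; rewrite mulr0.
  - by move=> z /out/D[-> _ _ _ _]; rewrite mulr0.
  - exact: compact_piecewise_lin n5 n3.
  - exact: compact_piecewise_lin n6 n7.
have i3 := compact_piecewise_integrable n3; have i4 := compact_piecewise_integrable n4.
have i5 := compact_piecewise_integrable n5.
have sum1 F G : plane_integrable F -> plane_integrable G ->
    integral_dA setT (fun z => 1 * F z + 1 * G z) = integral_dA setT F + integral_dA setT G.
  move=> iF iG; rewrite plane_integralD; try exact: plane_integrableZ.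
  by rewrite !plane_integralZ// !mul1r.
split=> //.
have E1 := etrans (esym (sum1 _ _ i3 i4)) I1.
have E2 := etrans (esym (sum1 _ _ i5 i3)) I2.
move: E1 E2; move: (integral_dA _ _) (integral_dA _ _) (integral_dA _ _) => x y t.
by move=> ty xt; apply: (addrI t); rewrite ty addrC xt.
Qed.

Lemma laplacian_distr_pot u g : (forall z, U z -> u z = pot z) ->
  (forall z, U z -> g z = 4 * pot_zzb z) -> laplacian_distr U u g.
Proof.
move=> uE gE phi tphi; have [i1 i2 H] := pot_weak_laplacian tphi.
have [smooth _ KU] := tphi; have {}KU : tsupport phi `<=` U := KU.
have D z (nz : ~ tsupport phi z) := derivatives_off_tsupport nz.
have off z : ~ U z -> ~ tsupport phi z by move=> nUz /KU.
rewrite integral_dA_zero_outside; last first.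
  by move=> z /off/D[_ _ _ _ E]; rewrite /laplacian E !mulr0.
rewrite [RHS]integral_dA_zero_outside; last by move=> z /off/D[-> _ _ _ _]; rewrite mulr0.
rewrite (_ : (fun z => u z * laplacian phi z) = (fun z => 4 * (pot z * d_z (d_zbar phi) z))); last first.
  apply/funext => z; rewrite /laplacian; have [Uz|nUz] := pselect (U z).
    by rewrite uE// mulrCA.
  by have [_ _ _ _ ->] := D z (off z nUz); rewrite !mulr0.
rewrite (_ : (fun z => g z * phi z) = (fun z => 4 * (pot_zzb z * phi z))); last first.
  apply/funext => z; have [Uz|nUz] := pselect (U z); first by rewrite gE// mulrA.
  by have [-> _ _ _ _] := D z (off z nUz); rewrite !mulr0.
by rewrite !plane_integralZ// H.
Qed.

End Distributions.

Section LinftyLaplacian.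
Context {R : realType}.
Implicit Types (z w c d : R[i]) (F G phi : R[i] -> R[i]) (r M : R).

Lemma le_norm_normc z M : (`|z| <= M%:C) = (normc z <= M).
Proof. by rewrite lecE /= eqxx. Qed.

Lemma Linfty_loc_piecewise (S : seq R[i]) (U : set R[i]) F : open U ->
  (forall z, U z -> z \notin S -> {for z, continuous F}) ->
  (forall z, U z -> exists M, \forall w \near z, normc (F w) <= M) ->
  Linfty_loc U F.
Proof.
move=> oU Fc Fb; split; first split.
- apply: (@piecewise_plane_measurable _ S U (fun z => Re (F z)) oU) => z Uz zS e e0.
  have e2 : 0 < e / 2 by lra.
  by apply: nearC1 (continuous_ReIm (Fc z Uz zS) e2) _ => w [H _]; lra.
- apply: (@piecewise_plane_measurable _ S U (fun z => Im (F z)) oU) => z Uz zS e e0.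
  have e2 : 0 < e / 2 by lra.
  by apply: nearC1 (continuous_ReIm (Fc z Uz zS) e2) _ => w [_ H]; lra.
move=> K cK KU; have [M HM] := compact_locally_bounded cK (fun z Kz => Fb z (KU z Kz)).
by exists M; apply: aeW => p Kp; rewrite le_norm_normc; exact: HM.
Qed.

Variables (U V : set R[i]) (f : R[i] -> R[i]) (N : nat) (a : 'I_N -> R[i]).
Hypotheses (oU : open U) (oV : open V) (UV : U `<=` V)
  (fH : forall z, V z -> holo f z)
  (zerof : U `&` [set z | f z = 0] = range a).

Lemma Linfty_loc_pot g : (forall z, U z -> g z = 4 * pot_zzb f a z) -> Linfty_loc U g.
Proof.
move=> gE.
have near_g z : U z -> \forall w \near z, 4 * pot_zzb f a w = g w.
  by move=> Uz; apply: nearC1 (near_open oU Uz) _ => w /gE ->.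
apply: (@Linfty_loc_piecewise [seq a j | j : 'I_N]) => // z Uz.
  move=> zS; have fz : f z != 0.
    by apply: contra zS => /eqP fz; have [j ->] := zeroP zerof Uz fz; exact: codom_f.
  apply: continuous_ext (near_g z Uz) _; apply: rdiff_continuous.
  by apply: rdiffM; [exact: rdiff_cst|exact: rdiff_pot_zzb oV UV fH _ Uz fz].
have [M HM] := locally_bounded_pot2 oU oV UV fH zerof Uz.
exists (normc (4 : R[i]) * M); apply: nearC2 HM (near_g z Uz) _ => w [H _] <-.
by rewrite normcM ler_wpM2l// normc_ge0.
Qed.

End LinftyLaplacian.

(** * Bump functions *)

Section Bump.
Context {R : realType}.
Implicit Types (F G : R -> R) (x y t c : R).

Lemma is_derive_near F G x d : (\forall y \near x, F y = G y) ->
  is_derive x 1 F d -> is_derive x 1 G d.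
Proof.
move=> FG /is_derive_estimate H; apply/is_derive_estimate => e e0.
have FGx := nbhs_singleton FG.
by apply: filterS2 FG (H e e0) => y <-; rewrite -FGx.
Qed.

Lemma is_derive_mul F G x (d e : R) : is_derive x 1 F d -> is_derive x 1 G e ->
  is_derive x 1 (fun y => F y * G y) (d * G x + F x * e).
Proof.
move=> dF dG; have := is_deriveM dF dG.
by move/is_derive_eq; apply; rewrite addrC; congr (_ + _); exact: mulrC.
Qed.

Lemma is_derive_add F G x (d e : R) : is_derive x 1 F d -> is_derive x 1 G e ->
  is_derive x 1 (fun y => F y + G y) (d + e).
Proof. by move=> dF dG; exact: is_deriveD. Qed.

Lemma is_derive_inv x : x != 0 -> is_derive x 1 (fun y : R => y^-1) (- x ^- 2).
Proof.
move=> x0; have d1 : derivable (@id R) x 1 by exact: derivable_id.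
apply: DeriveDef; first exact: (@derivableV _ _ id x 1 x0 d1).
by rewrite (@deriveV _ _ id x 1 x0 d1) derive_id -[_ *: 1]/(- x ^- 2 * 1) mulr1.
Qed.

Lemma is_derive_inv_pow (n : nat) x : x != 0 ->
  is_derive x 1 (fun y : R => y ^- n) (- n%:R * x ^- n.+1).
Proof.
move=> x0; elim: n => [|n IH].
  rewrite oppr0 mul0r.
  by under eq_fun => y do rewrite expr0 invr1; exact: is_derive_cst.
have := is_derive_mul (is_derive_inv x0) IH.
under eq_fun => y do rewrite -invfM -exprS.
move/is_derive_eq; apply; rewrite -natr1 !exprS; field.
by rewrite x0 expf_neq0.
Qed.

Lemma pow_le_expR (k : nat) x : 0 <= x -> x ^+ k <= k`!%:R * expR x.
Proof.
case: k => [|k] x0; first by rewrite expr0 mul1r; have := expR_ge1Dx x; lra.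
rewrite mulrC -ler_pdivrMr ?ltr0n ?fact_gt0//.
by have := expR_ge1Dxn k x0; lra.
Qed.

(** The powers of 1/x make the span of this family stable under differentiation, so smoothness of
    exp(-1/x) is an induction with no polynomials in 1/x to track. *)
Definition flat (n : nat) x : R := if 0 < x then x ^- n * expR (- x^-1) else 0.

Lemma flat_ge0 n x : 0 <= flat n x.
Proof.
by rewrite /flat; case: ifP => // x0; rewrite mulr_ge0 ?invr_ge0 ?expR_ge0 ?exprn_ge0 ?ltW.
Qed.

(** One term of the exponential series at 1/x, of degree n + 2, beats x^-n and leaves x^2, enough
    for a zero derivative at 0. *)
Lemma flat_quadratic n x : flat n x <= n.+2`!%:R * x ^+ 2.
Proof.
rewrite /flat; case: ifP => [x0|_]; last by rewrite mulr_ge0// sqr_ge0.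
have := @pow_le_expR n.+2 x^-1 _; rewrite invr_ge0 (ltW x0) => /(_ isT) H.
rewrite expRN ler_pdivrMr ?expR_gt0// mulrAC -ler_pdivrMr ?exprn_gt0//.
by rewrite -invfM -exprD addn2 -exprVn.
Qed.

Lemma is_derive_flat n x : is_derive x 1 (flat n) (flat n.+2 x - n%:R * flat n.+1 x).
Proof.
case: (ltgtP x 0) => [x0|x0|->].
- have E k : flat k x = 0 by rewrite /flat lt_gtF.
  rewrite !E mulr0 subr0.
  apply: (@is_derive_near (fun=> 0)).
  have : nbhs x [set y | y < 0] by exact: lt_nbhsl.
  by apply: filterS => y y0; rewrite /flat lt_gtF.
- apply: (@is_derive_near (fun y => y ^- n * expR (- y^-1))).
    have : nbhs x [set y | 0 < y] by exact: lt_nbhsr.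
    by apply: filterS => y y0; rewrite /flat y0.
  have x0' : x != 0 by rewrite gt_eqF.
  have dN : is_derive x 1 (fun y : R => - y^-1) (- - x ^- 2).
    exact: is_deriveN (is_derive_inv x0').
  have E := @is_derive1_comp R expR (fun y => - y^-1) x _ _ (is_derive_expR _) dN.
  have := is_derive_mul (is_derive_inv_pow n x0') E.
  move/is_derive_eq; apply; rewrite /flat x0 /= !exprS; field.
  by rewrite x0' expf_neq0.
have E k : flat k 0 = 0 by rewrite /flat ltxx.
rewrite !E mulr0 subr0.
apply/is_derive_estimate => e e0.
pose C : R := n.+2`!%:R.
have C0 : 0 < C by rewrite ltr0n fact_gt0.
apply/nbhs_normP; exists (e / C) => /=; first by rewrite divr_gt0.
move=> y; rewrite /ball_ /= sub0r normrN ltr_pdivlMr// => yC.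
rewrite E mul0r !subr0 ger0_norm ?flat_ge0//.
apply: le_trans (flat_quadratic n y) _.
rewrite -/C -[y ^+ 2]real_normK ?num_real// expr2 mulrA ler_wpM2r// mulrC; exact: ltW.
Qed.

Fixpoint smooth (k : nat) F : Prop :=
  if k is k'.+1 then exists2 F', (forall x, is_derive x 1 F (F' x)) & smooth k' F'
  else continuous F.

Lemma smooth_continuous k F : smooth k F -> continuous F.
Proof.
case: k => [//|k] [F' dF _] x.
by apply/differentiable_continuous/derivable1_diffP; exact: ex_derive.
Qed.

Lemma smoothW k F : smooth k.+1 F -> smooth k F.
Proof.
elim: k F => [|k IH] F; first exact: smooth_continuous.
by move=> [F' dF /IH sF']; exists F'.
Qed.

Lemma smooth_add k F G : smooth k F -> smooth k G -> smooth k (fun x => F x + G x).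
Proof.
elim: k F G => [|k IH] F G; first by move=> cF cG x; apply: continuousD; [exact: cF|exact: cG].
move=> [F' dF sF] [G' dG sG]; exists (fun x => F' x + G' x); last exact: IH.
by move=> x; exact: is_derive_add.
Qed.

Lemma smooth_mul k F G : smooth k F -> smooth k G -> smooth k (fun x => F x * G x).
Proof.
elim: k F G => [|k IH] F G; first by move=> cF cG x; apply: continuousM; [exact: cF|exact: cG].
move=> sF sG; have [F' dF sF'] := sF; have [G' dG sG'] := sG.
exists (fun x => F' x * G x + F x * G' x); first by move=> x; exact: is_derive_mul.
by apply: smooth_add; apply: IH => //; exact: smoothW.
Qed.

Lemma smooth_cst k c : smooth k (fun=> c).
Proof.
elim: k c => [|k IH] c; first by move=> x; exact: cst_continuous.
by exists (fun=> 0); [move=> x; exact: is_derive_cst|exact: IH].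
Qed.

Lemma is_derive_affine F x c d (e : R) : is_derive (c + d * x) 1 F e ->
  is_derive x 1 (fun y => F (c + d * y)) (d * e).
Proof.
move=> dF.
have dA : is_derive x 1 (fun y : R => c + d * y) d.
  have := is_derive_add (is_derive_cst c x 1) (is_derive_mul (is_derive_cst d x 1) (is_derive_id x 1)).
  by move/is_derive_eq; apply; rewrite mul0r add0r add0r mulr1.
have := @is_derive1_comp R F (fun y => c + d * y) x _ _ dF dA.
by move/is_derive_eq; apply; rewrite mulrC.
Qed.

Lemma smooth_affine k F c d : smooth k F -> smooth k (fun x => F (c + d * x)).
Proof.
elim: k F => [|k IH] F.
  move=> cF x; apply: (@continuous_comp _ _ _ (fun y => c + d * y) F); last exact: cF.
  apply: continuousD; first exact: cst_continuous.
  by apply: continuousM; [exact: cst_continuous|].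
move=> [F' dF sF]; exists (fun x => d * F' (c + d * x)).
  by move=> x; exact: is_derive_affine.
by apply: smooth_mul; [exact: smooth_cst|exact: IH].
Qed.

Lemma smooth_flat k n : smooth k (flat n).
Proof.
elim: k n => [|k IH] n.
  by move=> x; apply/differentiable_continuous/derivable1_diffP; apply: ex_derive; exact: is_derive_flat.
exists (fun x => flat n.+2 x + (- n%:R) * flat n.+1 x).
  by move=> x; rewrite mulNr; exact: is_derive_flat.
by apply: smooth_add => //; apply: smooth_mul => //; exact: smooth_cst.
Qed.

(* exp(- 1 / (1 + x)) exp(- 1 / (1 - x)) on ]-1, 1[; the arguments have the shape c + d * x of
   [smooth_affine]. *)
Definition bump_fun x := flat 0 (1 + 1 * x) * flat 0 (1 + -1 * x).
Definition dbump_fun x := flat 2 (1 + 1 * x) * flat 0 (1 + -1 * x) - flat 0 (1 + 1 * x) * flat 2 (1 + -1 * x).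

Lemma smooth_bump k : smooth k bump_fun.
Proof. by apply: smooth_mul; apply: smooth_affine; exact: smooth_flat. Qed.

Lemma is_derive_bump x : is_derive x 1 bump_fun (dbump_fun x).
Proof.
have H1 := is_derive_affine (c := 1) (d := 1) (is_derive_flat 0 (1 + 1 * x)).
have H2 := is_derive_affine (c := 1) (d := -1) (is_derive_flat 0 (1 + -1 * x)).
have := is_derive_mul H1 H2; move/is_derive_eq; apply.
by rewrite /dbump_fun; ring.
Qed.

Lemma smooth_dbump k : smooth k dbump_fun.
Proof.
rewrite (_ : dbump_fun = (fun x => flat 2 (1 + 1 * x) * flat 0 (1 + -1 * x) +
    -1 * (flat 0 (1 + 1 * x) * flat 2 (1 + -1 * x)))).
  apply: smooth_add; first by apply: smooth_mul; apply: smooth_affine; exact: smooth_flat.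
  apply: smooth_mul; first exact: smooth_cst.
  by apply: smooth_mul; apply: smooth_affine; exact: smooth_flat.
by apply/funext => x; rewrite /dbump_fun [X in _ = _ + X]mulN1r.
Qed.

Lemma bump_out x : 1 <= `|x| -> bump_fun x = 0 /\ dbump_fun x = 0.
Proof.
move=> x1; have H n : flat n (1 + 1 * x) = 0 \/ flat n (1 + -1 * x) = 0.
  rewrite /flat; case: ifP => [h1|_]; last by left.
  case: ifP => [h2|_]; last by right.
  by exfalso; move: x1; apply/negP; rewrite -ltNge ltr_norml; lra.
have F0 n y : flat n y = 0 -> forall m, flat m y = 0.
  rewrite /flat; case: ifP => // y0 /eqP; rewrite mulf_eq0 invr_eq0 expf_eq0 (gt_eqF y0) andbF /=.
  by rewrite expR_eq0.
rewrite /bump_fun /dbump_fun; case: (H 0%N) => /F0 E; by rewrite !E !(mul0r, mulr0) subr0.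
Qed.

(** The exponent of the bump is -2 / (1 - x^2), whose derivative is the factor on the right. *)
Lemma bump_dbump x : `|x| < 1 -> dbump_fun x = - (4 * x / (1 - x ^+ 2) ^+ 2) * bump_fun x.
Proof.
rewrite ltr_norml => /andP[h1 h2].
have p1 : 0 < 1 + 1 * x by lra.
have p2 : 0 < 1 + -1 * x by lra.
have E : 1 - x ^+ 2 = (1 + 1 * x) * (1 + -1 * x) by ring.
rewrite E /dbump_fun /bump_fun /flat p1 p2 !expr0 !invr1.
move: (expR _) (expR _) => a b.
have n1 : 1 + 1 * x != 0 by rewrite gt_eqF.
have n2 : 1 + -1 * x != 0 by rewrite gt_eqF.
by field; rewrite n2 -[x]mul1r n1.
Qed.

Lemma bump_ge0 x : 0 <= bump_fun x.
Proof. by rewrite mulr_ge0 ?flat_ge0. Qed.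

(** The bump increases up to 0 and decreases afterwards. This gives the integrand of [dbump2_moment]
    a constant sign, so that no cancellation has to be controlled. *)
Lemma dbump_sign x : x * dbump_fun x <= 0.
Proof.
have [x1|x1] := ltP `|x| 1; last by rewrite (bump_out x1).2 mulr0.
rewrite bump_dbump// mulrA mulrN mulNr oppr_le0 mulr_ge0 ?bump_ge0//.
have -> : x * (4 * x / (1 - x ^+ 2) ^+ 2) = 4 * (x ^+ 2 / (1 - x ^+ 2) ^+ 2) by ring.
by rewrite mulr_ge0// divr_ge0// ?sqr_ge0.
Qed.

Lemma dbump_lower : exists2 c, 0 < c & forall x, 1 / 4 <= x <= 1 / 2 -> c <= - (x * dbump_fun x).
Proof.
(* On [1/4, 1/2], 1 / (1 + x) <= 1 and 1 / (1 - x) <= 2, so m bounds the bump from below; the other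
   factor 4 x^2 / (1 - x^2)^2 is at least 1/4. *)
pose m := expR (- 1) * expR (- 2) : R.
have m0 : 0 < m by rewrite mulr_gt0 ?expR_gt0.
exists (m / 4); first by lra.
move=> x /andP[x1 x2].
have xa : `|x| < 1 by rewrite ltr_norml; lra.
rewrite bump_dbump// mulrA mulrN mulNr opprK.
have s1 : 0 < 1 - x ^+ 2 by nra.
have s2 : (1 - x ^+ 2) ^+ 2 <= 1 by rewrite expr_le1// ?ltW//; nra.
have H1 : 1 / 4 <= x * (4 * x / (1 - x ^+ 2) ^+ 2).
  have -> : x * (4 * x / (1 - x ^+ 2) ^+ 2) = 4 * x ^+ 2 / (1 - x ^+ 2) ^+ 2 by ring.
  by rewrite ler_pdivlMr ?exprn_gt0//; nra.
have H2 : m <= bump_fun x.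
  have p1 : 0 < 1 + 1 * x by lra.
  have p2 : 0 < 1 + -1 * x by lra.
  rewrite /bump_fun /flat p1 p2 !expr0 !invr1 !mul1r /m.
  apply: ler_pM; rewrite ?expR_ge0// ler_expR lerN2.
    by rewrite invf_le1//; lra.
  by rewrite -[2]invrK lef_pV2 ?posrE ?invr_gt0//; lra.
have := ler_pM _ (ltW m0) H1 H2; lra.
Qed.

Lemma smooth_bounded F : continuous F -> (forall x, 1 <= `|x| -> F x = 0) ->
  exists M, forall x, `|F x| <= M.
Proof.
move=> cF F0.
have nc : {within `[(-1 : R), 1], continuous (fun t => `|F t|)}.
  apply: continuous_subspaceT => t; apply: continuous_comp (cF t) _; exact: norm_continuous.
have le11 : (-1 : R) <= 1 by lra.
have [m _ mP] := EVT_max le11 nc.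
exists `|F m| => x; have [x1|x1] := ltP `|x| 1; last by rewrite F0 ?normr0.
by apply: mP; rewrite in_itv /= -ler_norml ltW.
Qed.

End Bump.

(** * Products of one-variable functions, squares and bounds for integrals *)

Section TensorProducts.
Context {R : realType}.
Implicit Types (z w c v : R[i]) (F G : R -> R) (H : R[i] -> R[i]) (r M x y : R).
Notation plane := (measurableTypeR R * measurableTypeR R)%type.

(** Each partial derivative acts on one factor, which reduces smoothness in the plane and the mixed
    derivative to one variable. *)
Definition tensor F G z : R[i] := (F (Re z) * G (Im z))%:C.

Lemma is_derive_shift0 F x (e : R) : is_derive x 1 F e -> is_derive (0 : R) 1 (fun t => F (x + t)) e.
Proof.
move=> dF; have dF0 : is_derive (x + 1 * 0) 1 F e by rewrite mulr0 addr0.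
have := is_derive_affine dF0; rewrite mul1r.
by under eq_fun => t do rewrite mul1r.
Qed.

Lemma dir_derive_real H v z (k : R -> R) (d : R) : (forall t, H (z + t%:C * v) = (k t)%:C) ->
  is_derive (0 : R) 1 k d -> dir_derivable H v z /\ dir_derive v H z = d%:C.
Proof.
move=> Hk dk; have ER : (fun t => Re (on_line H z v t)) = k.
  by apply/funext => t; rewrite /on_line Hk.
have EI : (fun t => Im (on_line H z v t)) = (fun=> 0).
  by apply/funext => t; rewrite /on_line Hk.
rewrite /dir_derivable /dir_derive ER EI; split.
  by split; [exact: ex_derive|exact: derivable_cst].
by rewrite !derive1E derive_val derive_cst.
Qed.

Lemma tensor_partial_x F G F' z : (forall x, is_derive x 1 F (F' x)) ->
  dir_derivable (tensor F G) 1 z /\ partial_x (tensor F G) z = tensor F' G z.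
Proof.
move=> dF; apply: (@dir_derive_real _ _ _ (fun t => F (Re z + t) * G (Im z))).
  by move=> t; rewrite /tensor mulr1; case: z => x y /=; rewrite addr0.
have := is_derive_mul (is_derive_shift0 (dF (Re z)))
  (is_derive_cst (G (Im z)) (0 : R) 1).
by rewrite mulr0 addr0.
Qed.

Lemma tensor_partial_y F G G' z : (forall x, is_derive x 1 G (G' x)) ->
  dir_derivable (tensor F G) imag_unit z /\ partial_y (tensor F G) z = tensor F G' z.
Proof.
move=> dG; apply: (@dir_derive_real _ _ _ (fun t => F (Re z) * G (Im z + t))).
  by move=> t; rewrite /tensor; case: z => x y /=; rewrite !(mulr0, mul0r) subr0 mulr1 !addr0.
have := is_derive_mul (is_derive_cst (F (Re z)) (0 : R) 1)
  (is_derive_shift0 (dG (Im z))).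
by rewrite mul0r add0r.
Qed.

Lemma tensor_continuous F G z : continuous F -> continuous G -> {for z, continuous (tensor F G)}.
Proof.
move=> cF cG.
have H (K : R -> R) (p : R[i] -> R) : continuous K ->
    (forall w, `|p w - p z| <= normc (w - z)) -> {for z, continuous (fun w => (K (p w))%:C)}.
  move=> cK pL; apply/continuous_normcP => e e0.
  have /cvgrPdist_lt/(_ e e0)/nbhs_normP[d /= d0 Hd] := cK (p z).
  apply: nearC1 (normc_near z d0) _ => w wd.
  rewrite -rmorphB normc_real distrC; apply: Hd; rewrite /ball_ /= distrC.
  exact: le_lt_trans (pL w) wd.
apply: (@continuous_ext _ _ (fun w => (F (Re w))%:C * (G (Im w))%:C)).
  by apply: nearCW => w; rewrite -rmorphM.
apply: continuousM_normc; apply: H => // w.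
  by rewrite -Re_sub ge_normc_Re.
by rewrite -Im_sub ge_normc_Im.
Qed.

Lemma Ck_tensor k F G : smooth k F -> smooth k G -> Ck k setT (tensor F G).
Proof.
elim: k F G => [|k IH] F G sF sG.
  by move=> z _; exact: tensor_continuous.
have [F' dF sF'] := sF; have [G' dG sG'] := sG; split.
- by move=> z _; apply: tensor_continuous; [exact: smooth_continuous sF|exact: smooth_continuous sG].
- by move=> z _; split; [exact: (tensor_partial_x G z dF).1|exact: (tensor_partial_y F z dG).1].
- rewrite (_ : partial_x _ = tensor F' G); last first.
    by apply/funext => z; exact: (tensor_partial_x G z dF).2.
  by apply: IH => //; exact: smoothW.
rewrite (_ : partial_y _ = tensor F G'); last first.
  by apply/funext => z; exact: (tensor_partial_y F z dG).2.
by apply: IH => //; exact: smoothW.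
Qed.

Lemma square_norm c r z : square c r z <->
  `|Re z - Re c| <= r /\ `|Im z - Im c| <= r.
Proof.
rewrite /square /rect !ler_norml.
by split=> -[/andP[? ?] /andP[? ?]]; split; apply/andP; split; lra.
Qed.

Lemma square_closed c r : closed (square c r : set R[i]).
Proof.
have H (p : R[i] -> R) : (forall w z, `|p w - p z| <= normc (w - z)) -> closed [set z | p z <= r].
  move=> pL; rewrite -[X in closed X]setCK; apply: open_closedC; rewrite openE => z /= /negP.
  rewrite -ltNge => rz.
  have d0 : 0 < p z - r by rewrite subr_gt0.
  apply: nearC1 (normc_near z d0) _ => w wz /=; apply/negP; rewrite -ltNge.
  by have := pL w z; rewrite ler_norml => /andP[? _]; lra.
rewrite (_ : (square c r : set R[i]) = [set z | `|Re z - Re c| <= r] `&`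
  [set z | `|Im z - Im c| <= r]); last first.
  by apply/seteqP; split => z /=; rewrite square_norm.
apply: closedI; apply: H => w z; apply: le_trans (ler_dist_dist _ _) _.
  by rewrite opprB addrA subrK -Re_sub ge_normc_Re.
by rewrite opprB addrA subrK -Im_sub ge_normc_Im.
Qed.

Lemma square_compact c r : compact (square c r : set R[i]).
Proof.
pose b := `|Re c| + `|Im c| + r.
apply: (subclosed_compact _ (@box_compact R b)); first exact: square_closed.
move=> z /square_norm[zx zy]; split.
  have := ler_normD (Re z - Re c) (Re c); rewrite subrK /b.
  by have := normr_ge0 (Im c); lra.
have := ler_normD (Im z - Im c) (Im c); rewrite subrK /b.
by have := normr_ge0 (Re c); lra.
Qed.

Lemma square_measurable c r : measurable (@of_xy R @^-1` square c r : set plane).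
Proof. exact: closed_plane_measurable (@square_closed c r). Qed.

Lemma square_measure c r : 0 <= r -> dA (@of_xy R @^-1` square c r : set plane) = ((2 * r) ^+ 2)%:E.
Proof.
move=> r0.
pose J1 : set (measurableTypeR R) := `[Re c - r, Re c + r]%classic.
pose J2 : set (measurableTypeR R) := `[Im c - r, Im c + r]%classic.
have E : (dA (J1 `*` J2) = (@lebesgue_measure R) J1 * (@lebesgue_measure R) J2)%E.
  by apply: product_measure1E; exact: measurable_itv.
have -> : (@of_xy R @^-1` square c r : set plane) = J1 `*` J2.
  by apply/seteqP; split => -[x y]; rewrite /square /rect /J1 /J2 /= !in_itv.
rewrite E.
have L (x : R) : (@lebesgue_measure R) `[x - r, x + r]%classic = (2 * r)%:E.
  rewrite lebesgue_measure_itv /= lte_fin; case: ifPn => [_|]; first by congr _%:E; ring.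
  by rewrite -leNgt => h; congr _%:E; lra.
by rewrite !L -EFinM expr2.
Qed.

Lemma Rintegral_ae_bound (D K : set plane) (k : plane -> R) M : measurable D -> measurable K ->
  K `<=` D -> measurable_fun D k -> (dA K < +oo)%E -> 0 <= M ->
  {ae @dA R, forall p, K p -> `|k p| <= M} -> (forall p, D p -> ~ K p -> k p = 0) ->
  `|Rintegral dA D k| <= M * fine (dA K).
Proof.
move=> mD mK KD mk Kfin M0 kM k0.
have -> : Rintegral dA D k = Rintegral dA K k.
  rewrite Rintegral_mkcond [RHS]Rintegral_mkcond; congr Rintegral; apply/funext => p.
  rewrite /patch; have [Kp|nKp] := pselect (K p).
    by rewrite !mem_set//; exact: KD.
  rewrite [in RHS]memNset//; have [Dp|nDp] := pselect (D p); last by rewrite memNset.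
  by rewrite mem_set// k0.
have mk' := (measurable_realfun.measurable_EFinP K k).2 (measurable_funS mD KD mk).
have B : (`|\int[@dA R]_(p in K) (k p)%:E| <= M%:E * dA K)%E.
  apply: le_trans (le_abse_integral _ mK mk') _.
  apply: (@integral_le_bound _ _ _ (@dA R) K (EFin \o k) M%:E mK mk'); first by rewrite lee_fin.
  apply: filterS kM => p kp Kp.
  by rewrite lee_fin; exact: kp.
have Kf : dA K \is a fin_num by rewrite ge0_fin_numE// measure_ge0.
rewrite /Rintegral; move: B; rewrite -[dA K]fineK// -EFinM.
by case: (\int[dA]_(p in K) (k p)%:E)%E => [x|//|//] /=; rewrite lee_fin.
Qed.

Lemma integral_dA_bound (U : set R[i]) c r (F : R[i] -> R[i]) M : open U -> square c r `<=` U ->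
  0 <= r -> 0 <= M -> measurable_on U F ->
  {ae @dA R, forall p, square c r (of_xy p) -> normc (F (of_xy p)) <= M} ->
  (forall z, U z -> ~ square c r z -> F z = 0) ->
  normc (integral_dA U F) <= 2 * M * (2 * r) ^+ 2.
Proof.
move=> oU sU r0 M0 [mR mI] FM F0.
have sm := square_measure c r0.
have fin : (dA (@of_xy R @^-1` square c r : set plane) < +oo)%E by rewrite sm ltry.
apply: le_trans (normc_le_ReIm _) _; rewrite /integral_dA /=.
have -> : 2 * M * (2 * r) ^+ 2 = M * (2 * r) ^+ 2 + M * (2 * r) ^+ 2 by ring.
have fE : fine (dA (@of_xy R @^-1` square c r : set plane)) = (2 * r) ^+ 2 by rewrite sm.
rewrite -fE; apply: lerD; apply: Rintegral_ae_bound => //; try exact: open_plane_measurable;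
  try exact: square_measurable.
- by move=> p; exact: sU.
- by apply: (@filterS _ _ (ae_filter_ringOfSetsType (@dA R))) FM => p H sp; apply: le_trans (H sp); exact: ge_normc_Re.
- by move=> p Up np; rewrite F0.
- by move=> p; exact: sU.
- by apply: (@filterS _ _ (ae_filter_ringOfSetsType (@dA R))) FM => p H sp; apply: le_trans (H sp); exact: ge_normc_Im.
- by move=> p Up np; rewrite F0.
Qed.

End TensorProducts.

(** * Bump functions at scale e *)

Section ScaledBumps.
Context {R : realType}.
Implicit Types (z w c d : R[i]) (F G : R[i] -> R[i]) (r M x y p q e : R).
Notation plane := (measurableTypeR R * measurableTypeR R)%type.

Definition bump_at p e x := bump_fun (- p / e + e^-1 * x).
Definition dbump_at p e x := e^-1 * dbump_fun (- p / e + e^-1 * x).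

Lemma is_derive_bump_at p e x : is_derive x 1 (bump_at p e) (dbump_at p e x).
Proof. exact: is_derive_affine (is_derive_bump _). Qed.

Lemma smooth_bump_at k p e : smooth k (bump_at p e).
Proof. exact: smooth_affine (smooth_bump k). Qed.

Lemma smooth_dbump_at k p e : smooth k (dbump_at p e).
Proof. by apply: smooth_mul; [exact: smooth_cst|exact: smooth_affine (smooth_dbump k)]. Qed.

Lemma bump_at_out p e x : 0 < e -> e <= `|x - p| -> bump_at p e x = 0 /\ dbump_at p e x = 0.
Proof.
move=> e0 ex; rewrite /bump_at /dbump_at; have [|-> ->] := @bump_out R (- p / e + e^-1 * x).
  rewrite (_ : _ + _ = (x - p) / e); last by ring.
  by rewrite normrM normfV (gtr0_norm e0) ler_pdivlMr// mul1r.
by rewrite mulr0.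
Qed.

Definition bump2 c e : R[i] -> R[i] := tensor (bump_at (Re c) e) (bump_at (Im c) e).
Definition dbump2 c e : R[i] -> R[i] := tensor (dbump_at (Re c) e) (dbump_at (Im c) e).

Lemma bump2_out c e z : 0 < e -> ~ square c e z -> bump2 c e z = 0 /\ dbump2 c e z = 0.
Proof.
move=> e0 nz; rewrite /bump2 /dbump2 /tensor.
have [zx|zx] := leP e `|Re z - Re c|.
  by have [-> ->] := bump_at_out e0 zx; rewrite !mul0r.
have [zy|zy] := leP e `|Im z - Im c|.
  by have [-> ->] := bump_at_out e0 zy; rewrite !mulr0.
by exfalso; apply: nz; apply/square_norm; split; exact: ltW.
Qed.

Lemma tsupport_square F c e : (forall z, ~ square c e z -> F z = 0) -> tsupport F `<=` square c e.
Proof.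
move=> F0; have H : [set z | F z != 0] `<=` square c e.
  by move=> z /eqP Fz; apply: contrapT => /F0.
by apply: subset_trans (closureS H) _; rewrite -(closure_id _).1//; exact: square_closed.
Qed.

Lemma bump2_test_function U c e : 0 < e -> square c e `<=` U -> test_function U (bump2 c e).
Proof.
move=> e0 sU; have sup := tsupport_square (fun z (nz : ~ square c e z) => (bump2_out e0 nz).1).
split.
- by move=> k; apply: Ck_tensor; exact: smooth_bump_at.
- exact: (subclosed_compact (@closed_closure _ _) (@square_compact R c e) sup).
- exact: subset_trans sup sU.
Qed.

Lemma bump2_mixed c e : iter 1 (@partial_x R) (iter 1 (@partial_y R) (bump2 c e)) = dbump2 c e.
Proof.
rewrite /=; have -> : partial_y (bump2 c e) =
    tensor (bump_at (Re c) e) (dbump_at (Im c) e).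
  by apply/funext => z; exact: (tensor_partial_y _ z (is_derive_bump_at _ _)).2.
by apply/funext => z; exact: (tensor_partial_x _ z (is_derive_bump_at _ _)).2.
Qed.

Lemma bump2_bounds : exists2 B : R, 0 < B & forall c e z, 0 < e ->
  normc (bump2 c e z) <= B /\ normc (dbump2 c e z) <= B / e ^+ 2.
Proof.
have [B0 H0] := smooth_bounded (smooth_continuous (@smooth_bump R 0)) (fun x h => (bump_out h).1).
have [B1 H1] := smooth_bounded (smooth_continuous (@smooth_dbump R 0)) (fun x h => (bump_out h).2).
have b0 : 0 <= B0 by exact: le_trans (normr_ge0 _) (H0 0).
have b1 : 0 <= B1 by exact: le_trans (normr_ge0 _) (H1 0).
exists (B0 ^+ 2 + B1 ^+ 2 + 1); first by rewrite ltr_wpDl// addr_ge0// sqr_ge0.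
move=> c e z e0; rewrite /bump2 /dbump2 /tensor !normc_real /bump_at /dbump_at; split.
  apply: (@le_trans _ _ (B0 * B0)); first by rewrite normrM ler_pM.
  by rewrite -expr2 -addrA lerDl addr_ge0// sqr_ge0.
have i0 : 0 < e^-1 by rewrite invr_gt0.
apply: (@le_trans _ _ ((e^-1 * B1) * (e^-1 * B1))).
  by rewrite !normrM (gtr0_norm i0) ler_pM// ?mulr_ge0// ?(ltW i0)// ler_wpM2l// ltW.
rewrite (_ : _ * _ = B1 ^+ 2 / e ^+ 2); last by field; rewrite gt_eqF.
by rewrite ler_wpM2r ?invr_ge0 ?sqr_ge0//; have := sqr_ge0 B0; lra.
Qed.

Lemma dbump2_continuous c e z : {for z, continuous (dbump2 c e)}.
Proof. by apply: tensor_continuous; exact: smooth_continuous (smooth_dbump_at 0 _ _). Qed.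

(** The imaginary part of (x + iy)^2 is 2 x y, so the integrand separates. In rescaled coordinates e
    cancels, and by [dbump_sign] both factors are nonnegative. *)
Lemma Im_dbump2 c e z : 0 < e -> exists s t : R,
  [/\ s = (Re z - Re c) / e, t = (Im z - Im c) / e &
  Im ((z - c) ^+ 2 * dbump2 c e z) = 2 * ((- (s * dbump_fun s)) * (- (t * dbump_fun t)))].
Proof.
move=> e0; do 2!eexists; split; [reflexivity|reflexivity|].
have Im_sqr (w : R[i]) (k : R) : Im (w ^+ 2 * k%:C) = 2 * Re w * Im w * k.
  by rewrite Im_mul expr2 Im_mul /=; ring.
rewrite /dbump2 /tensor /dbump_at Im_sqr Re_sub Im_sub.
rewrite (_ : - Re c / e + e^-1 * Re z = (Re z - Re c) / e); last by ring.
rewrite (_ : - Im c / e + e^-1 * Im z = (Im z - Im c) / e); last by ring.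
move: (Re z - Re c) (Im z - Im c) (dbump_fun _) (dbump_fun _) => x y A B.
by field; rewrite gt_eqF.
Qed.

Lemma Rintegral_ge_on (K : set plane) (k : plane -> R) M : measurable K ->
  (@dA R).-integrable setT (EFin \o k) -> 0 <= M -> (forall v, 0 <= k v) ->
  (dA K < +oo)%E -> (forall v, K v -> M <= k v) -> M * fine (dA K) <= Rintegral (@dA R) setT k.
Proof.
move=> mK ik M0 k0 Kfin kM.
have mk := measurable_int _ ik.
have B : (M%:E * dA K <= \int[@dA R]_v (EFin \o k) v)%E.
  rewrite -(integral_cst (@dA R) mK).
  apply: (@le_trans _ _ (\int[@dA R]_(v in K) (EFin \o k) v)%E).
    by apply: ge0_le_integral => //; exact: measurable_funS measurableT (@subsetT _ _) mk.
  apply: ge0_subset_integral => //.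
  by move=> v _ /=; rewrite lee_fin.
have Kf : dA K \is a fin_num by rewrite ge0_fin_numE// measure_ge0.
have If := integrable_fin_num measurableT ik.
by move: B; rewrite -[dA K]fineK// -[(\int[_]_v _)%E]fineK// -EFinM lee_fin.
Qed.

End ScaledBumps.

(** * Failure of W^(2,oo) regularity *)

Section LogarithmicObstruction.
Context {R : realType}.
Implicit Types (z w c d : R[i]) (F G : R[i] -> R[i]) (M e : R).
Notation plane := (measurableTypeR R * measurableTypeR R)%type.

Lemma continuous_mul_dbump2 F U c e : open U -> 0 < e -> square c e `<=` U ->
  (forall z, U z -> {for z, continuous F}) ->
  exists r, compact_piecewise r [::] (fun z => F z * dbump2 c e z).
Proof.
move=> oU e0 sU Fc; have sup := tsupport_square (fun z (nz : ~ square c e z) => (bump2_out e0 nz).2).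
have [r _ out] := compact_outside (@square_compact R c e); exists r.
apply: (@compact_piecewise_mul R U r [::] F (dbump2 c e) (dbump2 c e)).
- by move=> z /out nz /sup.
- exact: subset_trans sup sU.
- by move=> z Uz _; exact: Fc.
- by move=> z Uz; exists (normc (F z) + 1); exact: continuous_normc_bounded (Fc z Uz).
- by move=> z; exact: dbump2_continuous.
- by move=> z; exact: off_tsupport.
Qed.

Lemma compact_piecewise_measurable r S F : compact_piecewise r S F -> measurable_on setT F.
Proof.
move=> nF; have [M [mR _ _]] := compact_piecewise_Re nF; have [M' [mI _ _]] := compact_piecewise_Im nF.
by rewrite /measurable_on preimage_setT.
Qed.

Lemma continuous_sqr_sub c z : {for z, continuous (fun w => (w - c) ^+ 2)}.
Proof. exact: rdiff_continuous (holo_rdiff (holoX 2 (holo_sub c z))). Qed.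

Lemma dbump2_moment : exists2 k : R, 0 < k & forall c e, 0 < e ->
  k * e ^+ 2 <= Im (integral_dA setT (fun z => (z - c) ^+ 2 * dbump2 c e z)).
Proof.
have [k0 k00 lower] := @dbump_lower R.
exists (2 * k0 ^+ 2 / 16); first by rewrite divr_gt0// mulr_gt0// exprn_gt0.
move=> c e e0.
have [r nF] := continuous_mul_dbump2 openT e0 (@subsetT _ (square c e)) (fun z _ => @continuous_sqr_sub c z).
(* On the square of half-side e / 8 around m, both rescaled coordinates lie in [1/4, 1/2], where
   [dbump_lower] applies; its area e^2 / 16 explains the 16 in the constant. *)
pose m : R[i] := (Re c + 3 * e / 8) +i* (Im c + 3 * e / 8).
have e8 : 0 <= e / 8 by lra.
have sm := square_measure m e8.
rewrite /integral_dA preimage_setT /=.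
have E : 2 * k0 ^+ 2 / 16 * e ^+ 2 = (2 * k0 ^+ 2) * fine (@dA R (@of_xy R @^-1` square m (e / 8))).
  by rewrite sm /=; field.
rewrite E; apply: Rintegral_ge_on.
- exact: square_measurable.
- exact: (compact_piecewise_integrable nF).2.
- by rewrite mulr_ge0// sqr_ge0.
- move=> v; have [s [t [_ _ ->]]] := Im_dbump2 c (of_xy v) e0.
  by rewrite !mulr_ge0// oppr_ge0 dbump_sign.
- by rewrite sm ltry.
move=> v /square_norm[vx vy]; have [s [t [sE tE ->]]] := Im_dbump2 c (of_xy v) e0.
have H (x p : R) : `|x - (p + 3 * e / 8)| <= e / 8 -> 1 / 4 <= (x - p) / e <= 1 / 2.
  by rewrite ler_norml => /andP[h1 h2]; rewrite ler_pdivlMr// ler_pdivrMr//; apply/andP; split; lra.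
have Hs := lower s _; rewrite sE in Hs *; have {}Hs := Hs (H _ _ vx).
have Ht := lower t _; rewrite tE in Ht *; have {}Ht := Ht (H _ _ vy).
by rewrite ler_wpM2l// expr2; apply: ler_pM => //; exact: ltW.
Qed.

Lemma measurable_on_mul_tensor U F (H K : R -> R) : open U -> measurable_on U F ->
  continuous H -> continuous K -> measurable_on U (fun z => F z * tensor H K z).
Proof.
move=> oU [mR mI] cH cK.
have mt : measurable_fun (@of_xy R @^-1` U : set plane) (fun v => Re (tensor H K (of_xy v))).
  apply: (@piecewise_plane_measurable R [::] U (fun z => Re (tensor H K z)) oU) => z _ _ e e0.
  have e2 : 0 < e / 2 by lra.
  by apply: nearC1 (continuous_ReIm (tensor_continuous (z := z) cH cK) e2) _ => w [h _]; lra.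
split.
  under eq_fun => v do rewrite Re_mul mulr0 subr0.
  exact: measurable_realfun.measurable_funM.
under eq_fun => v do rewrite Im_mul mulr0 add0r.
exact: measurable_realfun.measurable_funM.
Qed.

(* Testing the weak mixed derivative against [bump2 c e] gives |ln e| e^2 = O(e^2) as e -> 0, because
   the integral of (z - c)^2 [dbump2 c e] has order e^2. *)
Lemma log_not_Wkinfty U u c c0 C r0 : open U -> U c -> (forall z, U z -> {for z, continuous u}) ->
  c0 != 0 -> 0 <= C -> 0 < r0 ->
  (forall e, 0 < e -> e < r0 -> forall z, square c e z ->
    normc (u z - c0 * (z - c) ^+ 2 * (ln e)%:C) <= C * e ^+ 2) ->
  ~ Wkinfty_loc 2 U u.
Proof.
move=> oU Uc uc c00 C0 r00 uC [_ /(_ 1%N 1%N isT)[G [mG bG] dG]].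
have [r1 r10 sU] := open_square oU Uc.
have [M0 GM0] := bG _ (@square_compact R c r1) sU.
pose M := Num.max M0 0.
have M0' : 0 <= M by rewrite le_max lexx orbT.
have GM : {ae @dA R, forall v, square c r1 (of_xy v) -> normc (G (of_xy v)) <= M}.
  apply: (@filterS _ _ (ae_filter_ringOfSetsType (@dA R))) GM0 => v H sv.
  by have := H sv; rewrite le_norm_normc le_max => ->.
have [B B0 bB] := @bump2_bounds R.
have [k k0 kT] := dbump2_moment.
have subsq e : e <= r1 -> square c e `<=` square c r1.
  by move=> er z /square_norm[h1 h2]; apply/square_norm; split; lra.
have key e : 0 < e -> e < r0 -> e <= r1 ->
    normc c0 * `|ln e| * (k * e ^+ 2) <= (8 * (M * B) + 8 * (C * B)) * e ^+ 2.
  move=> e0 er0 er1.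
  have seU : square c e `<=` U by apply: subset_trans sU; exact: subsq.
  have seT := @subsetT _ (square c e).
  have e2 : 0 < e ^+ 2 by rewrite exprn_gt0.
  have off z : ~ square c e z -> bump2 c e z = 0 /\ dbump2 c e z = 0 := bump2_out e0.
  have Bp z := bB c e z e0.
  have weak := dG _ (bump2_test_function e0 seU).
  rewrite bump2_mixed in weak.
  have sgn : (-1) ^+ (1 + 1) = 1 :> R[i] by ring.
  rewrite sgn mul1r in weak.
  (* The integrand is at most M B on a square of area (2 e)^2; the factor 2 counts real and
     imaginary parts. *)
  have upper : normc (integral_dA U (fun z => G z * bump2 c e z)) <= 2 * (M * B) * (2 * e) ^+ 2.
    apply: (@integral_dA_bound R U c e) => //.
    - exact: ltW.
    - by rewrite mulr_ge0// ltW.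
    - by apply: measurable_on_mul_tensor => //; exact: smooth_continuous (smooth_bump_at 0 _ _).
    - apply: (@filterS _ _ (ae_filter_ringOfSetsType (@dA R))) GM => v H sv.
      rewrite normcM; apply: ler_pM; rewrite ?normc_ge0//; last exact: (Bp _).1.
      by apply: H; exact: subsq sv.
    - by move=> z _ nz; rewrite (off z nz).1 mulr0.
  rewrite -weak in upper.
  rewrite integral_dA_zero_outside in upper; last first.
    by move=> z nz; rewrite (off z _).2 ?mulr0// => /seU.
  pose a := c0 * (ln e)%:C.
  pose E z := u z - a * (z - c) ^+ 2.
  have Ec z : U z -> {for z, continuous E}.
    move=> Uz; apply: (@continuous_ext _ _ (fun w => 1 * u w + (- a) * (w - c) ^+ 2)).
      by apply: nearCW => w; rewrite /E mul1r mulNr.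
    by apply: continuous_lin; [exact: uc|exact: continuous_sqr_sub].
  have [r2 n2] := continuous_mul_dbump2 oU e0 seU Ec.
  have [r3 n3] := continuous_mul_dbump2 openT e0 seT (fun z _ => @continuous_sqr_sub c z).
  have i2 := compact_piecewise_integrable n2; have i3 := compact_piecewise_integrable n3.
  have split_u : (fun z => u z * dbump2 c e z) =
      (fun z => a * ((z - c) ^+ 2 * dbump2 c e z) + E z * dbump2 c e z).
    by apply/funext => z; rewrite /E; ring.
  rewrite split_u plane_integralD ?plane_integralZ// in upper; last exact: plane_integrableZ.
  have error : normc (integral_dA setT (fun z => E z * dbump2 c e z)) <= 2 * (C * B) * (2 * e) ^+ 2.
    apply: (@integral_dA_bound R setT c e) => //.
    - exact: openT.
    - exact: ltW.
    - by rewrite mulr_ge0// ltW.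
    - exact: compact_piecewise_measurable n2.
    - apply: aeW => v sv; rewrite normcM.
      have H1 : normc (E (of_xy v)) <= C * e ^+ 2.
        by have := uC e e0 er0 _ sv; rewrite /E /a mulrAC.
      have := ler_pM (normc_ge0 _) (normc_ge0 _) H1 (Bp (of_xy v)).2.
      move/le_trans; apply; rewrite mulrACA mulfV ?mulr1//; last by rewrite gt_eqF.
    - by move=> z _ nz; rewrite (off z nz).2 mulr0.
  have T := kT c e e0; have := ge_normc_Im (integral_dA setT (fun z => (z - c) ^+ 2 * dbump2 c e z)).
  move: upper error T; set T := integral_dA _ (fun z => (z - c) ^+ 2 * _).
  set I := integral_dA _ _ => upper error T1 T2.
  have T3 : k * e ^+ 2 <= normc T by have := ler_norm (Im T); lra.
  have aT : normc (a * T) <= 2 * (M * B) * (2 * e) ^+ 2 + 2 * (C * B) * (2 * e) ^+ 2.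
    rewrite (_ : a * T = a * T + I + - I); last by rewrite addrK.
    by apply: le_trans (le_normcD _ _) _; rewrite normcN lerD.
  rewrite normcM in aT; have aE : normc a = normc c0 * `|ln e| by rewrite normcM normc_real.
  have := ler_wpM2l (normc_ge0 a) T3; rewrite aE in aT *; lra.
(* Divided by e^2, [key] gives |ln e| <= L - 1 for every admissible e, whereas e <= expR (- L)
   forces |ln e| >= L. *)
pose L := (8 * (M * B) + 8 * (C * B)) / (normc c0 * k) + 1.
have c0' : 0 < normc c0 by rewrite normc_gt0.
have L0 : 0 < L by rewrite ltr_wpDl// divr_ge0// ?mulr_ge0// ?addr_ge0// ?mulr_ge0// ltW.
pose e := Num.min (Num.min (r0 / 2) r1) (expR (- L)).
have e0 : 0 < e by rewrite !lt_min expR_gt0 r10 divr_gt0.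
have er0 : e < r0 by rewrite !gt_min; apply/orP; left; apply/orP; left; lra.
have er1 : e <= r1 by rewrite !ge_min lexx orbT.
have := key e e0 er0 er1; rewrite (mulrA _ k) ler_pM2r ?exprn_gt0//.
have lnL : L <= `|ln e|.
  have h : ln e <= - L by rewrite -[leRHS]expRK ler_ln ?posrE ?expR_gt0// ge_min lexx orbT.
  by rewrite ler0_norm; lra.
rewrite mulrAC -ler_pdivlMl; last exact: mulr_gt0.
rewrite mulrC; move: lnL; rewrite /L; lra.
Qed.

End LogarithmicObstruction.

(** * Expansion of u at a zero *)

Section LogarithmicExpansion.
Context {R : realType}.
Implicit Types (z w c d : R[i]) (F G : R[i] -> R[i]) (C e t : R).

Lemma ln_le_inv e : 0 < e -> e < 1 -> e * `|ln e| <= 1.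
Proof.
move=> e0 e1; rewrite ler0_norm ?ln_le0 ?(ltW e1)// -lnV ?posrE// mulrC -ler_pdivlMr// mul1r.
by apply/ltW/ln_sublinear; rewrite invr_gt0.
Qed.

(** With s = t / e this says that s^2 |ln s| is bounded on ]0, 2]: s |ln s| <= 1 below 1, and 0 <=
    ln s <= s <= 2 above. *)
Lemma sqr_ln_ratio t e : 0 < t -> 0 < e -> t <= 2 * e -> t ^+ 2 * `|ln t - ln e| <= 8 * e ^+ 2.
Proof.
move=> t0 e0 te; have te0 : 0 < t / e by rewrite divr_gt0.
rewrite -ln_div ?posrE//.
have -> : t ^+ 2 = (t / e) ^+ 2 * e ^+ 2 by rewrite exprMn exprVn mulfVK// expf_neq0 ?gt_eqF.
have {te} s2 : t / e <= 2 by rewrite ler_pdivrMr.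
move: (t / e) te0 s2 => s s0 s2; rewrite mulrAC ler_wpM2r ?sqr_ge0//.
have [s1|s1] := ltP s 1.
  have := ler_wpM2l (ltW s0) (ln_le_inv s0 s1); rewrite mulr1 mulrA -expr2; lra.
rewrite ger0_norm ?ln_ge0//; have := ln_sublinear s0 => h.
by apply: (@le_trans _ _ (s ^+ 2 * 2)); [rewrite ler_wpM2l ?sqr_ge0//; lra|nra].
Qed.

Variables (U V : set R[i]) (f : R[i] -> R[i]) (N : nat) (a : 'I_N -> R[i]).
Hypotheses (oU : open U) (oV : open V) (UV : U `<=` V)
  (fH : forall z, V z -> holo f z) (inj_a : injective a)
  (zerof : U `&` [set z | f z = 0] = range a).

(** Write P^2 = (z - c)^2 Q^2 and log |f|^2 = n ln t + log |h|^2 with t = |z - c|. Replacing Q^2 by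
    Q(c)^2 costs O(t |ln e|), replacing ln t by ln e is [sqr_ln_ratio], and log |h|^2 is bounded;
    with the factor (z - c)^2 each error is O(e^2). *)
Lemma pot_expansion j : exists c0 C r0, [/\ c0 != 0, 0 <= C, 0 < r0 &
  forall e, 0 < e -> e < r0 -> forall z, square (a j) e z ->
    normc (pot f a z - c0 * (z - a j) ^+ 2 * (ln e)%:C) <= C * e ^+ 2].
Proof.
have [Uc fc] := zero_a zerof j.
have [Q [Qholo PE Qc]] := zeros_poly_factor inj_a j.
have [m [h [m0 hholo fE hc]]] := zero_factor oU oV UV fH zerof Uc fc.
have [C1 hC1] := lognorm_bounded oV (UV Uc) hholo hc fE.
have [A WA] := holoM (Qholo (a j)) (Qholo (a j)).
have lipQ := wirt_lipschitz WA; have bndQ := wirt_bounded WA.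
set c := a j in Uc fc PE Qc fE hc hC1 WA lipQ bndQ *.
set q := Q c * Q c in lipQ bndQ.
set D1 : R := normc A + _ + 1 in lipQ; set D2 : R := _ + 1 in bndQ.
have D10 : 0 <= D1 by have := normc_ge0 A; rewrite /D1 normc0; lra.
have D20 : 0 <= D2 by have := normc_ge0 q; rewrite /D2; lra.
pose n : R := (2 * m)%:R.
have n0 : 0 < n by rewrite ltr0n muln_gt0.
have [d d0 Hd] : exists2 d, 0 < d & forall z, normc (z - c) < d ->
    [/\ normc (Q z * Q z - q) <= D1 * normc (z - c), normc (Q z * Q z) <= D2,
        h z != 0 & `|lognorm h z| <= C1].
  apply/nbhs_normcP.
  have E : \forall z \near c, normc (Q z * Q z - q) <= D1 * normc (z - c) /\ normc (Q z * Q z) <= D2.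
    by apply: nearC2 lipQ bndQ _ => z; exact: conj.
  by apply: nearC2 E hC1 _ => z [? ?] [? ?]; split.
have C10 : 0 <= C1.
  by have [|_ _ _ /(le_trans _)] := Hd c; [rewrite subrr normc0|apply].
(* The first 8 is 4 * 2, from t^2 <= 4 e^2 and t |ln e| <= 2; the second comes from [sqr_ln_ratio];
   the 4 is again t^2 <= 4 e^2. The radius ensures t <= 2 e < d and e < 1. *)
exists (q * n%:C), (8 * (D1 * n) + 8 * (D2 * n) + 4 * (D2 * C1)), (Num.min (d / 2) 1); split.
- rewrite mulf_neq0 ?mulf_neq0//; apply/eqP => /(congr1 (@complex.Re R)) /= n00.
  by move: n0; rewrite n00 ltxx.
- by rewrite !addr_ge0 ?mulr_ge0// ltW.
- by rewrite lt_min ltr01 divr_gt0.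
move=> e e0; rewrite lt_min => /andP[ed e1] z sz.
have te := square_dist sz.
set t := normc (z - c) in te.
have [zc|zc] := eqVneq z c.
  rewrite /pot PE zc subrr mul0r expr0n /= !(mul0r, mulr0) subrr normc0.
  by rewrite mulr_ge0 ?sqr_ge0// !addr_ge0 ?mulr_ge0// ltW.
have t0 : 0 < t by rewrite normc_gt0 subr_eq0.
have [] := Hd z; first by rewrite -/t; lra.
rewrite -/t => H1 H2 H3 H4.
have LE : lognorm f z = n * ln t + lognorm h z by apply: lognorm_zero.
have -> : pot f a z - q * n%:C * (z - c) ^+ 2 * (ln e)%:C =
    (z - c) ^+ 2 * ((Q z * Q z - q) * (n * ln e)%:C) +
    (z - c) ^+ 2 * (Q z * Q z * (n * (ln t - ln e))%:C) +
    (z - c) ^+ 2 * (Q z * Q z * (lognorm h z)%:C).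
  rewrite /pot PE LE !(rmorphD, rmorphN, rmorphM) /=.
  move: (z - c) (Q z) (n%:C) ((ln e)%:C) ((ln t)%:C) ((lognorm h z)%:C) => x1 x2 x3 x4 x5 x6.
  by ring.
have t2 : t ^+ 2 <= 4 * e ^+ 2 by nra.
have t20 : 0 <= t ^+ 2 by exact: sqr_ge0.
have e20 : 0 <= e ^+ 2 by exact: sqr_ge0.
rewrite [leRHS]mulrDl [X in _ <= X + _]mulrDl; apply: le_trans (le_normcD _ _) _; apply: lerD.
  apply: le_trans (le_normcD _ _) _; apply: lerD.
    rewrite normcM normc_exp normcM -/t normc_real normrM (gtr0_norm n0).
    apply: (@le_trans _ _ (4 * e ^+ 2 * (D1 * t * (n * `|ln e|)))).
      by apply: ler_pM; rewrite ?mulr_ge0 ?normc_ge0 ?(ltW n0)// ler_wpM2r// mulr_ge0// ltW.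
    have H : t * `|ln e| <= 2.
      by apply: (@le_trans _ _ (2 * e * `|ln e|)); [rewrite ler_wpM2r|have := ln_le_inv e0 e1; lra].
    have -> : 4 * e ^+ 2 * (D1 * t * (n * `|ln e|)) = 4 * e ^+ 2 * (D1 * n) * (t * `|ln e|) by ring.
    have -> : 8 * (D1 * n) * e ^+ 2 = 4 * e ^+ 2 * (D1 * n) * 2 by ring.
    by rewrite ler_wpM2l// !mulr_ge0// ltW.
  rewrite normcM normc_exp normcM -/t normc_real normrM (gtr0_norm n0).
  have H := sqr_ln_ratio t0 e0 te.
  have -> : 8 * (D2 * n) * e ^+ 2 = D2 * (n * (8 * e ^+ 2)) by ring.
  rewrite mulrCA (mulrCA (t ^+ 2) n); apply: ler_pM => //; [exact: normc_ge0| |by rewrite ler_wpM2l// ltW].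
  by rewrite !mulr_ge0// ltW.
rewrite normcM normc_exp normcM -/t normc_real.
have -> : 4 * (D2 * C1) * e ^+ 2 = 4 * e ^+ 2 * (D2 * C1) by ring.
by apply: ler_pM; rewrite ?mulr_ge0 ?normc_ge0//; apply: ler_pM; rewrite ?normc_ge0.
Qed.

Lemma pot_not_Wkinfty u : (0 < N)%N -> (forall z, U z -> u z = pot f a z) -> ~ Wkinfty_loc 2 U u.
Proof.
move=> N0 uE; pose j := Ordinal N0.
have [c0 [C [r0 [c00 C0 r00 H]]]] := pot_expansion j.
have [Uc _] := zero_a zerof j.
have [r1 r10 sU] := open_square oU Uc.
apply: (@log_not_Wkinfty R U u (a j) c0 C (Num.min r0 r1)) => //.
- move=> z Uz; apply: wirt_continuous (wirt_ext _ (wirt_pot_in oU oV UV fH zerof Uz)).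
  by apply: nearC1 (near_open oU Uz) _ => w /uE.
- by rewrite lt_min r00.
move=> e e0; rewrite lt_min => /andP[er0 er1] z sz; rewrite uE; first exact: H.
by apply: sU; move: sz => /square_norm[h1 h2]; apply/square_norm; split; lra.
Qed.

End LogarithmicExpansion.

Theorem theorem1p6 (R : realType) (U V : set R[i]) (f : R[i] -> R[i])
    (N : nat) (a : 'I_N -> R[i])
    (domainU : domain U) (boundedU : bounded_set U)
    (openV : open V) (UV : closure U `<=` V)
    (holof : holomorphic_on V f)
    (nonconstf : exists z w, [/\ V z, V w & f z != f w])
    (N_ge1 : (1 <= N)%N) (inj_a : injective a)
    (zerof : U `&` [set z | f z = 0] = range a) :
  let P := fun z : R[i] => \prod_(j < N) (z - a j) in
  let u := fun z : R[i] =>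
    if f z == 0 then 0 else P z ^+ 2 * (ln (complex.Re `|f z| ^+ 2))%:C in
  let g := fun z : R[i] => if f z == 0 then 0 else laplacian u z in
  [/\ Ck 1 U u,
      Linfty_loc U g /\ laplacian_distr U u g
    & ~ Wkinfty_loc 2 U u].
Proof.
move=> P u g; have [_ oU _] := domainU.
have {}UV : U `<=` V := subset_trans (@subset_closure _ U) UV.
have fH z : V z -> holo f z by move=> /holof/derivable_wirt.
have uE z : U z -> u z = pot f a z.
  move=> Uz; rewrite /u; case: eqP => [fz|_]; last by rewrite Re_norm.
  by have [->] := pot_at_zero zerof Uz fz.
have gE z : U z -> g z = 4 * pot_zzb f a z.
  move=> Uz; rewrite /g; case: eqP => [fz|/eqP fz]; last exact: laplacian_pot oU openV UV fH zerof _ _ uE Uz fz.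
  by have [_ _ _ -> _] := pot_at_zero zerof Uz fz; rewrite mulr0.
split; first exact: (Ck1_pot oU openV UV fH zerof uE).
  split; first exact: (Linfty_loc_pot oU openV UV fH zerof gE).
  exact: (laplacian_distr_pot oU openV UV fH zerof uE gE).
exact: (pot_not_Wkinfty oU openV UV fH inj_a zerof N_ge1 uE).
Qed.
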